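(* Let $m>n>1$ be integers and $0<r<1$ be such that $\frac{\log r}{\log m}\notin\mathbb{Q}$ and $\frac{\log r}{\log n}\notin\mathbb{Q}$. Let $\mu\in\mathcal{P}([0,1]^2)$ be a self-similar measure $\mu=\sum_{k=1}^l p_k\,\phi_k\mu$ (with all $p_k>0$, $\sum p_k=1$) with respect to an IFS $\Phi=\{\phi_k(x)=r\,O_k x+t_k\}_{k=1}^l$ on $\mathbb{R}^2$, where each $O_k$ is a $2\times2$ rotation matrix and $t_k\in\mathbb{R}^2$, such that: (1) $\Phi$ satisfies the strong separation condition, has uniform contraction ratio $r$, $\operatorname{supp}(\mu)$ does not lie on a vertical or horizontal line, and $G_\Phi\leq SO(\mathbb{R}^2)$; (2) either $|G_\Phi|<\infty$ or $\dim\mu>1$; (3) if $k_\Phi<\infty$, then for every integer $q\neq 0$, neither $\frac{q}{\log m}$ nor $\frac{q}{\log n}$ belongs to $\mathbb{Z}\cdot\frac{\gamma_\Phi}{\log r\cdot k_\Phi}$. Then $\mu$ is pointwise generic for $\lambda\times\lambda$ under the map $T_m\times T_n$.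
   Context: $T_q(x)=qx\bmod 1$; $T_m\times T_n$ acts coordinatewise on $[0,1]^2\cong\mathbb{T}^2$; $\lambda$ is Lebesgue measure on $[0,1]$. The attractor $X$ of $\Phi$ is the unique nonempty compact set with $X=\bigcup_k\phi_k(X)$; $\Phi$ satisfies the strong separation condition if this union is disjoint. $D\Phi=\{O_k\}_{k=1}^l$, $G_\Phi$ is the subgroup of $SO(\mathbb{R}^2)$ generated by $D\Phi$. $k_\Phi=\min\{k\in\mathbb{N}: O^k=O'^k \text{ for all } O,O'\in D\Phi\}$ (with $\min\emptyset=\infty$); if $k_\Phi<\infty$, $\gamma_\Phi\in[0,2\pi)$ is the unique angle such that $O^{k_\Phi}$ is rotation by $\gamma_\Phi$ for every $O\in D\Phi$. $\dim\mu=\inf\{\dim_H A:\mu(A)>0\}$. A measure $\mu$ is pointwise generic under $T$ for $\rho$ if for $\mu$-a.e. $z$, $\frac1N\sum_{k=0}^{N-1}f(T^kz)\to\int f\,d\rho$ for all $f\in C(\mathbb{T}^2)$. *)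

(* Defs.v *)
From mathcomp Require Import all_boot all_order all_algebra.
From mathcomp Require Import all_classical all_reals all_analysis.
Set Implicit Arguments. Unset Strict Implicit. Unset Printing Implicit Defensive.
Import Order.TTheory GRing.Theory Num.Theory.
Import numFieldNormedType.Exports.
Local Open Scope ring_scope.
Local Open Scope classical_set_scope.

Section Defs.
Variable R : realType.

Definition frac (x : R) : R := x - (Num.floor x)%:~R.
Definition Tq (q : nat) (x : R) : R := frac (q%:R * x).
Definition Tmn (m n : nat) (z : R * R) : R * R := (Tq m z.1, Tq n z.2).

Definition dist2 (z w : R * R) : R :=
  Num.sqrt ((z.1 - w.1) ^+ 2 + (z.2 - w.2) ^+ 2).
Definition diam2 (A : set (R * R)) : R :=
  sup [set dist2 z w | z in A & w in A].

Definition rotmx (theta : R) : 'M[R]_2 :=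
  \matrix_(i < 2, j < 2)
    (if (nat_of_ord i == nat_of_ord j) then cos theta
     else if (nat_of_ord i == 0)%N then - sin theta else sin theta).
Definition mxact (M : 'M[R]_2) (z : R * R) : R * R :=
  (M ord0 ord0 * z.1 + M ord0 ord_max * z.2,
   M ord_max ord0 * z.1 + M ord_max ord_max * z.2).

Definition simil (r : R) (O : 'M[R]_2) (t : R * R) (z : R * R) : R * R :=
  let w := mxact O z in (r * w.1 + t.1, r * w.2 + t.2).

Definition is_attractor (l : nat) (phi : 'I_l -> R * R -> R * R)
  (X : set (R * R)) : Prop :=
  compact X /\ X !=set0 /\ X = \bigcup_(k in [set: 'I_l]) (phi k @` X).
Definition SSC (l : nat) (phi : 'I_l -> R * R -> R * R) : Prop :=
  exists X, is_attractor phi X /\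
    forall i j : 'I_l, i != j -> (phi i @` X) `&` (phi j @` X) = set0.

Definition GPhi (l : nat) (O : 'I_l -> 'M[R]_2) : set 'M[R]_2 :=
  [set M | forall S : set 'M[R]_2,
     S 1%:M -> (forall k, S (O k)) ->
     (forall A B, S A -> S B -> S (A *m B)) ->
     (forall A, S A -> S (invmx A)) -> S M].

Definition same_pow (l : nat) (O : 'I_l -> 'M[R]_2) (k : nat) : Prop :=
  forall i j : 'I_l, O i ^+ k = O j ^+ k.
Definition is_kPhi (l : nat) (O : 'I_l -> 'M[R]_2) (k : nat) : Prop :=
  (0 < k)%N /\ same_pow O k /\ forall j, (0 < j < k)%N -> ~ same_pow O j.
Definition is_gammaPhi (l : nat) (O : 'I_l -> 'M[R]_2) (k : nat) (g : R) :=
  0 <= g < 2 * pi /\ forall i : 'I_l, O i ^+ k = rotmx g.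

Definition hcover_term (s : R) (U : set (R * R)) : R :=
  if pselect (U !=set0) then diam2 U `^ s else 0.
Definition hausdorff_content (s delta : R) (A : set (R * R)) : \bar R :=
  ereal_inf [set (\sum_(0 <= i <oo) (hcover_term s (U i))%:E)%E
            | U in [set U : nat -> set (R * R) |
                    A `<=` \bigcup_i U i /\
                    forall i z w, U i z -> U i w -> dist2 z w <= delta]].
Definition hausdorff_measure (s : R) (A : set (R * R)) : \bar R :=
  ereal_sup [set hausdorff_content s delta A | delta in [set d : R | 0 < d]].
Definition dimH (A : set (R * R)) : \bar R :=
  ereal_inf [set s%:E | s in [set s : R | 0 <= s /\ hausdorff_measure s A = 0%E]].

Definition dim_measure (mu : set (R * R) -> \bar R) : \bar R :=
  ereal_inf [set dimH A | A in [set A | measurable A /\ (0 < mu A)%E]].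

Definition supp (mu : set (R * R) -> \bar R) : set (R * R) :=
  [set z | forall U : set (R * R), open U -> U z -> (0 < mu U)%E].

Definition torus_fun (f : R * R -> R) : Prop :=
  continuous f /\
  forall z : R * R, f (z.1 + 1, z.2) = f z /\ f (z.1, z.2 + 1) = f z.

Definition pointwise_generic_leb (T : R * R -> R * R)
  (mu : set (R * R) -> \bar R) : Prop :=
  {ae mu, forall z, forall f, torus_fun f ->
     (fun N : nat => N%:R^-1 * \sum_(k < N) f (iter k T z)) @ \oo -->
       Rintegral ((@lebesgue_measure R) \x (@lebesgue_measure R))%E
                 (`[0, 1]%classic `*` `[0, 1]%classic) f}.

End Defs.

(* Main.v *)
Require Import Defs.
From mathcomp Require Import all_boot all_order all_algebra.
From mathcomp Require Import all_classical all_reals all_analysis.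
From mathcomp Require Import measurable_realfun ring lra zify.
Set Implicit Arguments. Unset Strict Implicit. Unset Printing Implicit Defensive.
Import Order.TTheory GRing.Theory Num.Theory.
Import numFieldNormedType.Exports.
Local Open Scope ring_scope.
Local Open Scope classical_set_scope.

(* Write the frequencies of [x |-> cos (2 pi (j m^i x_1 + k n^i x_2))] as [xi_i]; up to a
   bounded error they grow like [b^i v] with [v] fixed on an axis and [b = m] or [b = n].  By a
   strong law for exponentially decorrelated variables, the average over [i] of the cosine
   at [mu]-almost every [x] is that of its conditional expectation given the first [n_i]
   digits of [x], with [r^(n_i) b^i] bounded; this expectation is dominated by
   [F^(1/2)], where [F] is the squared modulus of the Fourier transform of [mu] at the frequency
   rescaled by [r^(n_i)] and rotated along those digits.

   A second conditioning replaces [F] by [P^L F], where [P] is the random walk that applies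
   the transposed linear part of a randomly chosen similarity.  Since the linear parts commute,
   a variance count shows that changing one step of the walk alters [P^L F] by
   [O(L^(-1/2))], so the rotations read off the address of [x] may be replaced by powers of
   a single one.  Irrationality gives [q, s] with [b^q r^s] times the [s]-th power of that
   rotation as close to, but different from, [1] as needed; in a suitable time window the
   rescaled frequencies then run through an almost straight, almost arithmetic progression, and
   the average of [F] along it is small unless [mu] charges thin strips.  It does not: a
   line of maximal mass would contain the fixed points of all the maps, hence carry [mu].

   Averages of all nonconstant characters therefore vanish almost everywhere, and Weyl's
   criterion, with the Fejer kernel, concludes. *)

(** The obstacle is that the rotations met along an address depend on the point, so its rescaled
    frequencies follow no explicit orbit. Averaging over [L] free letters hides this dependence: up
    to order, which is irrelevant for plane rotations, a word is given by its letter counts, and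
    these fluctuate by about [L^(1/2)], so that changing one of them by [1] is hardly seen.

    [F] itself need not be small at high frequency; only its time averages are. The multiplier
    [1 + e = b^q r^s rho^s], with [rho] the chosen rotation, must be close to [1] for the window to
    look straight, and different from [1] since a stationary orbit averages nothing; its modulus
    [b^q r^s] is never [1].

    When all linear parts are real, [mu] may sit on a slanted line, whose thin strips are not small.
    Frequencies then keep the direction [v] of the axis, so only strips normal to an axis matter.

    The order of choices shapes the statements: the modulus [C] of the frequencies, the size of [e],
    then [q] and [s], then the window length [M], and last [L], because the cost of exchanging
    letters grows with [M * s]. *)

(** * Bounded measurable functions and their expectations *)

Section BoundedMeasurable.
Context d (T : measurableType d) (R : realType).

(* Bounded measurable functions. *)
Definition bmf (f : T -> R) :=
  measurable_fun setT f /\ exists K, forall x, `|f x| <= K.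

Lemma bmf_cst c : bmf (fun=> c).
Proof. by split; [exact: measurable_cst|exists `|c|]. Qed.

Lemma bmfD f g : bmf f -> bmf g -> bmf (fun x => f x + g x).
Proof.
move=> [mf [K fK]] [mg [L gL]]; split; first exact: measurable_funD.
by exists (K + L) => x; rewrite (le_trans (ler_normD _ _))// lerD.
Qed.

Lemma bmfM f g : bmf f -> bmf g -> bmf (fun x => f x * g x).
Proof.
move=> [mf [K fK]] [mg [L gL]]; split; first exact: measurable_funM.
by exists (K * L) => x; rewrite normrM ler_pM.
Qed.

Lemma bmfN f : bmf f -> bmf (fun x => - f x).
Proof.
move=> bf; have := bmfM (bmf_cst (-1)) bf.
by under eq_fun do rewrite mulN1r.
Qed.

Lemma bmfB f g : bmf f -> bmf g -> bmf (fun x => f x - g x).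
Proof. by move=> bf bg; apply: bmfD => //; exact: bmfN. Qed.

Lemma bmfX f n : bmf f -> bmf (fun x => f x ^+ n).
Proof.
move=> bf; elim: n => [|n IH].
  by under eq_fun do rewrite expr0; exact: bmf_cst.
by under eq_fun do rewrite exprS; exact: bmfM.
Qed.

Lemma bmf_norm f : bmf f -> bmf (fun x => `|f x|).
Proof.
move=> [mf [K fK]]; split; first exact: measurableT_comp.
by exists K => x; rewrite normr_id.
Qed.

Lemma bmf_sum I (s : seq I) (f : I -> T -> R) :
  (forall i, bmf (f i)) -> bmf (fun x => \sum_(i <- s) f i x).
Proof.
move=> bf; elim: s => [|i s IH].
  by under eq_fun do rewrite big_nil; exact: bmf_cst.
by under eq_fun do rewrite big_cons; exact: bmfD.
Qed.

Lemma bmf_indic A : measurable A -> bmf (\1_A).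
Proof.
move=> mA; split; first exact: measurable_indic.
by exists 1 => x; rewrite indicE; case: (_ \in _); rewrite ?normr1 ?normr0.
Qed.

Lemma bmf_comp f (phi : T -> T) : measurable_fun setT phi -> bmf f ->
  bmf (fun x => f (phi x)).
Proof.
move=> mphi [mf [K fK]]; split; first exact: measurableT_comp.
by exists K.
Qed.

End BoundedMeasurable.

Ltac bm := do ?[by [] | exact: bmf_cst | apply: bmfB | apply: bmfN |
  apply: bmfD | apply: bmfM | apply: bmfX | apply: bmf_norm |
  apply: bmf_sum => ?].

Section Expectation.
Context d (T : measurableType d) (R : realType) (mu : probability T R).
Implicit Types f g : T -> R.

Lemma bmf_integrable f : bmf f -> mu.-integrable setT (EFin \o f).
Proof.
move=> [mf [K fK]]; apply: measurable_bounded_integrable => //.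
  by rewrite [X in (X < _)%E]probability_setT ltry.
by exists K; split; [exact: num_real|move=> M KM x _; exact/(le_trans (fK x))/ltW].
Qed.

Definition Ex (f : T -> R) : R := \int[mu]_x f x.

Lemma ExD f g : bmf f -> bmf g -> Ex (fun x => f x + g x) = Ex f + Ex g.
Proof. by move=> bf bg; apply: RintegralD => //; exact: bmf_integrable. Qed.

Lemma ExZ c f : bmf f -> Ex (fun x => c * f x) = c * Ex f.
Proof. by move=> bf; apply: RintegralZl => //; exact: bmf_integrable. Qed.

Lemma ExN f : bmf f -> Ex (fun x => - f x) = - Ex f.
Proof.
move=> bf; rewrite -mulN1r -(ExZ _ bf).
by congr Ex; apply/funext => x; rewrite mulN1r.
Qed.

Lemma ExB f g : bmf f -> bmf g -> Ex (fun x => f x - g x) = Ex f - Ex g.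
Proof. by move=> bf bg; rewrite ExD ?ExN//; exact: bmfN. Qed.

Lemma Ex_sum I (s : seq I) (f : I -> T -> R) : (forall i, bmf (f i)) ->
  Ex (fun x => \sum_(i <- s) f i x) = \sum_(i <- s) Ex (f i).
Proof.
move=> bf; elim: s => [|i s IH].
  rewrite big_nil; under eq_fun do rewrite big_nil.
  by rewrite /Ex Rintegral_cst// mul0r.
rewrite big_cons -IH -ExD//; last exact: bmf_sum.
by congr Ex; apply/funext => x; rewrite big_cons.
Qed.

Lemma Ex_cst c : Ex (fun=> c) = c.
Proof. by rewrite /Ex Rintegral_cst// [X in fine X]probability_setT mulr1. Qed.

Lemma le_Ex f g : bmf f -> bmf g -> (forall x, f x <= g x) -> Ex f <= Ex g.
Proof. by move=> bf bg fg; apply: le_Rintegral => //; exact: bmf_integrable. Qed.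

Lemma Ex_ge0 f : (forall x, 0 <= f x) -> 0 <= Ex f.
Proof. by move=> f0; exact: Rintegral_ge0. Qed.

Lemma Ex_indic A : measurable A -> Ex (\1_A) = fine (mu A).
Proof. by move=> mA; rewrite /Ex /Rintegral integral_indic// setIT. Qed.

Lemma Ex_ae f g A : bmf f -> bmf g -> measurable A -> mu A = 1%E ->
  (forall x, A x -> f x = g x) -> Ex f = Ex g.
Proof.
move=> bf bg mA A1 fg; rewrite /Ex /Rintegral; congr fine.
apply: ae_eq_integral => //; [exact/measurable_EFinP/bf.1|exact/measurable_EFinP/bg.1|].
exists (~` A); split; first exact: measurableC.
  by apply: etrans (probability_setC mu mA) _; rewrite A1 subee.
by move=> x /= h Ax; apply: h => _; rewrite fg.
Qed.

Lemma le_Ex_ae f g A : bmf f -> bmf g -> measurable A -> mu A = 1%E ->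
  (forall x, A x -> f x <= g x) -> Ex f <= Ex g.
Proof.
move=> bf bg mA A1 fg.
have b1 : bmf (fun x => f x * \1_A x) by apply: bmfM => //; exact: bmf_indic.
have b2 : bmf (fun x => g x * \1_A x) by apply: bmfM => //; exact: bmf_indic.
rewrite (@Ex_ae f (fun x => f x * \1_A x) A)//; last first.
  by move=> x Ax; rewrite indicE mem_set// mulr1.
rewrite (@Ex_ae g (fun x => g x * \1_A x) A)//; last first.
  by move=> x Ax; rewrite indicE mem_set// mulr1.
apply: le_Ex => // x; rewrite indicE; case: (boolP (x \in A)) => [/set_mem/fg|_].
  by rewrite !mulr1.
by rewrite !mulr0.
Qed.

Lemma ler_norm_Ex f K : bmf f -> (forall x, `|f x| <= K) -> `|Ex f| <= K.
Proof.
move=> bf fK; rewrite ler_norml; apply/andP; split.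
  rewrite -(Ex_cst (- K)); apply: le_Ex => //; first exact: bmf_cst.
  by move=> x; move: (fK x); rewrite ler_norml => /andP[].
rewrite -[leRHS](Ex_cst K); apply: le_Ex => //; first exact: bmf_cst.
by move=> x; move: (fK x); rewrite ler_norml => /andP[].
Qed.

Lemma ler_norm_Ex_ae f K A : bmf f -> measurable A -> mu A = 1%E ->
  (forall x, A x -> `|f x| <= K) -> `|Ex f| <= K.
Proof.
move=> bf mA A1 fK; rewrite ler_norml; apply/andP; split.
  rewrite -(Ex_cst (- K)); apply: (le_Ex_ae _ _ mA) => //; first exact: bmf_cst.
  by move=> x; move/(fK x); rewrite ler_norml => /andP[].
rewrite -[leRHS](Ex_cst K); apply: (le_Ex_ae _ _ mA) => //; first exact: bmf_cst.
by move=> x; move/(fK x); rewrite ler_norml => /andP[].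
Qed.

Lemma Ex_sqr_ge f : bmf f -> Ex f ^+ 2 <= Ex (fun x => f x ^+ 2).
Proof.
move=> bf; rewrite -subr_ge0.
have -> : Ex (fun x => f x ^+ 2) - Ex f ^+ 2 = Ex (fun x => (f x - Ex f) ^+ 2).
  transitivity (Ex (fun x => f x ^+ 2 + ((- 2 * Ex f) * f x + Ex f ^+ 2))).
    rewrite ExD ?ExD ?ExZ ?Ex_cst; do ?bm.
    by ring.
  by congr Ex; apply/funext => x; ring.
by apply: Ex_ge0 => x; exact: sqr_ge0.
Qed.

End Expectation.

(** * A strong law of large numbers *)

Section StrongLaw.
Context d (T : measurableType d) (R : realType) (mu : probability T R).

Lemma sum_inv_sqr_le n : \sum_(0 <= k < n) (k.+1%:R ^+ 2)^-1 <= 2 :> R.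
Proof.
(* The induction runs on the sharper bound [2 - 1/(n+1)], whose increment [1/(n+1) - 1/(n+2)]
   dominates the new term [1/(n+2)^2]. *)
suff H : \sum_(0 <= k < n.+1) (k.+1%:R ^+ 2)^-1 <= 2 - n.+1%:R^-1 :> R.
  case: n H => [|n] H; first by rewrite big_nil.
  apply: (@le_trans _ _ (2 - n.+2%:R^-1)); last by rewrite gerBl invr_ge0.
  by apply: le_trans H; rewrite [leRHS]big_nat_recr//= lerDl invr_ge0 sqr_ge0.
elim: n => [|n IH]; first by rewrite big_nat1 expr1n invr1; lra.
rewrite big_nat_recr//=.
apply: (le_trans (lerD IH (lexx _))).
have h1 : 0 < n.+1%:R :> R by rewrite ltr0n.
have e2 : n.+2%:R = n.+1%:R + 1 :> R by rewrite -natr1.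
rewrite e2; set y := n.+1%:R in h1 *.
rewrite -subr_ge0.
have -> : 2 - (y + 1)^-1 - (2 - y^-1 + ((y + 1) ^+ 2)^-1) = (y * (y + 1) ^+ 2)^-1.
  by field; rewrite ?lt0r_neq0//; lra.
by rewrite invr_ge0 mulr_ge0 ?sqr_ge0// ltW.
Qed.

(** The expectations are summable, so the series of the [f k] is integrable, hence finite almost
    everywhere, and there its terms tend to [0]. *)
Lemma Ex_series_cvg0 (f : nat -> T -> R) (C : R) :
  (forall k, bmf (f k)) -> (forall k x, 0 <= f k x) ->
  (forall k, Ex mu (f k) <= C / k.+1%:R ^+ 2) ->
  {ae mu, forall x, f ^~ x @ \oo --> 0}.
Proof.
move=> bf f0 fC.
have mf k : measurable_fun setT (EFin \o f k) by apply/measurable_EFinP; exact: (bf k).1.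
have C0 : 0 <= C.
  have := fC 0%N; rewrite expr1n divr1; apply: le_trans; exact: Ex_ge0.
pose g x := (\sum_(k <oo) (f k x)%:E)%E.
have ig : mu.-integrable setT g.
  apply/integrableP; split.
    apply: (@ge0_emeasurable_sum _ _ _ _ (fun k x => (f k x)%:E)) => //.
      by move=> k x _ _; rewrite lee_fin.
    by move=> k _; exact: mf.
  rewrite [X in (X < _)%E](_ : _ = \int[mu]_x g x)%E; last first.
    apply: eq_integral => x _; rewrite gee0_abs//.
    by apply: nneseries_ge0 => k _ _; rewrite lee_fin.
  rewrite integral_nneseries//; last by move=> k x _; rewrite lee_fin.
  apply: (@le_lt_trans _ _ (C * 2)%:E); last by rewrite ltry.
  apply: lime_le.
    by apply: is_cvg_nneseries => k _ _; apply: integral_ge0 => x _; rewrite lee_fin.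
  apply: nearW => n.
  apply: (@le_trans _ _ (\sum_(0 <= k < n) (C * (k.+1%:R ^+ 2)^-1)%:E)%E).
    apply: lee_sum => k _.
    rewrite -[leLHS]fineK ?lee_fin; first exact: fC.
    exact: integrable_fin_num (bmf_integrable mu (bf k)).
  rewrite sumEFin lee_fin.
  by rewrite -mulr_sumr ler_wpM2l// sum_inv_sqr_le.
have [_] := integrableP _ _ _ ig; move=> _.
have := integrable_ae measurableT ig.
apply: filterS => x /(_ I) fing.
apply: cvg_series_cvg_0.
apply: nondecreasing_is_cvgn.
  move=> a b ab; rewrite /series/=.
  rewrite -(subnKC ab) /index_iota !subn0 iotaD big_cat/= lerDl.
  exact: sumr_ge0.
exists (fine (g x)) => _ [n _ <-].
rewrite -lee_fin fineK// /series/= -sumEFin.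
by apply: nneseries_lim_ge => k _; rewrite lee_fin.
Qed.

(** Between the consecutive squares around [N] lie only [O(sqrt N)] terms, each at most [B], so the
    averages along squares control all averages. The square in the hypothesis is the form in which
    second moments provide it. *)
Lemma subsequence_sqr_cvg0 (y : nat -> R) (B : R) :
  (forall i, `|y i| <= B) ->
  (fun k => ((k.+1 ^ 2)%N%:R^-1 * \sum_(i < (k.+1 ^ 2)%N) y i) ^+ 2) @ \oo --> 0 ->
  (fun N : nat => N%:R^-1 * \sum_(i < N) y i) @ \oo --> 0.
Proof.
move=> yB H.
have B0 : 0 <= B by apply: le_trans (yB 0%N).
apply/cvgrPdist_le => e e0.
have e2 : 0 < (e / 2) ^+ 2 by rewrite exprn_gt0// divr_gt0.
move/cvgrPdist_le: H => /(_ _ e2)[k0 _ Hk0].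
have [k1 Hk1] : exists k1 : nat, 6 * B / e <= k1%:R.
  by exists (Num.bound (6 * B / e)); apply/ltW/archi_boundP; apply: divr_ge0; [exact: mulr_ge0|exact: ltW].
pose k2 := maxn k0 k1.
exists (k2.+1 ^ 2)%N => // N /= leN.
rewrite sub0r normrN.
have [k [kk2 kN Nk]] : exists k, [/\ (k2 <= k)%N, (k.+1 ^ 2 <= N)%N & (N < k.+2 ^ 2)%N].
  have ex : exists j, (j.+1 ^ 2 <= N)%N by exists k2.
  have ub j : (j.+1 ^ 2 <= N)%N -> (j <= N)%N by nia.
  case: (ex_maxnP ex ub) => k hk hmax; exists k; split => //; first exact: hmax.
  by rewrite ltnNge; apply/negP => /hmax; rewrite ltnn.
have N0 : 0 < N%:R :> R by rewrite ltr0n; nia.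
set n := (k.+1 ^ 2)%N in kN.
have n0 : 0 < n%:R :> R by rewrite ltr0n /n; nia.
have h1 : `|\sum_(i < n) y i| <= e / 2 * n%:R.
  have := Hk0 k (leq_trans (leq_maxl _ _) kk2).
  rewrite sub0r normrN ger0_norm ?sqr_ge0// -real_normK ?num_real//.
  rewrite ler_sqr ?nnegrE//; last by rewrite divr_ge0// ltW.
  rewrite normrM normfV (ger0_norm (ltW n0)).
  by rewrite ler_pdivrMl// mulrC.
have h2 : `|\sum_(i < N) y i - \sum_(i < n) y i| <= B * (N - n)%:R.
  rewrite -!(big_mkord xpredT y) -{1}(subnKC kN) /index_iota !subn0 iotaD big_cat/= add0n.
  rewrite addrAC subrr add0r; apply: (le_trans (ler_norm_sum _ _ _)).
  apply: (le_trans (ler_sum _ (fun i _ => yB i))).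
  by rewrite big_const_seq count_predT size_iota iter_addr_0 mulr_natr.
have h3 : (N - n)%:R * (2 * B) <= e * N%:R.
  (* The gap [N - n] is at most [2k + 2] and [n = (k+1)^2 <= N]; with [k1 >= 6B/e] the tail is then
     at most half of [e N]. *)
  have : ((N - n) * k.+1 <= 3 * N)%N by rewrite /n in kN *; nia.
  rewrite -(ler_nat R) !natrM => h3.
  have k3 : 6 * B <= k.+1%:R * e.
    rewrite -ler_pdivrMr//; apply: (le_trans Hk1); rewrite ler_nat.
    by apply: (leq_trans (leq_maxr k0 k1)); apply: leq_trans kk2 _.
  have kp : 0 < k.+1%:R :> R by rewrite ltr0n.
  rewrite -(ler_pM2l kp).
  have : (N - n)%:R * k.+1%:R * (2 * B) <= 3 * N%:R * (2 * B).
    by rewrite ler_wpM2r// mulr_ge0.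
  have : 6 * B * N%:R <= k.+1%:R * e * N%:R by rewrite ler_wpM2r// ltW.
  lra.
rewrite normrM normfV (ger0_norm (ltW N0)) ler_pdivrMl//.
have -> : \sum_(i < N) y i =
  (\sum_(i < N) y i - \sum_(i < n) y i) + \sum_(i < n) y i by ring.
apply: (le_trans (ler_normD _ _)).
have : n%:R <= N%:R :> R by rewrite ler_nat.
move=> hnN.
have : e / 2 * n%:R <= e / 2 * N%:R by rewrite ler_wpM2l// divr_ge0// ltW.
lra.
Qed.

(** Along [N = (k+1)^2] the averages have second moment at most [C / (k+1)^2], which is summable.
    The pointwise bound is asked only on a set [A] of full measure because digits make sense only on
    the attractor. *)
Lemma strong_law (Y : nat -> T -> R) (A : set T) (B C : R) :
  measurable A -> mu A = 1%E ->
  (forall i, bmf (Y i)) -> (forall i x, A x -> `|Y i x| <= B) ->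
  (forall N, Ex mu (fun x => (\sum_(i < N) Y i x) ^+ 2) <= C * N%:R) ->
  {ae mu, forall x, (fun N : nat => N%:R^-1 * \sum_(i < N) Y i x) @ \oo --> 0}.
Proof.
move=> mA A1 bY YB YC.
pose f k x := ((k.+1 ^ 2)%N%:R^-1 * \sum_(i < (k.+1 ^ 2)%N) Y i x) ^+ 2.
have bS N : bmf (fun x => \sum_(i < N) Y i x) by apply: bmf_sum => i; exact: bY.
have := @Ex_series_cvg0 f C; case.
- by move=> k; apply: bmfX; apply: bmfM => //; exact: bmf_cst.
- by move=> k x; exact: sqr_ge0.
- move=> k; rewrite /f.
  have -> : (fun x => ((k.+1 ^ 2)%N%:R^-1 * \sum_(i < (k.+1 ^ 2)%N) Y i x) ^+ 2)
      = (fun x => (k.+1 ^ 2)%N%:R^-1 ^+ 2 * (\sum_(i < (k.+1 ^ 2)%N) Y i x) ^+ 2).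
    by apply/funext => x; rewrite exprMn.
  rewrite ExZ; last exact: bmfX.
  rewrite -natrX; set n := (k.+1 ^ 2)%N.
  have n0 : 0 < n%:R :> R by rewrite ltr0n /n; nia.
  apply: (@le_trans _ _ (n%:R^-1 ^+ 2 * (C * n%:R))).
    by rewrite ler_wpM2l// sqr_ge0.
  by rewrite le_eqVlt; apply/orP; left; apply/eqP; field; rewrite lt0r_neq0.
move=> N [mN N0 sN].
exists (N `|` ~` A); split.
- by apply: measurableU => //; exact: measurableC.
- apply/eqP; rewrite eq_le measure_ge0 andbT.
  apply: (le_trans (measureU2 _ mN (measurableC mA))).
  have c0 : mu (~` A) = 0%E.
    by apply: etrans (probability_setC mu mA) _; rewrite A1 subee.
  rewrite [X in (X <= _)%E](_ : _ = 0%E)//.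
  by apply: etrans (f_equal2 (fun a b => a + b)%E N0 c0) _; exact: adde0.
- move=> x /= Hx; have [Ax|] := pselect (A x); last by right.
  left; apply: sN => /= Hf; apply: Hx.
  by apply: (@subsequence_sqr_cvg0 (Y ^~ x) B) => // i; exact: YB.
Qed.

Lemma sum_geometric_le (lam : R) n : 0 <= lam < 1 ->
  \sum_(i < n) lam ^+ i <= (1 - lam)^-1.
Proof.
move=> /andP[l0 l1]; rewrite -(mul1r (_^-1)) ler_pdivlMr ?subr_gt0//.
elim: n => [|n IH]; first by rewrite big_ord0 mul0r.
suff -> : (\sum_(i < n.+1) lam ^+ i) * (1 - lam) = 1 - lam ^+ n.+1.
  by rewrite gerBl exprn_ge0.
elim: n {IH} => [|n IH]; first by rewrite big_ord1 expr0 expr1 mul1r.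
by rewrite big_ord_recr/= mulrDl IH [in RHS]exprS; ring.
Qed.

(** One more variable costs twice its correlations with the earlier ones and itself, a geometric
    series, so the second moment grows at most linearly. *)
Lemma second_moment_le (Y : nat -> T -> R) (K lam : R) :
  (forall i, bmf (Y i)) -> 0 <= lam < 1 ->
  (forall i j, (i <= j)%N -> `|Ex mu (fun x => Y i x * Y j x)| <= K * lam ^+ (j - i)) ->
  forall N, Ex mu (fun x => (\sum_(i < N) Y i x) ^+ 2) <= (2 * K / (1 - lam)) * N%:R.
Proof.
move=> bY hlam cov; elim => [|N IH].
  rewrite mulr0; under eq_fun do rewrite big_ord0 expr0n/=.
  by rewrite Ex_cst.
have K0 : 0 <= K.
  by have := cov 0%N 0%N (leqnn _); rewrite subnn expr0 mulr1; exact: le_trans.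
have bS M : bmf (fun x => \sum_(i < M) Y i x) by apply: bmf_sum => i; exact: bY.
(* The diagonal term is put inside the cross sum and subtracted once; the subtraction has the
   favourable sign and is dropped. *)
have -> : (fun x => (\sum_(i < N.+1) Y i x) ^+ 2) =
    (fun x => (\sum_(i < N) Y i x) ^+ 2 + (2 * (\sum_(i < N.+1) Y i x * Y N x) + (- (Y N x * Y N x)))).
  by apply/funext => x; rewrite -mulr_suml !big_ord_recr/=; ring.
have bYY i j : bmf (fun x => Y i x * Y j x) by bm.
rewrite ExD; [|by bm|by bm; move=> *; bm].
rewrite ExD; [|by bm; move=> *; bm|by bm].
rewrite ExZ; last by bm.
rewrite Ex_sum; last by bm.
rewrite ExN//.
have h1 : 0 <= Ex mu (fun x => Y N x * Y N x).
  by apply: Ex_ge0 => x; rewrite -expr2 sqr_ge0.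
have h2 : \sum_(i < N.+1) Ex mu (fun x => Y i x * Y N x) <= K / (1 - lam).
  apply: (@le_trans _ _ (\sum_(i < N.+1) K * lam ^+ (N - i))).
    apply: ler_sum => i _; apply: (le_trans (ler_norm _)); apply: cov.
    by rewrite -ltnS.
  rewrite -mulr_sumr ler_wpM2l//.
  rewrite (reindex_inj rev_ord_inj)/=.
  apply: le_trans (sum_geometric_le N.+1 hlam).
  by apply: ler_sum => i _; rewrite subSS subKn// -ltnS.
rewrite -[N.+1%:R]natr1 mulrDr mulr1.
by move: IH h1 h2; rewrite -(mulrA 2 K); lra.
Qed.

End StrongLaw.

(** * The complex plane *)

Section Plane.
Variable R : realType.
Implicit Types (z w u v : R * R).

(* The plane is identified with the complex numbers: [cmul] is their product, and the linear
   part of a similarity of ratio [r] is the product by a number of modulus [r]. *)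
Definition dot z w : R := z.1 * w.1 + z.2 * w.2.
Definition cmul z w : R * R := (z.1 * w.1 - z.2 * w.2, z.1 * w.2 + z.2 * w.1).
Definition conj z : R * R := (z.1, - z.2).
Definition sc (a : R) z : R * R := (a * z.1, a * z.2).
Definition nrm z : R := Num.sqrt (z.1 ^+ 2 + z.2 ^+ 2).

Lemma cmulA u v w : cmul u (cmul v w) = cmul (cmul u v) w.
Proof. by rewrite /cmul /=; congr pair; ring. Qed.

Lemma cmulC u v : cmul u v = cmul v u.
Proof. by rewrite /cmul /=; congr pair; ring. Qed.

Lemma cmulDr u v w : cmul u (v + w) = cmul u v + cmul u w.
Proof. by rewrite /cmul /=; congr pair => /=; ring. Qed.

Lemma cmulBr u v w : cmul u (v - w) = cmul u v - cmul u w.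
Proof. by rewrite /cmul /=; congr pair => /=; ring. Qed.

Lemma cmulDl u v w : cmul (u + v) w = cmul u w + cmul v w.
Proof. by rewrite /cmul /=; congr pair => /=; ring. Qed.

Lemma cmulBl u v w : cmul (u - v) w = cmul u w - cmul v w.
Proof. by rewrite /cmul /=; congr pair => /=; ring. Qed.

Lemma cmul1 u : cmul (1, 0) u = u.
Proof. by case: u => a b; rewrite /cmul /=; congr pair; ring. Qed.

Lemma conjM u v : conj (cmul u v) = cmul (conj u) (conj v).
Proof. by rewrite /cmul /conj /=; congr pair; ring. Qed.

Lemma dot_cmul u v w : dot u (cmul v w) = dot (cmul (conj v) u) w.
Proof. by rewrite /dot /cmul /=; ring. Qed.

Lemma dotDr u v w : dot u (v + w) = dot u v + dot u w.
Proof. by rewrite /dot /=; ring. Qed.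

Lemma dotBr u v w : dot u (v - w) = dot u v - dot u w.
Proof. by rewrite /dot /=; ring. Qed.

Lemma dotBl u v w : dot (u - v) w = dot u w - dot v w.
Proof. by rewrite /dot /=; ring. Qed.

Lemma dotZl a v w : dot (sc a v) w = a * dot v w.
Proof. by rewrite /sc /dot/=; ring. Qed.

Lemma cmulZl a v w : cmul (sc a v) w = sc a (cmul v w).
Proof. by rewrite /sc /cmul/=; congr pair; ring. Qed.

Lemma nrm_ge0 z : 0 <= nrm z. Proof. exact: sqrtr_ge0. Qed.

Lemma sqr_nrm z : nrm z ^+ 2 = z.1 ^+ 2 + z.2 ^+ 2.
Proof. by rewrite sqr_sqrtr// addr_ge0// sqr_ge0. Qed.

Lemma nrm_le z (K : R) : 0 <= K -> (nrm z <= K) = (z.1 ^+ 2 + z.2 ^+ 2 <= K ^+ 2).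
Proof. by move=> K0; rewrite -sqr_nrm ler_sqr// nnegrE// nrm_ge0. Qed.

Lemma nrmM z w : nrm (cmul z w) = nrm z * nrm w.
Proof.
apply/eqP; rewrite -(@eqrXn2 _ 2)//; last 2 first.
- exact: nrm_ge0.
- by rewrite mulr_ge0// nrm_ge0.
by rewrite exprMn !sqr_nrm /cmul/=; apply/eqP; ring.
Qed.

Lemma nrm_conj z : nrm (conj z) = nrm z.
Proof. by rewrite /nrm /conj/= sqrrN. Qed.

Lemma nrmN z : nrm (- z) = nrm z.
Proof. by rewrite /nrm /= !sqrrN. Qed.

Lemma nrmZ a z : nrm (sc a z) = `|a| * nrm z.
Proof.
rewrite /sc /nrm /= !exprMn -mulrDr sqrtrM ?sqr_ge0//.
by rewrite sqrtr_sqr.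
Qed.

Lemma nrm0 : nrm 0 = 0.
Proof. by rewrite /nrm/= expr0n/= addr0 sqrtr0. Qed.

Lemma nrm_eq0 z : (nrm z == 0) = (z == 0).
Proof.
apply/eqP/eqP => [h|->]; last exact: nrm0.
have : z.1 ^+ 2 + z.2 ^+ 2 = 0 by rewrite -sqr_nrm h expr0n.
move/eqP; rewrite paddr_eq0 ?sqr_ge0// !sqrf_eq0 => /andP[/eqP a /eqP b].
by apply/eqP; rewrite -pair_eqE /pair_eq/= a b !eqxx.
Qed.

Lemma ler_dot_nrm z w : `|dot z w| <= nrm z * nrm w.
Proof.
rewrite -ler_sqr ?nnegrE ?mulr_ge0 ?nrm_ge0//.
rewrite real_normK ?num_real// exprMn !sqr_nrm /dot -subr_ge0.
suff -> : (z.1 ^+ 2 + z.2 ^+ 2) * (w.1 ^+ 2 + w.2 ^+ 2) -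
  (z.1 * w.1 + z.2 * w.2) ^+ 2 = (z.1 * w.2 - z.2 * w.1) ^+ 2 by exact: sqr_ge0.
by ring.
Qed.

Lemma nrmD z w : nrm (z + w) <= nrm z + nrm w.
Proof.
rewrite nrm_le ?addr_ge0 ?nrm_ge0// [leRHS]sqrrD !sqr_nrm /=.
have := le_trans (ler_norm _) (ler_dot_nrm z w); rewrite /dot => h.
rewrite -mulr_natr; lra.
Qed.

Lemma ler_nrm z : `|z| <= nrm z.
Proof.
rewrite prod_normE ge_max/=; apply/andP; split;
  rewrite -ler_sqr ?nnegrE ?nrm_ge0// real_normK ?num_real// sqr_nrm.
  by rewrite lerDl sqr_ge0.
by rewrite lerDr sqr_ge0.
Qed.

Lemma nrm_ler z : nrm z <= 2 * `|z|.
Proof.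
rewrite nrm_le ?mulr_ge0//.
have h1 : `|z.1| <= `|z| by rewrite prod_normE le_max lexx.
have h2 : `|z.2| <= `|z| by rewrite prod_normE le_max lexx orbT.
have : `|z.1| ^+ 2 <= `|z| ^+ 2 by rewrite ler_sqr ?nnegrE.
have : `|z.2| ^+ 2 <= `|z| ^+ 2 by rewrite ler_sqr ?nnegrE.
rewrite !real_normK ?num_real// exprMn.
have : 0 <= `|z| ^+ 2 by rewrite exprn_ge0.
lra.
Qed.

Definition cis (th : R) : R * R := (cos th, sin th).
Lemma nrm_cis th : nrm (cis th) = 1.
Proof. by rewrite /nrm /cis/= cos2Dsin2 sqrtr1. Qed.

Lemma similE r th t z : simil r (rotmx th) t z = cmul (sc r (cis th)) z + t.
Proof.
rewrite /sc /simil /mxact /rotmx !mxE/= /cmul /cis/=.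
by congr pair => /=; ring.
Qed.

Lemma measurable_dot v : measurable_fun setT (dot v).
Proof.
apply: measurable_funD; apply: measurable_funM => //.
Qed.

Lemma measurable_cmulD a b : measurable_fun setT (fun z => cmul a z + b).
Proof.
apply/measurable_fun_pairP; split.
  rewrite (_ : _ \o _ = fun z => a.1 * z.1 - a.2 * z.2 + b.1)//.
  apply: measurable_funD => //; apply: measurable_funB; exact: measurable_funM.
rewrite (_ : _ \o _ = fun z => a.1 * z.2 + a.2 * z.1 + b.2)//.
apply: measurable_funD => //; apply: measurable_funD; exact: measurable_funM.
Qed.

(** Measurability on [R * R] refers to the product sigma-algebra, so an open set is written as a
    countable union of boxes with rational centres and half-sides [1/(n+1)]. *)
Lemma open_measurable_plane (U : set (R * R)) : open U -> measurable U.
Proof.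
move=> oU.
pose box (i : rat * rat * nat) : set (R * R) :=
  ball (ratr i.1.1 : R) (i.2.+1%:R^-1) `*` ball (ratr i.1.2 : R) (i.2.+1%:R^-1).
have -> : U = \bigcup_i (if `[< box i `<=` U >] then box i else set0).
  apply/seteqP; split => [z Uz|z [i _]]; last first.
    by case: asboolP => // + Bz; apply.
  have /nbhs_ballP[e /= e0 eU] : nbhs z U by rewrite nbhsE; exists U.
  have [n hn] : exists n : nat, n.+1%:R^-1 < e / 2.
    have := @cvg_harmonic R => /cvgrPdist_lt /(_ (e / 2)); case; first by rewrite divr_gt0.
    move=> n _ /(_ n (leqnn _)); rewrite /harmonic/= sub0r normrN ger0_norm// => h.
    by exists n.
  have n0 : 0 < n.+1%:R^-1 :> R by rewrite invr_gt0.
  have [q1 hq1] : exists q : rat, ball (z.1 : R) (n.+1%:R^-1) (ratr q : R).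
    have [y [hy [q _ qy]]] := @dense_rat R (ball (z.1 : R) (n.+1%:R^-1)) ltac:(by exists z.1; exact: ballxx) (ball_open _ _).
    by exists q; rewrite qy.
  have [q2 hq2] : exists q : rat, ball (z.2 : R) (n.+1%:R^-1) (ratr q : R).
    have [y [hy [q _ qy]]] := @dense_rat R (ball (z.2 : R) (n.+1%:R^-1)) ltac:(by exists z.2; exact: ballxx) (ball_open _ _).
    by exists q; rewrite qy.
  exists (q1, q2, n) => //; rewrite asboolT.
    by split; apply: ball_sym.
  have le_e : n.+1%:R^-1 + n.+1%:R^-1 <= e by rewrite [leRHS]splitr lerD// ltW.
  move=> w [/= w1 w2]; apply: eU; split.
    exact: (@le_ball R R _ _ _ le_e) (ball_triangle hq1 w1).
  exact: (@le_ball R R _ _ _ le_e) (ball_triangle hq2 w2).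
apply: countable_bigcupT_measurable => [|i]; first exact: countableP.
case: asboolP => // _; apply: measurableX; apply: open_measurable; exact: ball_open.
Qed.

Lemma closed_measurable_plane (U : set (R * R)) : closed U -> measurable U.
Proof.
move=> cU; rewrite -(setCK U); apply: measurableC; apply: open_measurable_plane.
exact: closed_openC.
Qed.

Lemma continuous_dot v : continuous (dot v).
Proof.
move=> z; apply: cvgD; apply: cvgM; [exact: cvg_cst|exact: cvg_fst|exact: cvg_cst|exact: cvg_snd].
Qed.

Lemma continuous_nrm : continuous nrm.
Proof.
move=> z; apply: continuous_cvg; first exact: sqrt_continuous.
apply: cvgD; under eq_fun do rewrite expr2; rewrite expr2; apply: cvgM;
  by [exact: cvg_fst|exact: cvg_snd].
Qed.

Lemma continuous_cmulD a b : continuous (fun z => cmul a z + b).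
Proof.
move=> z; apply: cvgD; last exact: cvg_cst.
apply: (@cvg_pair _ _ _ _ (nbhs (cmul a z).1) (nbhs (cmul a z).2)).
  apply: cvgB; apply: cvgM; [exact: cvg_cst|exact: cvg_fst|exact: cvg_cst|exact: cvg_snd].
apply: cvgD; apply: cvgM; [exact: cvg_cst|exact: cvg_snd|exact: cvg_cst|exact: cvg_fst].
Qed.

End Plane.

(** * Real-valued probabilities of sets *)

Section RealProbability.
Context d (T : measurableType d) (R : realType) (mu : probability T R).

Definition prb (A : set T) : R := fine (mu A).

Lemma prbE A : measurable A -> mu A = (prb A)%:E.
Proof. by move=> mA; rewrite /prb fineK//; exact: fin_num_measure. Qed.

Lemma prb_ge0 A : 0 <= prb A. Proof. by rewrite fine_ge0. Qed.

Lemma prbT : prb setT = 1.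
Proof. by rewrite /prb [X in fine X]probability_setT. Qed.

Lemma le_prb A B : measurable A -> measurable B -> A `<=` B -> prb A <= prb B.
Proof. by move=> mA mB AB; rewrite -lee_fin -!prbE//; apply: le_measure => //; rewrite inE. Qed.

Lemma prb_le1 A : measurable A -> prb A <= 1.
Proof. by move=> mA; rewrite -prbT; apply: le_prb. Qed.

Lemma prb_set0 : prb set0 = 0.
Proof. by rewrite /prb measure0. Qed.

Lemma prb1 A : measurable A -> prb A = 1 -> mu A = 1%E.
Proof. by move=> mA A1; rewrite prbE// A1. Qed.

Lemma prb_Ex A : measurable A -> prb A = Ex mu (\1_A).
Proof. by move=> mA; rewrite Ex_indic. Qed.

Lemma prbUI A B : measurable A -> measurable B ->
  prb (A `|` B) = prb A + prb B - prb (A `&` B).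
Proof.
move=> mA mB; have mU := measurableU _ _ mA mB; have mI := measurableI _ _ mA mB.
rewrite !prb_Ex// -ExD -?ExB; do ?bm; do ?exact: bmf_indic.
  congr Ex; apply/funext => x; rewrite !indicE in_setU in_setI.
  by case: (x \in A); case: (x \in B) => /=; ring.
Qed.

Lemma prb_setC A : measurable A -> prb (~` A) = 1 - prb A.
Proof.
move=> mA; have := prbUI mA (measurableC mA).
by rewrite setUv setICr prb_set0 subr0 prbT => ->; rewrite addrC addKr.
Qed.

Lemma prb_cvg (F : (set T)^nat) : (forall n, measurable (F n)) ->
  (forall n m, (n <= m)%N -> F m `<=` F n) ->
  prb \o F @ \oo --> prb (\bigcap_n F n).
Proof.
move=> mF dF; have mc : measurable (\bigcap_n F n) by exact: bigcapT_measurable.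
apply: fine_cvg; rewrite -prbE//; apply: (nonincreasing_cvg_mu (mu := mu)) => //.
  by rewrite ltey_eq fin_num_measure.
by apply/nonincreasing_seqP => n; apply/subsetPset; exact: dF.
Qed.

End RealProbability.

(** * Self-similar measures *)

Definition similarity (R : realType) (l : nat) (a t : 'I_l -> R * R) k z := cmul (a k) z + t k.

Record self_similar (R : realType) (l : nat) (r : R) (p : 'I_l -> R)
    (a t : 'I_l -> R * R) (mu : probability (R * R)%type R) : Prop := SelfSimilar {
  ratio01 : 0 < r < 1;
  nrma : forall k, nrm (a k) = r;
  p_gt0 : forall k, 0 < p k;
  sum_p : \sum_(k < l) p k = 1;
  mu_box : mu (`[0, 1]%classic `*` `[0, 1]%classic) = 1%E;
  mu_self : forall A, measurable A ->
     mu A = (\sum_(k < l) (p k)%:E * mu (similarity a t k @^-1` A))%E }.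

Section SelfSimilarMeasure.
Context (R : realType) (l : nat) (r : R) (p : 'I_l -> R) (a t : 'I_l -> R * R).
Context (mu : probability (R * R)%type R) (ss : self_similar r p a t mu).
Local Notation phi := (similarity a t).
Local Notation nrma := (nrma ss).
Local Notation p_gt0 := (p_gt0 ss).
Local Notation sum_p := (sum_p ss).
Local Notation mu_box := (mu_box ss).
Local Notation mu_self := (mu_self ss).
Local Notation r01 := (ratio01 ss).

Lemma r_gt0 : 0 < r. Proof. by have /andP[] := r01. Qed.
Lemma r_lt1 : r < 1. Proof. by have /andP[] := r01. Qed.

Lemma nrm_phiB k x y : nrm (phi k x - phi k y) = r * nrm (x - y).
Proof.
by rewrite opprD addrACA subrr addr0 -cmulBr nrmM nrma.
Qed.

(** The multiplier [conj (a k) / r^2] is the complex inverse of [a k], whose modulus is [r]. *)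
Definition phiV k z : R * R := cmul (sc (r ^- 2) (conj (a k))) (z - t k).

Let sqr_a k : (a k).1 ^+ 2 + (a k).2 ^+ 2 = r ^+ 2.
Proof. by rewrite -sqr_nrm nrma. Qed.

Lemma cmul_conj_a k z : cmul (sc (r ^- 2) (conj (a k))) (cmul (a k) z) = z.
Proof.
case: z => x y; rewrite cmulA cmulZl.
have -> : cmul (conj (a k)) (a k) = (r ^+ 2, 0).
  by rewrite -(sqr_a k) /cmul /conj/=; congr pair; ring.
rewrite /sc/= mulVf ?mulr0 ?cmul1// expf_neq0// lt0r_neq0//; exact: r_gt0.
Qed.

Lemma phiK k : cancel (phi k) (phiV k).
Proof. by move=> z; rewrite /phiV addrK cmul_conj_a. Qed.

Lemma phiVK k : cancel (phiV k) (phi k).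
Proof.
move=> z; rewrite /phiV /similarity cmulA (cmulC (a k)) -cmulA cmul_conj_a.
by rewrite subrK.
Qed.

Lemma measurable_phi k : measurable_fun setT (phi k).
Proof. exact: measurable_cmulD. Qed.

Lemma phiVE k : phiV k = fun z => cmul (sc (r ^- 2) (conj (a k))) z - cmul (sc (r ^- 2) (conj (a k))) (t k).
Proof. by apply/funext => z; rewrite /phiV cmulBr. Qed.

Lemma measurable_phiV k : measurable_fun setT (phiV k).
Proof. rewrite phiVE; exact: measurable_cmulD. Qed.

Lemma prb_self A : measurable A -> prb mu A = \sum_(k < l) p k * prb mu (phi k @^-1` A).
Proof.
move=> mA; rewrite {1}/prb mu_self//.
have mk k : measurable (phi k @^-1` A).
  by rewrite -[X in measurable X]setTI; exact: measurable_phi.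
under eq_bigr => k _ do rewrite prbE// -EFinM.
by rewrite sumEFin.
Qed.

(** Invariance is given on sets; it passes to integrals by reading [mu] as a finite sum of scaled
    images of itself. *)
Lemma Ex_self f : bmf f -> Ex mu f = \sum_(k < l) p k * Ex mu (fun y => f (phi k y)).
Proof.
move=> bf.
(* A constant added to [f] cancels because the weights sum to [1], so [f] may be taken nonnegative,
   as the formulas for sums and images of measures ask. *)
wlog f0 : f bf / forall x, 0 <= f x.
  move=> H; have [mf [K fK]] := bf.
  have bK : bmf (fun x => f x + K) by apply: bmfD => //; exact: bmf_cst.
  have fK0 x : 0 <= f x + K by have := fK x; rewrite ler_norml; lra.
  have := H _ bK fK0.
  rewrite ExD ?Ex_cst//; last exact: bmf_cst.
  have e k : Ex mu (fun y => f (phi k y) + K) = Ex mu (fun y => f (phi k y)) + K.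
    rewrite ExD ?Ex_cst//; last exact: bmf_cst.
    exact: bmf_comp (measurable_phi k) bf.
  under eq_bigr => k _ do rewrite e mulrDr.
  by rewrite big_split/= -mulr_suml sum_p mul1r => /addIr.
pose pn k : {nonneg R} := NngNum (ltW (p_gt0 k)).
(* [msum] takes a family indexed by the naturals; indices from [l] on get the zero measure. *)
pose m0 (i : nat) : {measure set (R * R)%type -> \bar R} :=
  match insub i with Some k => mscale (pn k) (pushforward mu (phi k)) | None => mzero end.
pose m_ := m0 measurable_phi.
have mE A : measurable A -> mu A = msum m_ l A.
  move=> mA; rewrite mu_self// /msum; apply: eq_bigr => k _.
  by rewrite /m_ /m0 valK.
rewrite /Ex /Rintegral (eq_measure_integral (msum m_ l)); last by move=> A mA _; exact: mE.
have mf : measurable_fun setT (EFin \o f) by apply/measurable_EFinP; exact: bf.1.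
rewrite ge0_integral_measure_sum//; last by move=> x _; rewrite lee_fin.
have -> : (\sum_(n < l) \int[m_ n]_x (f x)%:E =
   \sum_(k < l) (p k * fine (\int[mu]_x (f (phi k x))%:E))%:E)%E.
  apply: eq_bigr => k _; rewrite /m_ /m0 valK.
  rewrite ge0_integral_mscale//; last by move=> x _; rewrite lee_fin.
  rewrite ge0_integral_pushforward//; [|exact: measurable_phi|by move=> x _; rewrite lee_fin].
  rewrite preimage_setT EFinM fineK//.
  apply: integrable_fin_num => //.
  by have := bmf_integrable mu (bmf_comp (measurable_phi k) bf).
by rewrite sumEFin.
Qed.

(** Each map sends the [e/r]-neighbourhood of [Z] into its [e]-neighbourhood, so the smaller one has
    at least the mass of the larger. After enough steps the larger one covers the unit square; hence
    every neighbourhood of [Z] has full mass, and so has their intersection. *)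
Lemma invariant_full Z : closed Z -> Z !=set0 ->
  (forall k z, Z z -> Z (phi k z)) -> mu Z = 1%E.
Proof.
move=> cZ [z0 Zz0] Zphi; have r0 := r_gt0; have r1 := r_lt1.
pose N (e : R) := [set x | exists2 z, Z z & nrm (x - z) < e].
have oN e : open (N e).
  have -> : N e = \bigcup_(z in Z) [set x | nrm (x - z) < e].
    by apply/seteqP; split => [x [z]|x [z]]; exists z.
  apply: bigcup_open => z _.
  have -> : [set x | nrm (x - z) < e] = (fun x => nrm (x - z)) @^-1` [set y | y < e] by [].
  apply: open_comp; last exact: open_lt.
  move=> x _; apply: continuous_comp; last exact: continuous_nrm.
  by apply: cvgB; [exact: cvg_id|exact: cvg_cst].
have mN e : measurable (N e) by apply: open_measurable_plane.
have stepN e : prb mu (N (e / r)) <= prb mu (N e).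
  rewrite (prb_self (mN e)).
  have h k : prb mu (N (e / r)) <= prb mu (phi k @^-1` N e).
    apply: le_prb => //.
      by rewrite -[X in measurable X]setTI; exact: measurable_phi.
    move=> x [z Zz xz]; exists (phi k z); first exact: Zphi.
    by rewrite nrm_phiB mulrC -ltr_pdivlMr.
  rewrite -[leLHS]mul1r -sum_p mulr_suml; apply: ler_sum => k _.
  by rewrite ler_wpM2l// ltW// p_gt0.
have stepn e n : prb mu (N (e / r ^+ n)) <= prb mu (N e).
  elim: n => [|n IH]; first by rewrite expr0 divr1.
  apply: le_trans IH; rewrite exprSr invfM mulrA; exact: stepN.
have N1 e : 0 < e -> prb mu (N e) = 1.
  move=> e0; apply/eqP; rewrite eq_le prb_le1//=.
  (* Points of the unit square have norm at most [2], hence lie within [D] of [z0]. *)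
  pose D := 2 + nrm z0 + 1.
  have D0 : 0 < D by rewrite /D; have := nrm_ge0 z0; lra.
  have [n hn] : exists n, r ^+ n < e / D.
    have : r ^+ n @[n --> \oo] --> 0 by apply: cvg_expr; rewrite ger0_norm// ltW.
    move/cvgrPdist_lt => /(_ (e / D)); case; first by rewrite divr_gt0.
    move=> n _ /(_ n (leqnn _)); rewrite /= sub0r normrN ger0_norm ?exprn_ge0//.
      by move=> h; exists n.
    exact: ltW.
  apply: le_trans (stepn e n).
  have mb : measurable (`[0, 1]%classic `*` `[0, 1]%classic : set (R * R)).
    by apply: measurableX; exact: measurable_itv.
  have -> : 1 = prb mu (`[0, 1]%classic `*` `[0, 1]%classic) by rewrite /prb mu_box.
  apply: le_prb => // x [/= x1 x2]; exists z0 => //.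
  apply: (@lt_le_trans _ _ D).
    apply: (@le_lt_trans _ _ (nrm x + nrm z0)).
      by apply: (le_trans (nrmD _ _)); rewrite nrmN.
    rewrite /D; suff : nrm x <= 2 by lra.
    rewrite nrm_le//; move: x1 x2; rewrite !in_itv/=; nra.
  rewrite ler_pdivlMr ?exprn_gt0// mulrC -ler_pdivlMr//; exact: ltW.
have mZ : measurable Z by exact: closed_measurable_plane.
apply: prb1 => //.
have ZE : Z = \bigcap_n N n.+1%:R^-1.
  apply/seteqP; split => [z Zz n _|x Nx].
    by exists z => //; rewrite subrr nrm0 invr_gt0 ltr0n.
  apply: cZ => B /nbhs_ballP[e /= e0 eB].
  have [n hn] : exists n : nat, n.+1%:R^-1 < e.
    have := @cvg_harmonic R => /cvgrPdist_lt /(_ e e0)[n _ /(_ n (leqnn _))].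
    by rewrite /harmonic/= sub0r normrN ger0_norm// => h; exists n.
  have [z Zz xz] := Nx n I.
  exists z; split => //; apply: eB; rewrite -ball_normE/=.
  exact: le_lt_trans (ler_nrm _) (lt_trans xz hn).
have dN m n : (m <= n)%N -> N n.+1%:R^-1 `<=` N m.+1%:R^-1.
  move=> mn x [z Zz xz]; exists z => //; apply: (lt_le_trans xz).
  by rewrite lef_pV2 ?posrE ?ltr0n// ler_nat.
have := @prb_cvg _ _ _ mu (fun n => N n.+1%:R^-1) (fun n => mN _) dN.
rewrite -ZE (_ : _ \o _ = fun=> 1); last first.
  by apply/funext => n; rewrite /= N1// invr_gt0 ltr0n.
by move/(cvg_lim (@Rhausdorff R)) => <-; rewrite lim_cst.
Qed.

End SelfSimilarMeasure.

Record disjoint_attractor (R : realType) (l : nat) (a t : 'I_l -> R * R) (X : set (R * R)) : Prop := DisjointAttractor {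
  compactX : compact X;
  nonemptyX : X !=set0;
  attractorX : X = \bigcup_(k in [set: 'I_l]) (similarity a t k @` X);
  disjointX : forall i j : 'I_l, i != j -> (similarity a t i @` X) `&` (similarity a t j @` X) = set0 }.

(** * Averages over random words *)

Section WordAverages.
Context (R : realType) (l : nat) (p : 'I_l -> R).
Hypothesis p_ge0 : forall k, 0 <= p k.
Hypothesis sum_p : \sum_(k < l) p k = 1.

(** The expectation of [H] at a word of [n] independent letters of law [p]. *)
Fixpoint avg n (H : seq 'I_l -> R) : R :=
  if n is n'.+1 then \sum_(k < l) p k * avg n' (fun u => H (k :: u)) else H [::].

Lemma eq_avg n H H' : (forall u, size u = n -> H u = H' u) -> avg n H = avg n H'.
Proof.
elim: n H H' => [|n IH] H H' HH /=; first exact: HH.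
by apply: eq_bigr => k _; congr (_ * _); apply: IH => u su; apply: HH; rewrite /= su.
Qed.

Lemma avg_cst n c : avg n (fun=> c) = c.
Proof.
by elim: n => //= n IH; under eq_bigr do rewrite IH; rewrite -mulr_suml sum_p mul1r.
Qed.

Lemma le_avg n H H' : (forall u, size u = n -> H u <= H' u) -> avg n H <= avg n H'.
Proof.
elim: n H H' => [|n IH] H H' HH /=; first exact: HH.
by apply: ler_sum => k _; rewrite ler_wpM2l//; apply: IH => u su; apply: HH; rewrite /= su.
Qed.

Lemma avgD n H H' : avg n (fun u => H u + H' u) = avg n H + avg n H'.
Proof.
elim: n H H' => [|n IH] H H' //=.
by rewrite -big_split/=; apply: eq_bigr => k _; rewrite IH mulrDr.
Qed.

Lemma avgZ n c H : avg n (fun u => c * H u) = c * avg n H.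
Proof.
elim: n H => [|n IH] H //=; rewrite mulr_sumr.
by apply: eq_bigr => k _; rewrite IH mulrCA.
Qed.

Lemma avgB n H H' : avg n (fun u => H u - H' u) = avg n H - avg n H'.
Proof.
rewrite avgD -[- avg n H']mulN1r -avgZ; congr (_ + _).
by apply: eq_avg => u _; rewrite mulN1r.
Qed.

Lemma avg_sum I (s : seq I) n (H : I -> seq 'I_l -> R) :
  avg n (fun u => \sum_(i <- s) H i u) = \sum_(i <- s) avg n (H i).
Proof.
elim: s => [|i s IH].
  by rewrite big_nil -[RHS](avg_cst n 0); apply: eq_avg => u _; rewrite big_nil.
rewrite big_cons -IH -avgD; apply: eq_avg => u _; by rewrite big_cons.
Qed.

Lemma ler_norm_avg n H K : (forall u, size u = n -> `|H u| <= K) -> `|avg n H| <= K.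
Proof.
move=> HK; rewrite ler_norml; apply/andP; split.
  rewrite -(avg_cst n (- K)); apply: le_avg => u /HK; by rewrite ler_norml => /andP[].
rewrite -[leRHS](avg_cst n K); apply: le_avg => u /HK; by rewrite ler_norml => /andP[].
Qed.

Lemma avg_ge0 n H : (forall u, 0 <= H u) -> 0 <= avg n H.
Proof. by move=> H0; rewrite -(avg_cst n 0); apply: le_avg => u _; exact: H0. Qed.

End WordAverages.

(** * Coding by words and conditional expectations *)

Section Coding.
Context (R : realType) (l : nat) (r : R) (p : 'I_l -> R) (a t : 'I_l -> R * R).
Context (mu : probability (R * R)%type R) (ss : self_similar r p a t mu).
Context (X : set (R * R)) (sX : disjoint_attractor a t X).
Local Notation phi := (similarity a t).
Local Notation phiV := (phiV r a t).
Local Notation avg := (avg p).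
Implicit Types (u : seq 'I_l) (x y : R * R) (k : 'I_l).

Let p_ge0 k : 0 <= p k. Proof. exact/ltW/(p_gt0 ss). Qed.
Let sum_p := sum_p ss.

Lemma closedX : closed X.
Proof. apply: compact_closed (compactX sX). exact: norm_hausdorff. Qed.

Lemma measurable_attractor : measurable X.
Proof. apply: closed_measurable_plane; exact: closedX. Qed.

Lemma phiX k x : X x -> X (phi k x).
Proof. by move=> Xx; rewrite (attractorX sX); exists k => //; exists x. Qed.

Lemma muX : mu X = 1%E.
Proof. exact: (invariant_full ss closedX (nonemptyX sX) phiX). Qed.

Lemma measurable_piece k : measurable (phi k @` X).
Proof.
apply: closed_measurable_plane; apply: compact_closed; first exact: norm_hausdorff.
apply: continuous_compact (compactX sX); apply: continuous_subspaceT.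
exact: continuous_cmulD.
Qed.

Lemma piece_phi j k x : X x -> \1_(phi j @` X) (phi k x) = (j == k)%:R :> R.
Proof.
move=> Xx; rewrite indicE; congr (_%:R); congr nat_of_bool.
have [->|jk] := eqVneq j k; first by rewrite mem_set//; exists x.
apply/negbTE/negP => /set_mem jx.
have : (phi j @` X `&` phi k @` X) (phi k x) by split => //; exists x.
by rewrite (disjointX sX jk).
Qed.

Fixpoint wphi u y : R * R := if u is k :: u' then phi k (wphi u' y) else y.

(* For [x = wphi u y] with [y] in [X] and [size u = n], [cyl n H x = H u y]. *)
Fixpoint cyl n (H : seq 'I_l -> R * R -> R) x : R :=
  if n is n'.+1 then
    \sum_(k < l) \1_(phi k @` X) x * cyl n' (fun u => H (k :: u)) (phiV k x)
  else H [::] x.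

Lemma wphi_cat u v y : wphi (u ++ v) y = wphi u (wphi v y).
Proof. by elim: u => //= k u ->. Qed.

Lemma wphiX u y : X y -> X (wphi u y).
Proof. by move=> Xy; elim: u => //= k u; exact: phiX. Qed.

Lemma word_exists n x : X x -> exists u y, [/\ size u = n, X y & x = wphi u y].
Proof.
elim: n x => [|n IH] x Xx; first by exists [::], x.
move: (Xx); rewrite {1}(attractorX sX) => -[k _ [z Xz <-]].
have [u [y [su Xy ->]]] := IH z Xz; exists (k :: u), y.
by split => //=; rewrite su.
Qed.

Lemma cyl_phi n H k y : X y -> cyl n.+1 H (phi k y) = cyl n (fun u => H (k :: u)) y.
Proof.
move=> Xy /=; rewrite (bigD1 k)//= piece_phi// eqxx mul1r (phiK ss).
rewrite big1 ?addr0// => j jk; by rewrite piece_phi// (negbTE jk) mul0r.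
Qed.

Lemma cyl_word n H u y : X y -> (n <= size u)%N ->
  cyl n H (wphi u y) = H (take n u) (wphi (drop n u) y).
Proof.
move=> Xy; elim: n H u => [|n IH] H [|k u]// nu.
change (cyl n.+1 H (phi k (wphi u y)) = H (k :: take n u) (wphi (drop n u) y)).
by rewrite (cyl_phi _ _ _ (wphiX u Xy)) IH.
Qed.

Lemma bmf_cyl n H : (forall u, bmf (H u)) -> bmf (cyl n H).
Proof.
elim: n H => [|n IH] H bH; first exact: bH.
apply: bmf_sum => k; apply: bmfM; first by apply: bmf_indic; exact: measurable_piece.
apply: bmf_comp; first exact: measurable_phiV.
exact: IH.
Qed.

Lemma measurable_wphi u : measurable_fun setT (wphi u).
Proof.
elim: u => [|k u IH]; first exact: measurable_id.
by apply: measurableT_comp IH; exact: measurable_cmulD.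
Qed.

Lemma Ex_cyl n H : (forall u, bmf (H u)) ->
  Ex mu (cyl n H) = avg n (fun u => Ex mu (H u)).
Proof.
elim: n H => [|n IH] H bH //.
rewrite (Ex_self ss); last exact: bmf_cyl.
apply: eq_bigr => k _; rewrite -/avg -IH//; congr (_ * _).
apply: (Ex_ae _ _ measurable_attractor muX).
- by apply: bmf_comp (bmf_cyl _ _) => //; exact: measurable_cmulD.
- exact: bmf_cyl.
- by move=> y Xy; rewrite cyl_phi.
Qed.

Lemma Ex_word n f : bmf f -> Ex mu f = avg n (fun u => Ex mu (fun y => f (wphi u y))).
Proof.
move=> bf; have bH u : bmf (fun y => f (wphi u y)).
  exact: bmf_comp (measurable_wphi u) bf.
rewrite -(Ex_cyl n bH); apply: (Ex_ae _ _ measurable_attractor muX) => //; first exact: bmf_cyl.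
move=> x /(word_exists n)[u [y [su Xy ->]]].
by rewrite cyl_word ?su// -su take_size drop_size.
Qed.

(* The conditional expectation given the first [n] digits. *)
Definition condexp n (g : R * R -> R) := cyl n (fun u _ => Ex mu (fun y => g (wphi u y))).

Lemma condexp_word n g u y : X y -> (n <= size u)%N ->
  condexp n g (wphi u y) = Ex mu (fun z => g (wphi (take n u) z)).
Proof. by move=> Xy nu; rewrite /condexp cyl_word. Qed.

Lemma bmf_condexp n g : bmf (condexp n g).
Proof. apply: bmf_cyl => u; exact: bmf_cst. Qed.

(** On each cylinder of order [n] the first factor is constant and the second has mean zero. *)
Lemma condexp_orth n (K : seq 'I_l -> R) g : bmf g ->
  Ex mu (fun x => cyl n (fun u _ => K u) x * (g x - condexp n g x)) = 0.
Proof.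
move=> bg.
have bgw u : bmf (fun y => g (wphi u y)) by exact: bmf_comp (measurable_wphi u) bg.
pose H u y := K u * (g (wphi u y) - Ex mu (fun z => g (wphi u z))).
have bH u : bmf (H u) by rewrite /H; bm.
have -> : Ex mu (fun x => cyl n (fun u _ => K u) x * (g x - condexp n g x)) = Ex mu (cyl n H).
  apply: (Ex_ae _ _ measurable_attractor muX); last 1 first.
  - move=> x /(word_exists n)[u [y [su Xy ->]]].
    rewrite condexp_word ?su// !cyl_word ?su//.
    by rewrite -su take_size drop_size.
  - apply: bmfM; first by apply: bmf_cyl => u; exact: bmf_cst.
    by apply: bmfB => //; exact: bmf_condexp.
  - exact: bmf_cyl.
rewrite Ex_cyl// -[RHS](avg_cst (p := p) sum_p n); apply: eq_avg => u _.
by rewrite /H ExZ; bm; rewrite ExB ?Ex_cst ?subrr ?mulr0//; bm.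
Qed.

Lemma ler_condexp n g (B : R) x : bmf g -> (forall y, X y -> `|g y| <= B) -> X x -> `|condexp n g x| <= B.
Proof.
move=> bg gB /(word_exists n)[u [y [su Xy ->]]].
rewrite condexp_word ?su//; apply: (ler_norm_Ex_ae _ measurable_attractor muX).
  exact: bmf_comp (measurable_wphi _) bg.
by move=> z Xz; apply/gB/wphiX.
Qed.

(** Write [g - E_m g = (E_n g - E_m g) + (g - E_n g)], with [E_n] for [condexp n]. As [m <= n], the
    first bracket depends on the first [n] digits and is orthogonal to [h - E_n h]; the second is at
    most [e], while [h - E_n h] is at most [2]. *)
Lemma correlation_le (g h : R * R -> R) (m n : nat) (e : R) :
  bmf g -> bmf h -> (forall x, X x -> `|h x| <= 1) -> (m <= n)%N ->
  (forall x, X x -> `|g x - condexp n g x| <= e) ->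
  `|Ex mu (fun x => (g x - condexp m g x) * (h x - condexp n h x))| <= 2 * e.
Proof.
move=> bg bh h1 mn ge.
pose K u := Ex mu (fun z => g (wphi u z)) - Ex mu (fun z => g (wphi (take m u) z)).
have bc j f : bmf (condexp j f) by exact: bmf_condexp.
have bK : bmf (cyl n (fun u _ => K u)) by apply: bmf_cyl => u; exact: bmf_cst.
have bgm : bmf (fun x => g x - condexp m g x) by apply: bmfB => //; exact: bc.
have bgn : bmf (fun x => g x - condexp n g x) by apply: bmfB => //; exact: bc.
have bhn : bmf (fun x => h x - condexp n h x) by apply: bmfB => //; exact: bc.
have -> : Ex mu (fun x => (g x - condexp m g x) * (h x - condexp n h x)) =
  Ex mu (fun x => cyl n (fun u _ => K u) x * (h x - condexp n h x)) +
  Ex mu (fun x => (g x - condexp n g x) * (h x - condexp n h x)).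
  rewrite -ExD; [|exact: bmfM|exact: bmfM].
  apply: (Ex_ae _ _ measurable_attractor muX); [exact: bmfM|by apply: bmfD; exact: bmfM|].
  move=> x /(word_exists n)[u [y [su Xy ->]]].
  rewrite !condexp_word ?su// cyl_word ?su// /K -su take_size.
  by ring.
rewrite condexp_orth// add0r.
apply: (ler_norm_Ex_ae _ measurable_attractor muX); first exact: bmfM.
move=> x Xx; rewrite normrM mulrC ler_pM//; last exact: ge.
apply: (le_trans (ler_normB _ _)).
by have := h1 _ Xx; have := ler_condexp n bh h1 Xx; lra.
Qed.

(** The alternative [2 <= K * lam ^+ (j - i)] serves times too close for decorrelation: a product of
    two terms bounded by [2] then meets the bound trivially. Otherwise [g i] is nearly determined by
    the first [n j] digits and [correlation_le] applies. *)
Lemma condexp_strong_law (g : nat -> R * R -> R) (n : nat -> nat) (K lam : R) :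
  (forall i, bmf (g i)) -> (forall i x, X x -> `|g i x| <= 1) -> 0 <= lam < 1 ->
  (forall i j, (i <= j)%N -> 2 <= K * lam ^+ (j - i) \/
    ((n i <= n j)%N /\
     forall x, X x -> `|g i x - condexp (n j) (g i) x| <= K * lam ^+ (j - i))) ->
  {ae mu, forall x, (fun N : nat => N%:R^-1 * \sum_(i < N) (g i x - condexp (n i) (g i) x)) @ \oo --> 0}.
Proof.
move=> bg g1 hlam gK.
have bY i : bmf (fun x => g i x - condexp (n i) (g i) x).
  by apply: bmfB => //; exact: bmf_condexp.
have Y2 i x : X x -> `|g i x - condexp (n i) (g i) x| <= 2.
  move=> Xx; apply: (le_trans (ler_normB _ _)).
  by have := g1 i x Xx; have := ler_condexp (n i) (bg i) (g1 i) Xx; lra.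
apply: (strong_law measurable_attractor muX bY Y2).
apply: (second_moment_le (K := 2 * K) bY hlam) => i j ij.
have [h|[nij h]] := gK i j ij; last first.
  by rewrite -mulrA; apply: correlation_le => //; exact: g1.
apply: (@le_trans _ _ (2 * 2)); last by rewrite -mulrA ler_pM2l.
apply: (ler_norm_Ex_ae _ measurable_attractor muX); first exact: bmfM.
by move=> x Xx; rewrite normrM ler_pM// Y2.
Qed.

End Coding.

(** * The Fourier transform along the random walk *)

Section Trigonometry.
Variable R : realType.
Implicit Types x y : R.

Lemma sin_lipschitz x y : `|sin x - sin y| <= `|x - y|.
Proof.
wlog xy : x y / y <= x.
  by move=> H; case: (leP y x) => [/H//|/ltW/H]; rewrite distrC (distrC y).
have [c _ ->] := @MVT_segment R sin cos y x xy (fun z _ => is_derive_sin z)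
  (continuous_subspaceT (@continuous_sin R)).
by rewrite normrM ler_piMl// cos_max.
Qed.

Lemma cos_lipschitz x y : `|cos x - cos y| <= `|x - y|.
Proof.
rewrite -!sinDpihalf; apply: le_trans (sin_lipschitz _ _) _.
by rewrite opprD addrACA subrr addr0.
Qed.

Lemma norm_sin_le x : `|sin x| <= `|x|.
Proof. by have := sin_lipschitz x 0; rewrite sin0 !subr0. Qed.

Lemma cosM2 x : cos (2 * x) = 1 - 2 * sin x ^+ 2.
Proof. by rewrite mulrC mulr_natr cos_mulr2n cos2sin2 -mulr_natr; ring. Qed.

Lemma cos_ge_quad x : 1 - x ^+ 2 / 2 <= cos x.
Proof.
have -> : x = 2 * (x / 2) by field.
rewrite cosM2; set y := x / 2.
have : sin y ^+ 2 <= y ^+ 2.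
  by rewrite -(real_normK (num_real (sin y))) -(real_normK (num_real y)) ler_sqr ?nnegrE// norm_sin_le.
lra.
Qed.

(** Mean value theorem, with [cos >= 1/2] on [[0, 1]]; oddness handles negative [x]. *)
Lemma norm_sin_ge x : `|x| <= 1 -> `|x| / 2 <= `|sin x|.
Proof.
wlog x0 : x / 0 <= x.
  move=> H; case: (leP 0 x) => [/H//|/ltW]; rewrite -oppr_ge0 => /H.
  by rewrite sinN !normrN.
rewrite (ger0_norm x0) => x1.
have [c /[!in_itv]/= /andP[c0 cx]] := @MVT_segment R sin cos 0 x x0 (fun z _ => is_derive_sin z)
  (continuous_subspaceT (@continuous_sin R)).
rewrite sin0 !subr0 => ->.
rewrite normrM (ger0_norm x0) mulrC ler_wpM2r//.
apply: le_trans (ler_norm _); apply: le_trans (cos_ge_quad c).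
nra.
Qed.

(* [2 sin(b/2)] times the sum telescopes. *)
Lemma sum_cos_arith x y n :
  2 * sin (y / 2) * \sum_(i < n) cos (x + i%:R * y) =
  sin (x + n%:R * y - y / 2) - sin (x - y / 2).
Proof.
elim: n => [|n IH]; first by rewrite big_ord0 mulr0 mul0r addr0 subrr.
rewrite big_ord_recr/= mulrDr IH.
have -> : x + n.+1%:R * y - y / 2 = (x + n%:R * y) + y / 2.
  by rewrite -[n.+1%:R]natr1; field.
by set A := x + _; rewrite (sinB A) (sinD A); ring.
Qed.

(** The telescoped sum is at most [2] whatever [n] is, and [|2 sin (y/2)| >= |y|/2] because [y/2]
    lies in [[-1, 1]]. *)
Lemma norm_sum_cos_arith x y n : 0 < `|y| <= 2 ->
  `|\sum_(i < n) cos (x + i%:R * y)| <= 4 / `|y|.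
Proof.
move=> /andP[y0 y2].
have y0' : 0 < `|y / 2| by rewrite normrM normfV (ger0_norm (ler0n R 2)) divr_gt0.
have h : `|y / 2| / 2 <= `|sin (y / 2)|.
  by apply: norm_sin_ge; rewrite normrM normfV (ger0_norm (ler0n R 2)) ler_pdivrMr// mul1r.
have h2 : `|2 * sin (y / 2) * \sum_(i < n) cos (x + i%:R * y)| <= 2.
  rewrite sum_cos_arith; apply: (le_trans (ler_normB _ _)).
  by have := sin_max (x + n%:R * y - y / 2); have := sin_max (x - y / 2); lra.
rewrite ler_pdivlMr//.
move: h h2; rewrite !normrM normfV !(ger0_norm (ler0n R 2)).
set S := `|\sum_(_ < _) _|; set s := `|sin _| => h h2.
have S0 : 0 <= S by exact: normr_ge0.
have : `|y| * S <= 4 * s * S by rewrite ler_wpM2r//; lra.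
lra.
Qed.

End Trigonometry.

(** * The Fourier transform of the measure and the walk on frequencies *)

Section Fourier.
Context (R : realType) (l : nat) (r : R) (p : 'I_l -> R) (a t : 'I_l -> R * R).
Context (mu : probability (R * R)%type R) (ss : self_similar r p a t mu).
Context (X : set (R * R)) (sX : disjoint_attractor a t X).
Local Notation avg := (avg p).
Local Notation wphi := (wphi a t).
Local Notation E := (Ex mu).
Implicit Types (u : seq 'I_l) (x y xi zeta : R * R) (k : 'I_l).

Let p_ge0 k : 0 <= p k. Proof. exact/ltW/(p_gt0 ss). Qed.
Let sum_p := sum_p ss.

Lemma bmf_cos xi b : bmf (fun y => cos (dot xi y + b)).
Proof.
split; last by exists 1 => x; exact: cos_max.
apply: measurableT_comp; first by apply: continuous_measurable_fun; exact: continuous_cos.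
by apply: measurable_funD => //; exact: measurable_dot.
Qed.

Lemma bmf_cos0 xi : bmf (fun y => cos (dot xi y)).
Proof. by have := bmf_cos xi 0; under eq_fun do rewrite addr0. Qed.

Lemma bmf_sin0 xi : bmf (fun y => sin (dot xi y)).
Proof. by have := bmf_cos xi (- (pi / 2)); under eq_fun do rewrite cosBpihalf. Qed.

Definition Fcos xi : R := E (fun y => cos (dot xi y)).
Definition Fsin xi : R := E (fun y => sin (dot xi y)).
(* The squared modulus of the Fourier transform of [mu]. *)
Definition F xi : R := Fcos xi ^+ 2 + Fsin xi ^+ 2.

Lemma F_ge0 xi : 0 <= F xi. Proof. by rewrite addr_ge0// sqr_ge0. Qed.

Lemma F_le1 xi : F xi <= 1.
Proof.
have -> : (1 : R) = E (fun y => cos (dot xi y) ^+ 2 + sin (dot xi y) ^+ 2).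
  by under eq_fun do rewrite cos2Dsin2; rewrite Ex_cst.
rewrite ExD; [|by apply: bmfX; exact: bmf_cos0|by apply: bmfX; exact: bmf_sin0].
by apply: lerD; apply: Ex_sqr_ge; [exact: bmf_cos0|exact: bmf_sin0].
Qed.

Lemma Ex_cosD xi b : E (fun y => cos (dot xi y + b)) = cos b * Fcos xi - sin b * Fsin xi.
Proof.
rewrite -!ExZ; [|exact: bmf_sin0|exact: bmf_cos0].
rewrite -ExB; [|by apply: bmfM; [exact: bmf_cst|exact: bmf_cos0]|
  by apply: bmfM; [exact: bmf_cst|exact: bmf_sin0]].
by congr Ex; apply/funext => y; rewrite cosD; ring.
Qed.

(** The expectation is the real part of the Fourier transform multiplied by [exp (i b)]. *)
Lemma sqr_Ex_cos_le xi b : E (fun y => cos (dot xi y + b)) ^+ 2 <= F xi.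
Proof.
rewrite Ex_cosD /F -subr_ge0; have := cos2Dsin2 b.
set c := cos b; set s := sin b; set A := Fcos xi; set B := Fsin xi => cs.
have -> : A ^+ 2 + B ^+ 2 - (c * A - s * B) ^+ 2 =
   (c ^+ 2 + s ^+ 2) * (A ^+ 2 + B ^+ 2) - (c * A - s * B) ^+ 2 by rewrite cs mul1r.
have -> : (c ^+ 2 + s ^+ 2) * (A ^+ 2 + B ^+ 2) - (c * A - s * B) ^+ 2 = (s * A + c * B) ^+ 2 by ring.
exact: sqr_ge0.
Qed.

(** The squared modulus is the Fourier transform of the law of [x - y] for independent [x] and [y];
    time averages of [F] thus become averages of cosines, which can be summed. *)
Lemma F_double xi : F xi = E (fun y => E (fun x => cos (dot xi (x - y)))).
Proof.
have -> : (fun y => E (fun x => cos (dot xi (x - y)))) =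
   (fun y => Fcos xi * cos (dot xi y) + Fsin xi * sin (dot xi y)).
  apply/funext => y.
  transitivity (E (fun x => cos (dot xi x + - dot xi y))).
    by congr Ex; apply/funext => x; rewrite dotBr.
  by rewrite Ex_cosD cosN sinN; ring.
rewrite ExD; [|by apply: bmfM; [exact: bmf_cst|exact: bmf_cos0]|
  by apply: bmfM; [exact: bmf_cst|exact: bmf_sin0]].
by rewrite !ExZ; [|exact: bmf_sin0|exact: bmf_cos0].
Qed.

Let box : set (R * R) := `[0, 1]%classic `*` `[0, 1]%classic.
Let mbox : measurable box.
Proof. by apply: measurableX; exact: measurable_itv. Qed.
Let nrm_box x : box x -> nrm x <= 2.
Proof. by move=> [/= x1 x2]; rewrite nrm_le//; move: x1 x2; rewrite !in_itv/=; nra. Qed.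

Lemma Fcos_lipschitz xi zeta : `|Fcos xi - Fcos zeta| <= 2 * nrm (xi - zeta).
Proof.
rewrite /Fcos -ExB; [|exact: bmf_cos0|exact: bmf_cos0].
apply: (ler_norm_Ex_ae _ mbox (mu_box ss)); first by apply: bmfB; exact: bmf_cos0.
move=> x /nrm_box x2; apply: (le_trans (cos_lipschitz _ _)).
rewrite -dotBl mulrC; apply: (le_trans (ler_dot_nrm _ _)).
by rewrite ler_wpM2l// nrm_ge0.
Qed.

Lemma Fsin_lipschitz xi zeta : `|Fsin xi - Fsin zeta| <= 2 * nrm (xi - zeta).
Proof.
rewrite /Fsin -ExB; [|exact: bmf_sin0|exact: bmf_sin0].
apply: (ler_norm_Ex_ae _ mbox (mu_box ss)); first by apply: bmfB; exact: bmf_sin0.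
move=> x /nrm_box x2; apply: (le_trans (sin_lipschitz _ _)).
rewrite -dotBl mulrC; apply: (le_trans (ler_dot_nrm _ _)).
by rewrite ler_wpM2l// nrm_ge0.
Qed.

Lemma F_lipschitz xi zeta : `|F xi - F zeta| <= 8 * nrm (xi - zeta).
Proof.
have C1 z : `|Fcos z| <= 1.
  by apply: ler_norm_Ex => [|x]; [exact: bmf_cos0|exact: cos_max].
have S1 z : `|Fsin z| <= 1.
  by apply: ler_norm_Ex => [|x]; [exact: bmf_sin0|exact: sin_max].
have -> : F xi - F zeta = (Fcos xi - Fcos zeta) * (Fcos xi + Fcos zeta) +
    (Fsin xi - Fsin zeta) * (Fsin xi + Fsin zeta) by rewrite /F; ring.
have h (u v w : R) : `|u| <= w -> `|v| <= 2 -> `|u * v| <= w * 2.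
  by move=> uw v2; rewrite normrM ler_pM.
have c2 : `|Fcos xi + Fcos zeta| <= 2.
  by apply: (le_trans (ler_normD _ _)); have := C1 xi; have := C1 zeta; lra.
have s2 : `|Fsin xi + Fsin zeta| <= 2.
  by apply: (le_trans (ler_normD _ _)); have := S1 xi; have := S1 zeta; lra.
apply: (le_trans (ler_normD _ _)).
have := h _ _ _ (Fcos_lipschitz xi zeta) c2.
have := h _ _ _ (Fsin_lipschitz xi zeta) s2.
lra.
Qed.

Definition wmul u : R * R := foldr (fun k z => cmul (a k) z) (1, 0) u.
(** The transpose of the linear part of [wphi u]: it turns a frequency at [wphi u y] into a
    frequency at [y], up to a phase. *)
Definition adj u xi := cmul (conj (wmul u)) xi.

Lemma wmul_cat u v : wmul (u ++ v) = cmul (wmul u) (wmul v).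
Proof. by elim: u => [|k u IH] /=; rewrite ?cmul1// IH cmulA. Qed.

Lemma adj_cat u v xi : adj (u ++ v) xi = adj v (adj u xi).
Proof. by rewrite /adj wmul_cat conjM (cmulC (conj (wmul u))) cmulA. Qed.

(** Plane rotations commute. This is what lets a changed letter pass through the average [PL]. *)
Lemma adjC u v xi : adj u (adj v xi) = adj v (adj u xi).
Proof. by rewrite /adj !cmulA (cmulC (conj (wmul u))). Qed.

Lemma nrm_wmul u : nrm (wmul u) = r ^+ size u.
Proof.
elim: u => [|k u IH] /=; last by rewrite nrmM (nrma ss) IH exprS.
by rewrite /nrm/= expr1n expr0n/= addr0 sqrtr1.
Qed.

Lemma nrm_adj u xi : nrm (adj u xi) = r ^+ size u * nrm xi.
Proof. by rewrite /adj nrmM nrm_conj nrm_wmul. Qed.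

Lemma wphi_affine u y : wphi u y = cmul (wmul u) y + wphi u 0.
Proof.
elim: u => [|k u IH] /=; first by rewrite cmul1 addr0.
by rewrite {1}IH /similarity cmulDr cmulA addrA.
Qed.

Lemma dot_wphi xi u y : dot xi (wphi u y) = dot (adj u xi) y + dot xi (wphi u 0).
Proof. by rewrite {1}wphi_affine dotDr dot_cmul. Qed.

Lemma sqr_Ex_cos_wphi_le xi u b :
  E (fun y => cos (dot xi (wphi u y) + b)) ^+ 2 <= F (adj u xi).
Proof.
have -> : (fun y => cos (dot xi (wphi u y) + b)) =
    (fun y => cos (dot (adj u xi) y + (dot xi (wphi u 0) + b))).
  by apply/funext => y; rewrite (dot_wphi xi u y) -addrA.
exact: sqr_Ex_cos_le.
Qed.

(* The [n]-th power of the Markov operator of the walk [xi |-> conj (a k) xi]. *)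
Definition PL n (f : R * R -> R) xi := avg n (fun u => f (adj u xi)).

Lemma adj_single k xi : adj [:: k] xi = cmul (conj (a k)) xi.
Proof. by rewrite /adj/= cmulC (cmulC (a k)) cmul1 cmulC. Qed.

Lemma PL0 f xi : PL 0 f xi = f xi.
Proof. by rewrite /PL /adj/= /conj/= oppr0 cmul1. Qed.

Lemma PLS n f xi : PL n.+1 f xi = \sum_(k < l) p k * PL n f (adj [:: k] xi).
Proof.
apply: eq_bigr => k _; congr (_ * _); apply: eq_avg => u _.
by rewrite -adj_cat.
Qed.

Lemma PL_adj n f u xi : PL n f (adj u xi) = PL n (fun z => f (adj u z)) xi.
Proof. by apply: eq_avg => v _; rewrite adjC. Qed.

Lemma PLD n m f xi : PL n (PL m f) xi = PL (n + m) f xi.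
Proof.
elim: n xi => [|n IH] xi; first by rewrite PL0.
by rewrite addSn !PLS; apply: eq_bigr => k _; rewrite IH.
Qed.

Lemma PL_sqr_le n f xi : PL n f xi ^+ 2 <= PL n (fun z => f z ^+ 2) xi.
Proof.
rewrite -subr_ge0.
have -> : PL n (fun z => f z ^+ 2) xi - PL n f xi ^+ 2 =
    avg n (fun u => (f (adj u xi) - PL n f xi) ^+ 2).
  transitivity (avg n (fun u => f (adj u xi) ^+ 2 +
     ((- 2 * PL n f xi) * f (adj u xi) + PL n f xi ^+ 2))).
    by rewrite !avgD avgZ (avg_cst sum_p) -/(PL n f xi) -/(PL n (fun z => f z ^+ 2) xi); ring.
  by apply: eq_avg => u _; ring.
by apply: avg_ge0 => // u; exact: sqr_ge0.
Qed.

Lemma le_PL n f g xi : (forall z, f z <= g z) -> PL n f xi <= PL n g xi.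
Proof. by move=> fg; apply: le_avg. Qed.

(** Only the terms [j] and [k] of the variance are kept; since [p j + p k <= 1], they dominate
    [p j * p k] times the squared difference, wherever the mean lies. *)
Lemma variance_ge (x : 'I_l -> R) j k : j != k ->
  (\sum_(i < l) p i * x i) ^+ 2 + p j * p k * (x j - x k) ^+ 2 <= \sum_(i < l) p i * x i ^+ 2.
Proof.
move=> jk; set m := \sum_(i < l) p i * x i.
rewrite addrC -lerBrDr.
have -> : \sum_(i < l) p i * x i ^+ 2 - m ^+ 2 = \sum_(i < l) p i * (x i - m) ^+ 2.
  have -> : \sum_(i < l) p i * (x i - m) ^+ 2 =
     \sum_(i < l) p i * x i ^+ 2 + ((- 2 * m) * \sum_(i < l) p i * x i + (\sum_(i < l) p i) * m ^+ 2).
    rewrite mulr_sumr mulr_suml -!big_split/=; apply: eq_bigr => i _; ring.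
  by rewrite sum_p -/m; ring.
have kj : k != j by rewrite eq_sym.
rewrite (bigD1 j)//= (bigD1 k)//=.
have pjk : p j + p k <= 1.
  rewrite -sum_p (bigD1 j)//= (bigD1 k)//= addrA lerDl.
  by apply: sumr_ge0 => i _.
rewrite addrA; apply: ler_wpDr.
  by apply: sumr_ge0 => i _; rewrite mulr_ge0// sqr_ge0.
have -> : x j - x k = (x j - m) - (x k - m) by ring.
set u := x j - m; set v := x k - m; rewrite -subr_ge0.
have -> : p j * u ^+ 2 + p k * v ^+ 2 - p j * p k * (u - v) ^+ 2 =
   (p j * u + p k * v) ^+ 2 + (1 - (p j + p k)) * (p j * u ^+ 2 + p k * v ^+ 2) by ring.
rewrite addr_ge0 ?sqr_ge0// mulr_ge0 ?subr_ge0//.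
by rewrite addr_ge0// mulr_ge0// sqr_ge0.
Qed.

(* The variance of one step of the walk is bounded below by the squared jump,
   and the jump commutes with averaging: all K.+1 steps lose at least the same amount. *)
Lemma PL_jump_le f j k K xi : (forall z, 0 <= f z <= 1) -> j != k ->
  K.+1%:R * (p j * p k * (PL K f (adj [:: j] xi) - PL K f (adj [:: k] xi)) ^+ 2) <= 1.
Proof.
move=> f01 jk; set D := PL K f (adj [:: j] xi) - _.
(* [PL n] of the square of [PL m f] interpolates between the square of [PL K.+1 f], which is
   nonnegative, and [PL K.+1] of [f ^+ 2], at most [1]; each unit passed from [m] to [n] adds at
   least [p j * p k * D ^+ 2]. *)
suff H n m : (n + m)%N = K.+1 ->
    n%:R * (p j * p k * D ^+ 2) <= PL n (fun z => PL m f z ^+ 2) xi.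
  apply: (le_trans (H K.+1 0%N (addn0 _))).
  rewrite -[leRHS](avg_cst (p := p) sum_p K.+1); apply: le_avg => // u _.
  rewrite PL0; have /andP[f0 f1] := f01 (adj u xi).
  by rewrite expr_le1.
elim: n m => [|n IH] m nm; first by rewrite mul0r PL0 sqr_ge0.
pose g z := PL m f (adj [:: j] z) - PL m f (adj [:: k] z).
have h1 : PL n (fun z => PL m.+1 f z ^+ 2 + p j * p k * g z ^+ 2) xi <=
   PL n.+1 (fun z => PL m f z ^+ 2) xi.
  have -> : PL n.+1 (fun z => PL m f z ^+ 2) xi = PL n (PL 1 (fun z => PL m f z ^+ 2)) xi.
    by rewrite PLD addn1.
  apply: le_PL => z; rewrite PLS [leRHS]PLS.
  under [X in _ <= X]eq_bigr do rewrite PL0.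
  exact: (variance_ge (fun i => PL m f (adj [:: i] z)) jk).
apply: le_trans h1; rewrite /PL avgD avgZ -/(PL n (fun z => PL m.+1 f z ^+ 2) xi).
rewrite -/(PL n (fun z => g z ^+ 2) xi) -natr1 mulrDl mul1r lerD//.
  by apply: IH; rewrite addnS -addSn.
rewrite ler_wpM2l ?mulr_ge0//.
(* Jensen replaces the average of [g ^+ 2] by the square of the average of [g], which is [D]
   whatever [n] is, because the changed letter commutes with the walk. *)
apply: le_trans (PL_sqr_le n g xi).
suff -> : PL n g xi = D by [].
rewrite /g /PL avgB /D; congr (_ - _).
  by rewrite -(_ : (n + m)%N = K) -?PLD; [rewrite PL_adj|move: nm; rewrite addSn => -[]].
by rewrite -(_ : (n + m)%N = K) -?PLD; [rewrite PL_adj|move: nm; rewrite addSn => -[]].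
Qed.

(** [K0] depends on [e] and [p] alone; this uniformity in [f] and in the frequency is what allows
    one number of letters to serve all times and all points. *)
Lemma PL_jump_cvg0 (e : R) : 0 < e -> exists K0, forall K, (K0 <= K)%N ->
  forall f xi j k, (forall z, 0 <= f z <= 1) ->
  `|PL K f (adj [:: j] xi) - PL K f (adj [:: k] xi)| <= e.
Proof.
(* The product of the weights is a positive lower bound for each of them. *)
move=> e0; pose c := \prod_(k < l) p k.
have c0 : 0 < c by apply: prodr_gt0 => k _; exact: p_gt0 ss k.
have p1 k : p k <= 1.
  by rewrite -sum_p (bigD1 k)//= lerDl sumr_ge0.
have cp k : c <= p k.
  rewrite /c (bigD1 k)//= ler_piMr//.
  by apply: prodr_ile1 => i; rewrite p_ge0 p1.
have d0 : 0 < c ^+ 2 * e ^+ 2 by rewrite mulr_gt0// exprn_gt0.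
exists (Num.bound ((c ^+ 2 * e ^+ 2)^-1)) => K KK f xi j k f01.
have [->|jk] := eqVneq j k; first by rewrite subrr normr0 ltW.
have := PL_jump_le K xi f01 jk; set D := _ - _ => h.
rewrite leNgt; apply/negP => eD.
have De : e ^+ 2 < D ^+ 2.
  by rewrite -(real_normK (num_real D)) ltr_sqr ?nnegrE// ltW.
have K1 : 1 < K.+1%:R * (c ^+ 2 * e ^+ 2).
  rewrite -ltr_pdivrMr// div1r.
  apply: (lt_le_trans (archi_boundP _)); first by rewrite invr_ge0 ltW.
  by rewrite ler_nat ltnW.
have : c ^+ 2 * e ^+ 2 <= p j * p k * D ^+ 2.
  apply: ler_pM; rewrite ?sqr_ge0//; last exact: ltW.
  by rewrite expr2 ler_pM// ltW.
move=> h3; have : K.+1%:R * (c ^+ 2 * e ^+ 2) <= K.+1%:R * (p j * p k * D ^+ 2) by rewrite ler_wpM2l.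
by move/le_trans => /(_ _ h) /(lt_le_trans K1); rewrite ltxx.
Qed.

End Fourier.

(** * Lines and strips *)

Definition cross (R : realType) (z w : R * R) : R := z.1 * w.2 - z.2 * w.1.
Definition line (R : realType) (d : R * R) (c : R) : set (R * R) := [set x | dot d x = c].

Section NullLines.
Context (R : realType) (l : nat) (r : R) (p : 'I_l -> R) (a t : 'I_l -> R * R).
Context (mu : probability (R * R)%type R) (ss : self_similar r p a t mu).
Local Notation phi := (similarity a t).
Local Notation P := (prb mu).
Implicit Types (A B : set (R * R)) (d v x y z : R * R) (k j : 'I_l).

Let r_gt0 := r_gt0 ss.
Let r_lt1 := r_lt1 ss.

Lemma index_exists : inhabited 'I_l.
Proof.
case: (pselect (exists k : 'I_l, True)) => [[k _]|H]; first by constructor; exact: k.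
have := sum_p ss; rewrite big1; last by move=> i _; exfalso; apply: H; exists i.
by move/eqP; rewrite eq_sym oner_eq0.
Qed.

Lemma fixed_point k : exists z, phi k z = z.
Proof.
have ak : (a k).1 ^+ 2 + (a k).2 ^+ 2 = r ^+ 2 by rewrite -sqr_nrm (nrma ss).
pose b : R * R := (1 - (a k).1, - (a k).2).
pose n := (1 - (a k).1) ^+ 2 + (a k).2 ^+ 2.
have n0 : n != 0.
  apply/eqP => /eqP; rewrite /n paddr_eq0 ?sqr_ge0// !sqrf_eq0 subr_eq0 => /andP[/eqP a1 /eqP a2].
  by move: ak r_gt0 r_lt1; rewrite -a1 a2 expr1n expr0n/= addr0; nra.
(* This is [t k / (1 - a k)], with [b = 1 - a k] and [n] its squared modulus. *)
exists (sc n^-1 (cmul (conj b) (t k))).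
rewrite /similarity /sc /cmul /conj /b/=; case: (t k) => t1 t2 /=.
by congr pair => /=; rewrite /n; field.
Qed.

Lemma iter_phi_fixed k z x n : phi k z = z -> nrm (iter n (phi k) x - z) = r ^+ n * nrm (x - z).
Proof.
move=> kz; elim: n => [|n IH]; first by rewrite expr0 mul1r.
by rewrite iterS -{1}kz (nrm_phiB ss) IH exprS mulrA.
Qed.

Lemma cvg_expr_lt (e K : R) : 0 < e -> exists n, r ^+ n * K < e.
Proof.
move=> e0; pose M := `|K| + 1.
have M0 : 0 < M by rewrite /M; have := normr_ge0 K; lra.
have : r ^+ n @[n --> \oo] --> 0 by apply: cvg_expr; rewrite ger0_norm// ltW.
move/cvgrPdist_lt => /(_ (e / M)); case; first by rewrite divr_gt0.
move=> n _ /(_ n (leqnn _)); rewrite /= sub0r normrN ger0_norm ?exprn_ge0//; last exact: ltW.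
rewrite ltr_pdivlMr// => h; exists n; apply: le_lt_trans h.
rewrite ler_wpM2l ?exprn_ge0//; first exact: ltW.
by rewrite /M (le_trans (ler_norm _))// lerDl.
Qed.

(** The iterates of [phi k] from [x] converge to its fixed point, and those of order a multiple of
    [q] stay in [A]. *)
Lemma fixed_point_closed A k q z x : closed A -> (0 < q)%N ->
  (forall y, A y -> A (iter q (phi k) y)) -> A x -> phi k z = z -> A z.
Proof.
move=> cA q0 Aq Ax kz; apply: cA => B /nbhs_ballP[e /= e0 eB].
have [n hn] := cvg_expr_lt (nrm (x - z)) e0.
have An : A (iter (n * q) (phi k) x).
  elim: n {hn} => // n IH; rewrite mulSn iterD; exact: Aq.
exists (iter (n * q) (phi k) x); split => //; apply: eB; rewrite -ball_normE/=.
rewrite distrC; apply: (le_lt_trans (ler_nrm _)); rewrite iter_phi_fixed//.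
apply: le_lt_trans hn; rewrite ler_wpM2r ?nrm_ge0//.
by rewrite ler_wiXn2l// ?leq_pmulr// ltW.
Qed.

(** * Sets of maximal mass in a family stable under preimages *)

Section Maximal.
Variable Fam : set (set (R * R)).
Hypothesis Fam_closed : forall A, Fam A -> closed A.
Hypothesis Fam_nonempty : forall A, Fam A -> A !=set0.
Hypothesis Fam_preimage : forall A k, Fam A -> Fam (phi k @^-1` A).
Hypothesis Fam_null : forall A B, Fam A -> Fam B -> A <> B -> P (A `&` B) = 0.

Let mF A : Fam A -> measurable A.
Proof. by move=> /Fam_closed; exact: closed_measurable_plane. Qed.

Fixpoint heavy (c : R) (s : seq (set (R * R))) : Prop :=
  if s is A :: s' then
    [/\ Fam A, c <= P A, forall B, List.In B s' -> A <> B & heavy c s']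
  else True.

Lemma heavy_Fam c s A : heavy c s -> List.In A s -> Fam A.
Proof. by elim: s => //= B s IH [FB _ _ hs] [<-//|]; exact: IH. Qed.

Let bigU (s : seq (set (R * R))) := foldr setU set0 s.

Lemma heavy_measurable c s : heavy c s -> measurable (bigU s).
Proof. by elim: s => //= A s IH [FA _ _ hs]; apply: measurableU; [exact: mF|exact: IH]. Qed.

Lemma heavy_inter c s A : heavy c s -> Fam A -> (forall B, List.In B s -> A <> B) ->
  P (A `&` bigU s) = 0.
Proof.
move=> + FA; elim: s => [_ _|B s IH /= [FB _ _ hs] AB]; first by rewrite setI0 prb_set0.
rewrite setIUr; apply/eqP; rewrite eq_le prb_ge0 andbT.
have mAB : measurable (A `&` B) by apply: measurableI; exact: mF.
have mAU : measurable (A `&` bigU s).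
  by apply: measurableI; [exact: mF|exact: heavy_measurable hs].
rewrite prbUI// Fam_null//; last by apply: AB; left.
rewrite IH//; last by move=> C Cs; apply: AB; right.
by rewrite !add0r oppr_le0 prb_ge0.
Qed.

(** Distinct members meet in null sets, so their masses add up. *)
Lemma heavy_size c s : heavy c s -> (size s)%:R * c <= 1.
Proof.
move=> hs; apply: (@le_trans _ _ (P (bigU s))); last first.
  by apply: prb_le1; exact: heavy_measurable hs.
elim: s hs => [|A s IH /= [FA cA As hs]]; first by rewrite mul0r prb_set0.
rewrite prbUI ?(heavy_inter hs)//; [|exact: mF|exact: heavy_measurable hs].
by rewrite subr0 -natr1 mulrDl mul1r addrC lerD// IH.
Qed.

(** Boundedly many members have mass at least [P A0], and a longest [heavy] list contains them all.
    So the maximum is attained, and its maximisers lie in the finite list [s], which is what makes a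
    pigeonhole argument possible afterwards. *)
Lemma maximal_exists A0 : Fam A0 -> 0 < P A0 ->
  exists s A, [/\ Fam A, 0 < P A, forall B, Fam B -> P B <= P A &
    forall B, Fam B -> P B = P A -> List.In B s].
Proof.
move=> F0 c0; set c := P A0 in c0.
pose Q n := `[< exists s, heavy c s /\ size s = n >].
have exQ : exists n, Q n by exists 0%N; apply/asboolP; exists [::].
have ubQ n : Q n -> (n <= Num.bound (c^-1))%N.
  move=> /asboolP[s [hs <-]]; rewrite -(ler_nat R).
  have := heavy_size hs; rewrite -ler_pdivlMr// div1r => /le_trans; apply.
  by apply/ltW/archi_boundP; rewrite invr_ge0 ltW.
case: (ex_maxnP exQ ubQ) => n /asboolP[s [hs sn]] nmax.
have all_in B : Fam B -> c <= P B -> List.In B s.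
  move=> FB cB; apply: contrapT => Bs.
  have /nmax : Q n.+1.
    apply/asboolP; exists (B :: s); split; last by rewrite /= sn.
    by split => // C Cs BC; apply: Bs; rewrite BC.
  by rewrite ltnn.
have [A [As Amax]] : exists A, List.In A s /\ forall B, List.In B s -> P B <= P A.
  have : exists B, List.In B s by exists A0; exact: all_in.
  elim: (s) => [[]//|B s' IH _] /=.
  case: (pselect (exists C, List.In C s')) => [/IH[A [As' Amax]]|H]; last first.
    exists B; split; first by left.
    by move=> C [->//|Cs']; exfalso; apply: H; exists C.
  case: (leP (P B) (P A)) => BA.
    by exists A; split; [right|move=> C [<-//|]; exact: Amax].
  exists B; split; first by left.
  by move=> C [<-//|/Amax]; move=> h; apply/ltW/(le_lt_trans h).
have cA : c <= P A by apply: Amax; exact: all_in.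
exists s, A; split => //.
- exact: heavy_Fam hs As.
- exact: lt_le_trans cA.
- move=> B FB; case: (leP c (P B)) => [cB|/ltW Bc]; first by apply/Amax/all_in.
  exact: le_trans cA.
- by move=> B FB BA; apply: all_in => //; rewrite BA.
Qed.

(** Invariance writes the maximal mass as a mean of masses of preimages, so each preimage is maximal
    too. Preimages under the iterates of one map then repeat, which makes the set stable under a
    power of that map and puts its fixed point inside. The second conclusion is the first one for
    the preimage of [A] under [phi j]. *)
Lemma maximal_fixed A0 : Fam A0 -> 0 < P A0 ->
  exists A, [/\ Fam A, 0 < P A, forall k z, phi k z = z -> A z &
    forall j k z, phi k z = z -> A (phi j z)].
Proof.
move=> F0 c0; have [s [A [FA A_gt0 Amax Aall]]] := maximal_exists F0 c0.
have pre k B : Fam B -> P B = P A -> P (phi k @^-1` B) = P A.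
  move=> FB BA; have FpB := Fam_preimage k FB.
  apply/eqP; rewrite eq_le Amax//=.
  rewrite leNgt; apply/negP => lt.
  have := prb_self ss (mF FB); rewrite BA.
  suff : \sum_(k0 < l) p k0 * P (phi k0 @^-1` B) < P A.
    by move=> /[swap] <-; rewrite ltxx.
  rewrite -[ltRHS]mul1r -(sum_p ss) mulr_suml.
  rewrite (bigD1 k)//= [ltRHS](bigD1 k)//=; apply: ltr_leD.
    by rewrite ltr_pM2l// (p_gt0 ss).
  apply: ler_sum => i _; apply: ler_wpM2l; first by apply: ltW; exact: (p_gt0 ss).
  by apply: Amax; exact: Fam_preimage.
have fixin B : Fam B -> P B = P A -> forall k z, phi k z = z -> B z.
  move=> FB BA k z kz.
  have BnE n : Fam (iter n (phi k) @^-1` B) /\ P (iter n (phi k) @^-1` B) = P A.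
    elim: n => [//|n [Fn Pn]].
    rewrite (_ : iter n.+1 _ @^-1` B = phi k @^-1` (iter n (phi k) @^-1` B)).
      by split; [exact: Fam_preimage|exact: pre].
    by apply/seteqP; split => x /=; rewrite -iterSr.
  have idx n : exists i : 'I_(size s), nth set0 s i = iter n (phi k) @^-1` B.
    have [Fn Pn] := BnE n; have := Aall _ Fn Pn.
    elim: (s) => [//|C s' IH /= [->|/IH[i hi]]]; first by exists ord0.
    by exists (lift ord0 i).
  (* The preimages under the iterates of order [0] to [size s] sit in a list of length [size s], so
     two of them coincide. *)
  pose f (n : 'I_(size s).+1) := projT1 (cid (idx n)).
  have fE n : nth set0 s (f n) = iter n (phi k) @^-1` B by rewrite /f; case: cid.
  have [i [j [ij fij]]] : exists i j : 'I_(size s).+1, i != j /\ f i = f j.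
    apply: contrapT => H.
    have /leq_card : injective f.
      move=> i j fij; apply/eqP/negPn/negP => ij; apply: H; exists i, j.
      by split.
    by rewrite !card_ord ltnn.
  wlog lij : i j ij fij / (i < j)%N.
    move=> H; case: (ltngtP i j) => [|ji|e]; first exact: H.
      by apply: (H j i) => //; rewrite eq_sym.
    by move/eqP: ij; case; apply/val_inj.
  have E : iter i (phi k) @^-1` B = iter j (phi k) @^-1` B by rewrite -!fE fij.
  have [x Bx] := Fam_nonempty FB.
  apply: (@fixed_point_closed B k (j - i)%N z x) => //.
  - exact: Fam_closed.
  - by rewrite subn_gt0.
  move=> y By.
  (* Surjectivity of the [i]-th iterate turns the equality of preimages into stability of [B] under
     the iterate of order [j - i]. *)
  have surj : exists w, iter i (phi k) w = y.
    elim: (nat_of_ord i) y {By} => [|n IH] y; first by exists y.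
    by have [w hw] := IH (phiV r a t k y); exists w; rewrite iterS hw (phiVK ss).
  have [w hw] := surj.
  have : (iter i (phi k) @^-1` B) w by rewrite /preimage/= hw.
  by rewrite E /preimage/= -{1}(subnK (ltnW lij)) iterD hw.
exists A; split => // [|j k z kz]; first exact: fixin.
by apply: (fixin (phi j @^-1` A) _ _ k z kz); [exact: Fam_preimage|exact: pre].
Qed.

End Maximal.

Variable v : R * R.
Hypothesis offline : forall c, mu (line v c) <> 1%E.

Lemma closed_line d c : closed (line d c).
Proof.
have -> : line d c = dot d @^-1` [set c] by [].
apply: closed_comp; last exact: closed_eq.
by move=> x _; exact: continuous_dot.
Qed.

Lemma measurable_line d c : measurable (line d c).
Proof. by apply: closed_measurable_plane; exact: closed_line. Qed.

Lemma closed_point z : closed [set z].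
Proof. by apply: compact_closed; [exact: norm_hausdorff|exact: compact_set1]. Qed.

(** Such a point would be an invariant closed set, hence carry all the mass, and so would the line
    through it orthogonal to [v]. *)
Lemma no_common_fixed z : ~ (forall k, phi k z = z).
Proof.
move=> kz.
have c1 : closed [set z] by exact: closed_point.
have m1 : mu [set z] = 1%E.
  by apply: (invariant_full ss c1); [exists z|move=> k _ ->; exact: kz].
apply: (offline (c := dot v z)); apply/eqP; rewrite eq_le; apply/andP; split.
  by apply: probability_le1; exact: measurable_line.
rewrite -m1; apply: le_measure; rewrite ?inE; [|exact: measurable_line|by move=> _ ->].
exact: closed_measurable_plane.
Qed.

Lemma point_null x : P [set x] = 0.
Proof.
apply/eqP; rewrite eq_le prb_ge0 andbT leNgt; apply/negP => x0.
pose Fam := [set A : set (R * R) | exists z, A = [set z]].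
have [|||||A [[z ->] _ Af _]] := @maximal_fixed Fam _ _ _ _ [set x] _ x0.
- by move=> _ [z ->]; exact: closed_point.
- by move=> _ [z ->]; exists z.
- move=> _ k [z ->]; exists (phiV r a t k z); apply/seteqP; split => y /=.
    by move=> <-; rewrite (phiK ss).
  by move=> ->; rewrite (phiVK ss).
- move=> _ _ [z ->] [w ->] zw; rewrite (_ : _ `&` _ = set0) ?prb_set0//.
  by apply/seteqP; split => y //= [-> zw']; apply: zw; rewrite zw'.
- by exists x.
apply: (@no_common_fixed z) => k.
by have [w kw] := fixed_point k; have := Af k w kw => /= <-.
Qed.

(* Directions stable under the walk: all of them, unless every rotation is +-1,
   in which case only the multiples of [v]. *)
Definition walk_direction d := d <> 0 /\ ((forall k, (a k).2 = 0) -> cross d v = 0).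

Lemma preimage_line k d c : phi k @^-1` line d c = line (cmul (conj (a k)) d) (c - dot d (t k)).
Proof.
apply/seteqP; split => y; rewrite /line /preimage/= /similarity dotDr dot_cmul.
  by move=> <-; rewrite addrK.
by move=> ->; rewrite subrK.
Qed.

Lemma walk_direction_step k d : walk_direction d -> walk_direction (cmul (conj (a k)) d).
Proof.
move=> [d0 dv]; split.
  move/eqP; rewrite -nrm_eq0 nrmM nrm_conj (nrma ss) mulf_eq0 nrm_eq0.
  by rewrite gt_eqF//= => /eqP.
move=> h; transitivity ((a k).1 * cross d v); last by rewrite dv// mulr0.
by rewrite /cross /cmul /conj/= h; ring.
Qed.

Lemma cross_eq0 d e w : w <> 0 -> dot d w = 0 -> dot e w = 0 -> cross d e = 0.
Proof.
move=> w0 dw ew; have : cross d e * (w.1 ^+ 2 + w.2 ^+ 2) = 0.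
  have -> : cross d e * (w.1 ^+ 2 + w.2 ^+ 2) =
     dot d w * (e.2 * w.1 - e.1 * w.2) - dot e w * (d.2 * w.1 - d.1 * w.2).
    by rewrite /cross /dot; ring.
  by rewrite dw ew !mul0r subrr.
move/eqP; rewrite mulf_eq0 -sqr_nrm sqrf_eq0 nrm_eq0 => /orP[/eqP//|/eqP].
by move/w0.
Qed.

Lemma parallel d e : d <> 0 -> cross d e = 0 -> exists s, e = sc s d.
Proof.
move=> d0 de; have n0 : d.1 ^+ 2 + d.2 ^+ 2 != 0.
  by rewrite -sqr_nrm sqrf_eq0 nrm_eq0; apply/eqP.
exists (dot d e / (d.1 ^+ 2 + d.2 ^+ 2)); move: de n0; rewrite /cross /dot /sc.
case: d {d0} => d1 d2; case: e => e1 e2 /= de n0.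
have de' : d1 * e2 = d2 * e1 by apply/eqP; rewrite -subr_eq0 de.
congr pair; rewrite mulrAC; apply: (canRL (mulfK n0)).
  transitivity ((d1 * e1 + d2 * e2) * d1 + d2 * (d2 * e1 - d1 * e2)); first by ring.
  by rewrite de' subrr mulr0 addr0.
transitivity ((d1 * e1 + d2 * e2) * d2 + d1 * (d1 * e2 - d2 * e1)); first by ring.
by rewrite de' subrr mulr0 addr0.
Qed.

(** A line of positive mass would yield a maximal one, [A], through the fixed points and their
    images under all the maps. Two distinct fixed points and their images under [phi k] force [a k]
    to be real; then every map preserves [A], the normal of [A] is parallel to [v] by
    [walk_direction], and [A] is one of the lines excluded by [offline]. *)
Lemma line_null d c : walk_direction d -> P (line d c) = 0.
Proof.
move=> Dd; apply/eqP; rewrite eq_le prb_ge0 andbT leNgt; apply/negP => x0.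
pose Fam := [set A : set (R * R) | exists d c, walk_direction d /\ A = line d c].
have [|||||A [[e [b [De AE]]] _ Af Ajf]] := @maximal_fixed Fam _ _ _ _ (line d c) _ x0.
- by move=> _ [e [b [_ ->]]]; exact: closed_line.
- move=> _ [e [b [[e0 _] ->]]].
  have n0 : e.1 ^+ 2 + e.2 ^+ 2 != 0 by rewrite -sqr_nrm sqrf_eq0 nrm_eq0; apply/eqP.
  exists (sc (b / (e.1 ^+ 2 + e.2 ^+ 2)) e); rewrite /line/= /dot /sc/=; field; exact: n0.
- move=> _ k [e [b [De ->]]]; exists (cmul (conj (a k)) e), (b - dot e (t k)).
  by split; [exact: walk_direction_step|exact: preimage_line].
(* Distinct lines share at most one point, and points are null. *)
- move=> _ _ [e [b [[e0 _] ->]]] [e' [b' [[e'0 _] ->]]] ne.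
  have [[x [ex e'x]]|H] := pselect (exists x, (line e b `&` line e' b') x); last first.
    rewrite (_ : _ `&` _ = set0) ?prb_set0//.
    by apply/seteqP; split => y //= Hy; apply: H; exists y.
  rewrite (_ : _ `&` _ = [set x]) ?point_null//.
  apply/seteqP; split => y; last by move=> ->.
  move=> [ey e'y] /=; apply: contrapT => yx.
  have w0 : y - x <> 0 by move=> /eqP; rewrite subr_eq0 => /eqP.
  have ew : dot e (y - x) = 0 by rewrite dotBr; move: ex ey; rewrite /line/= => -> ->; rewrite subrr.
  have e'w : dot e' (y - x) = 0 by rewrite dotBr; move: e'x e'y; rewrite /line/= => -> ->; rewrite subrr.
  have [s es] := parallel e0 (cross_eq0 w0 ew e'w).
  have s0 : s != 0.
    by apply/eqP => s0; apply: e'0; rewrite es s0 /sc !mul0r.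
  have sd z : dot (sc s e) z = s * dot e z by rewrite dotZl.
  apply: ne; apply/seteqP; split => z; rewrite /line/= => hz.
    by rewrite -e'x es !sd hz ex.
  by apply: (mulfI s0); rewrite -sd -es hz -e'x es sd ex.
- by exists d, c.
have [k0] := index_exists.
have [f0 kf0] := fixed_point k0.
(* No point is fixed by all the maps, so a map that moves [f0] has a fixed point [f1] different from
   [f0]. *)
have [k1 fk1] : exists k, phi k f0 <> f0.
  by apply: contrapT => H; apply: (@no_common_fixed f0) => k; apply: contrapT => kf; apply: H; exists k.
have [f1 kf1] := fixed_point k1.
have w0 : f1 - f0 <> 0.
  by move=> /eqP; rewrite subr_eq0 => /eqP f10; apply: fk1; rewrite -f10.
have inA x : A x -> dot e x = b by rewrite AE.
have e_w : dot e (f1 - f0) = 0.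
  by rewrite dotBr (inA _ (Af _ _ kf0)) (inA _ (Af _ _ kf1)) subrr.
(* Both [e] and [conj (a k)] times [e] are orthogonal to [f1 - f0], hence parallel, which a non-real
   multiplier forbids. *)
have a2 k : (a k).2 = 0.
  have h : dot (cmul (conj (a k)) e) (f1 - f0) = 0.
    rewrite -dot_cmul cmulBr dotBr.
    have := inA _ (Ajf k _ _ kf0); have := inA _ (Ajf k _ _ kf1).
    by rewrite /similarity !dotDr => h1 h0; apply/eqP; rewrite subr_eq0; apply/eqP/(addIr (dot e (t k))); rewrite h1.
  have := cross_eq0 w0 e_w h.
  have -> : cross e (cmul (conj (a k)) e) = - (a k).2 * (e.1 ^+ 2 + e.2 ^+ 2).
    by rewrite /cross /cmul /conj/=; ring.
  move/eqP; rewrite mulf_eq0 oppr_eq0 -sqr_nrm sqrf_eq0 nrm_eq0 => /orP[/eqP//|/eqP].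
  by move/(De.1).
have full : mu A = 1%E.
  apply: (invariant_full ss); [by rewrite AE; exact: closed_line|by exists f0; exact: Af kf0|].
  move=> k x /inA ex; have := inA _ (Ajf k _ _ kf0); have := inA _ (Af _ _ kf0).
  rewrite AE /line/= /similarity !dotDr !dot_cmul.
  have E y : dot (cmul (conj (a k)) e) y = (a k).1 * dot e y.
    by rewrite /dot /cmul /conj/= a2; ring.
  by rewrite !E ex => ->.
have [s es] := parallel De.1 (De.2 a2).
have Av : A `<=` line v (s * b).
  by move=> x /inA ex; rewrite /line/= es dotZl ex.
apply: (offline (c := s * b)); apply/eqP; rewrite eq_le; apply/andP; split.
  by apply: probability_le1; exact: measurable_line.
rewrite -full; apply: le_measure; rewrite ?inE//; [rewrite AE; exact: measurable_line|exact: measurable_line].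
Qed.

End NullLines.

(** * Uniform smallness of strips, and averages along almost straight orbits *)

Section Kernel.
Context (R : realType) (l : nat) (r : R) (p : 'I_l -> R) (a t : 'I_l -> R * R).
Context (mu : probability (R * R)%type R) (ss : self_similar r p a t mu).
Variable v : R * R.
Hypothesis offline : forall c, mu (line v c) <> 1%E.
Local Notation P := (prb mu).
Local Notation walk_direction := (walk_direction a v).
Local Notation E := (Ex mu).
Implicit Types (d x y z : R * R) (k j : 'I_l).

Let box : set (R * R) := `[0, 1]%classic `*` `[0, 1]%classic.
Let mbox : measurable box.
Proof. by apply: measurableX; exact: measurable_itv. Qed.
Let nrm_box x : box x -> nrm x <= 2.
Proof. by move=> [/= x1 x2]; rewrite nrm_le//; move: x1 x2; rewrite !in_itv/=; nra. Qed.
Let mu_box := mu_box ss.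

Definition strip d c (rho : R) := [set x | `|dot d x - c| <= rho].

Lemma closed_strip d c rho : closed (strip d c rho).
Proof.
have -> : strip d c rho = (fun x => `|dot d x - c|) @^-1` [set y | y <= rho] by [].
apply: closed_comp; last exact: closed_le.
move=> x _; apply: cvg_norm.
by apply: cvgB; [exact: continuous_dot|exact: cvg_cst].
Qed.

Lemma measurable_strip d c rho : measurable (strip d c rho).
Proof. by apply: closed_measurable_plane; exact: closed_strip. Qed.

Lemma strip_cvg0 d c : walk_direction d ->
  (fun n : nat => P (strip d c (n.+1%:R^-1))) @ \oo --> 0.
Proof.
move=> Dd; rewrite -(line_null ss offline c Dd).
have -> : line d c = \bigcap_n strip d c (n.+1%:R^-1).
  apply/seteqP; split => x; rewrite /line /strip/=.
    by move=> xc n _ /=; rewrite xc subrr normr0 invr_ge0.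
  move=> H; apply/eqP; rewrite -subr_eq0 -normr_eq0 eq_le normr_ge0 andbT.
  apply/ler_addgt0Pl => e e0; rewrite addr0.
  have := @cvg_harmonic R => /cvgrPdist_lt /(_ e e0)[n _ /(_ n (leqnn _))].
  rewrite /harmonic/= sub0r normrN ger0_norm// => h.
  by apply: le_trans (ltW h); exact: H.
apply: prb_cvg => [n|n m nm x]; first exact: measurable_strip.
rewrite /strip/= => /le_trans; apply.
by rewrite lef_pV2 ?posrE ?ltr0n// ler_nat.
Qed.

(** The closed condition contained in [walk_direction]; with [nrm d = 1] in place of [d <> 0] it
    cuts out a compact set of directions. *)
Let cone d := (forall k, (a k).2 = 0) -> cross d v = 0.

Let closed_cone : closed [set d | cone d].
Proof.
have [h|h] := pselect (forall k, (a k).2 = 0); last first.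
  by rewrite (_ : [set d | _] = setT) ?closedT//; apply/seteqP; split => d //= _ /h.
rewrite (_ : [set d | _] = (fun d => cross d v) @^-1` [set 0]); last first.
  by apply/seteqP; split => d //=; rewrite /cone; [apply|move=> + _].
apply: closed_comp; last exact: closed_eq.
move=> d _; apply: cvgB; apply: cvgM; [exact: cvg_fst|exact: cvg_cst|exact: cvg_snd|exact: cvg_cst].
Qed.

Lemma compact_directions : compact [set d | nrm d = 1 /\ cone d].
Proof.
pose Q : set (R * R) := `[(-1 : R), 1]%classic `*` `[(-1 : R), 1]%classic.
apply: (@subclosed_compact _ _ Q).
- have c1 : closed ((@nrm R) @^-1` [set 1]).
    by apply: closed_comp; [move=> x _; exact: continuous_nrm|exact: closed_eq].
  exact: closedI c1 closed_cone.
- by apply: compact_setX; exact: segment_compact.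
- move=> d [/= d1 _]; have : d.1 ^+ 2 + d.2 ^+ 2 = 1 by rewrite -sqr_nrm d1 expr1n.
  by move=> h; split; rewrite /= in_itv/=; apply/andP; split; nra.
Qed.

(** Inside the unit square a thin strip lies in a slightly wider strip of nearby direction and
    offset, so compactness makes [strip_cvg0] uniform. Strips with offset beyond [3] miss the square
    and are treated apart. *)
Lemma strip_uniform (e : R) : 0 < e -> exists2 rho : R, 0 < rho &
  forall d c, nrm d = 1 -> walk_direction d -> P (strip d c rho) <= e.
Proof.
move=> e0.
have := compact_setX compact_directions (@segment_compact R (-3) 3).
rewrite compact_near_coveringP => /(_ nat \oo
  (fun n dc => P (strip dc.1 dc.2 (n.+1%:R^-1)) <= e) _)[].
  move=> [d0 c0] [/= [d01 d0c] _].
  have Dd0 : walk_direction d0.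
    by split=> // d00; move: d01; rewrite d00 nrm0 => /eqP; rewrite eq_sym oner_eq0.
  have /cvgrPdist_le /(_ _ e0)[m _ /(_ m (leqnn m))] := strip_cvg0 c0 Dd0.
  rewrite sub0r normrN ger0_norm ?prb_ge0// => hm.
  (* Here [8 * dl] is the half-width [1/(m+1)]: the thin strip uses at most [2 * dl], the change of
     direction [4 * dl] on the square, and the change of offset [dl]. *)
  pose dl : R := (4 * m.+1%:R)^-1 / 2.
  have dl0 : 0 < dl by rewrite divr_gt0// invr_gt0 mulr_gt0.
  exists (ball (d0, c0) dl, [set n | (4 * m.+1 <= n.+1)%N]).
    split; first exact: nbhsx_ballx.
    by exists (4 * m.+1)%N => // n /= h; rewrite leqW.
  move=> [[d c] n] /= [[bd bc] hn]; apply: le_trans hm.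
  have [b1 b2] : `|d0 - d| < dl /\ `|c0 - c| < dl.
    by move: bd bc; rewrite -!ball_normE.
  have -> : P (strip d c n.+1%:R^-1) = P (strip d c n.+1%:R^-1 `&` box).
    have e1 : P box = 1 by rewrite /prb mu_box.
    have mS : measurable (strip d c n.+1%:R^-1) by exact: measurable_strip.
    have := prbUI mu mS mbox; rewrite e1.
    suff -> : P (strip d c n.+1%:R^-1 `|` box) = 1 by lra.
    apply/eqP; rewrite eq_le prb_le1/=; last exact: measurableU.
    by rewrite -[leLHS]e1; apply: le_prb; [exact: mbox|exact: (measurableU _ _ mS mbox)|move=> x bx; right].
  apply: le_prb; [apply: measurableI => //; exact: measurable_strip|exact: measurable_strip|].
  move=> x [/= hx /nrm_box x2]; rewrite /strip/=.
  have -> : dot d0 x - c0 = (dot d x - c) + (dot (d0 - d) x - (c0 - c)) by rewrite dotBl; ring.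
  apply: (le_trans (ler_normD _ _)).
  have h2 : `|dot (d0 - d) x - (c0 - c)| <= 5 * dl.
    apply: (le_trans (ler_normB _ _)).
    have : `|dot (d0 - d) x| <= 4 * dl.
      apply: (le_trans (ler_dot_nrm _ _)).
      have := nrm_ler (d0 - d); have := nrm_ge0 (d0 - d); have := nrm_ge0 x; nra.
    by move: b2; lra.
  have h3 : n.+1%:R^-1 <= 2 * dl.
    rewrite /dl mulrCA mulfV// mulr1 lef_pV2 ?posrE ?ltr0n ?mulr_gt0//.
    by rewrite -natrM ler_nat.
  have h4 : 8 * dl = m.+1%:R^-1.
    have q0 : m.+1%:R != 0 :> R by rewrite pnatr_eq0.
    by rewrite /dl; move: q0; set q := m.+1%:R => q0; field.
  have hx' : `|dot d x - c| <= n.+1%:R^-1 := hx.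
  rewrite -h4; apply: (le_trans (lerD (le_trans hx' h3) h2)); lra.
move=> N _ HN; exists (N.+1%:R^-1); first by rewrite invr_gt0.
move=> d c d1 [d0 dc].
have [c3|c3] := leP `|c| 3.
  apply: (HN N (leqnn N) (d, c)); split => //=.
  by rewrite in_itv/=; move: c3; rewrite ler_norml.
apply: (@le_trans _ _ 0); last exact: ltW.
have -> : 0 = P (~` box) by rewrite prb_setC// /prb mu_box/= subrr.
apply: le_prb; [exact: measurable_strip|exact: measurableC|].
move=> x hx0 /nrm_box x2; have hx : `|dot d x - c| <= N.+1%:R^-1 := hx0.
have : `|dot d x| <= 2 by apply: (le_trans (ler_dot_nrm _ _)); rewrite d1 mul1r.
have : `|c| <= `|dot d x - c| + `|dot d x|.
  have := ler_normD (- (dot d x - c)) (dot d x).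
  by rewrite normrN (_ : - (dot d x - c) + dot d x = c)//; ring.
have h3 : N.+1%:R^-1 <= 1 :> R by rewrite invf_le1 ?ltr0n// ler1n.
move=> h1 h2; suff : (3 : R) < 3 by rewrite ltxx.
by move: h3 hx; set q := _^-1; lra.
Qed.

Lemma bmf_cosB xi y : bmf (fun x => cos (dot xi (x - y))).
Proof. by under eq_fun do rewrite dotBr; exact: bmf_cos. Qed.

Lemma bmf_Ex_cosB xi : bmf (fun y => E (fun x => cos (dot xi (x - y)))).
Proof.
have -> : (fun y => E (fun x => cos (dot xi (x - y)))) =
   (fun y => Fcos mu xi * cos (dot xi y) + Fsin mu xi * sin (dot xi y)).
  apply/funext => y.
  transitivity (E (fun x => cos (dot xi x + - dot xi y))).
    by congr Ex; apply/funext => x; rewrite dotBr.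
  by rewrite Ex_cosD cosN sinN; ring.
by apply: bmfD; apply: bmfM; [exact: bmf_cst|exact: bmf_cos0|exact: bmf_cst|exact: bmf_sin0].
Qed.

Section Linearization.
Variable e : R * R.
Let G z := cmul ((1, 0) + e) z.

(** First and second order estimates for [(1 + e)^M], proved together because the second order
    remainder at [M + 1] is the one at [M] plus [e] times the first order remainder at [M]. *)
Lemma iter_linear_bound z (M : nat) : M%:R * nrm e <= 1 / 2 ->
  nrm (iter M G z - z) <= 2 * (M%:R * nrm e) * nrm z /\
  nrm (iter M G z - z - cmul (sc M%:R e) z) <= (M%:R * nrm e) ^+ 2 * nrm z.
Proof.
have e0 := nrm_ge0 e; have z0 := nrm_ge0 z.
elim: M => [|M IH] Me.
  have -> : iter 0 G z - z = 0 by rewrite subrr.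
  have -> : 0 - cmul (sc 0%:R e) z = 0.
    by rewrite /sc !mul0r /cmul/= !mul0r; congr pair => /=; ring.
  by rewrite nrm0 !mul0r mulr0 expr0n/= mul0r lexx.
have Me' : M%:R * nrm e <= 1 / 2.
  by apply: le_trans Me; rewrite ler_wpM2r// ler_nat.
have [h1 h2] := IH Me'.
have step : iter M.+1 G z - z - cmul (sc M.+1%:R e) z =
    (iter M G z - z - cmul (sc M%:R e) z) + cmul e (iter M G z - z).
  rewrite iterS /G cmulDl cmul1 -natr1 /sc cmulBr.
  by case: (iter M _ z) => u1 u2; case: z {h1 h2 IH z0} => z1 z2; case: e => e1 e2;
    rewrite /cmul/=; congr pair => /=; ring.
have E2 : nrm (iter M.+1 G z - z - cmul (sc M.+1%:R e) z) <= (M.+1%:R * nrm e) ^+ 2 * nrm z.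
  rewrite step; apply: (le_trans (nrmD _ _)); rewrite nrmM.
  have := ler_wpM2l e0 h1; rewrite -natr1; set A := nrm (_ - _ - _) in h2 *.
  have M0 : 0 <= M%:R :> R by []. 
  have : 0 <= nrm e ^+ 2 * nrm z by rewrite mulr_ge0// sqr_ge0.
  move: h2; set q := nrm e; set w := nrm z; set m := M%:R; lra.
split => //.
have -> : iter M.+1 G z - z = (iter M.+1 G z - z - cmul (sc M.+1%:R e) z) + cmul (sc M.+1%:R e) z.
  by rewrite subrK.
apply: (le_trans (nrmD _ _)); rewrite [X in _ + X]nrmM nrmZ ger0_norm//.
apply: (le_trans (lerD E2 (lexx _))).
have M0 : 0 <= M.+1%:R * nrm e by rewrite mulr_ge0.
have : (M.+1%:R * nrm e) ^+ 2 <= M.+1%:R * nrm e.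
  by rewrite expr2 ler_piMl//; lra.
move=> /(ler_wpM2r z0); lra.
Qed.

End Linearization.

(* On a time window where the orbit of [eta] is almost straight, the phase is almost
   linear in time with slope [dot (cmul e eta) (x - y)]; the slope is small only for [x] in a
   thin strip around [y]. *)
Lemma kernel_bound (eps : R) : 0 < eps -> exists2 C0 : R, 0 < C0 & forall C, C0 <= C ->
  exists2 e0 : R, 0 < e0 & forall e, e != 0 -> nrm e <= e0 -> ((forall k, (a k).2 = 0) -> e.2 = 0) ->
  exists2 M : nat, (0 < M)%N & forall eta, r * C <= nrm eta <= C -> walk_direction eta ->
    M%:R^-1 * \sum_(i < M) F mu (iter i (cmul ((1, 0) + e)) eta) <= eps.
Proof.
move=> eps0; have r0 := r_gt0 ss; have r1 := r_lt1 ss.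
have eps4 : 0 < eps / 4 by rewrite divr_gt0.
have [rho rho0 Hrho] := strip_uniform eps4.
(* [M |e|] will lie between [D / (2C)] and [D / C]. Off the strip the slope [be] then satisfies
   [M |be| >= rho * r * D / 2 = 16 / eps], which makes the bound [4 / |be|] of the cosine sum at
   most [M * eps / 4]. *)
pose D := 32 / (rho * r * eps).
have D0 : 0 < D by rewrite divr_gt0// !mulr_gt0.
have DD0 : 0 < 16 * D ^+ 2 / eps by rewrite divr_gt0// mulr_gt0// exprn_gt0.
(* With [T = D / C], the first term gives [T <= 1/2], needed to linearize; the second gives
   [T ^+ 2 * C <= eps / 16], which bounds the quadratic error. *)
exists (2 * D + 16 * D ^+ 2 / eps); first by rewrite addr_gt0// mulr_gt0.
move=> C C0C.
have Cp : 0 < C by apply: lt_le_trans C0C; rewrite addr_gt0// mulr_gt0.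
pose T := D / C.
have T0 : 0 < T by rewrite divr_gt0.
have T1 : T <= 1 / 2.
  rewrite ler_pdivrMr//; apply: le_trans (_ : D <= 1/2 * (2 * D)) _; first by lra.
  by rewrite ler_pM2l//; apply: le_trans C0C; rewrite lerDl ltW.
have TC : T * C = D by rewrite /T divfK// gt_eqF.
have TTC : T ^+ 2 * C <= eps / 16.
  have -> : T ^+ 2 * C = D ^+ 2 / C by rewrite /T; field; rewrite gt_eqF.
  have : 16 * D ^+ 2 / eps <= C by apply: le_trans C0C; rewrite lerDr mulr_ge0// ltW.
  by rewrite !ler_pdivrMr//; lra.
(* The first bound makes the rounding of [T / |e|] to [M] lose at most half; the second keeps the
   slope at most [2], as [norm_sum_cos_arith] asks. *)
exists (Num.min (T / 2) (C^-1 / 2)); first by rewrite lt_min; apply/andP; split; rewrite divr_gt0// invr_gt0.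
move=> e e0 + ea; rewrite le_min => /andP[eT eC].
have ne0 : 0 < nrm e by rewrite lt0r nrm_ge0 nrm_eq0 e0.
pose M := Num.truncn (T / nrm e).
have Te2 : 2 <= T / nrm e by rewrite ler_pdivlMr//; lra.
have Tge0 : 0 <= T / nrm e by rewrite divr_ge0// ltW.
have [MT TM] : M%:R <= T / nrm e /\ T / nrm e < M.+1%:R.
  by have /andP[] := truncn_itv Tge0.
have M1 : 1 < M%:R :> R by move: TM Te2; rewrite -natr1; lra.
have M0 : (0 < M)%N by rewrite -(ltr_nat R); exact: lt_trans M1.
have Mp : 0 < M%:R :> R by rewrite ltr0n.
have MeT : M%:R * nrm e <= T by rewrite -ler_pdivlMr.
have MeT2 : T / 2 <= M%:R * nrm e.
  have : T < M.+1%:R * nrm e by rewrite -ltr_pdivrMr.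
  by rewrite -natr1 mulrDl mul1r; lra.
exists M => // eta /andP[eta1 eta2] Deta.
have eta0 : 0 < nrm eta by apply: lt_le_trans eta1; rewrite mulr_gt0.
pose w := cmul e eta.
have nw : nrm w = nrm e * nrm eta by rewrite nrmM.
have nw0 : 0 < nrm w by rewrite nw mulr_gt0.
pose d := sc (nrm w)^-1 w.
have d1 : nrm d = 1 by rewrite nrmZ ger0_norm ?invr_ge0 ?ltW// mulVf// gt_eqF.
(* If all [a k] are real then so is [e], and [w] stays parallel to [eta]. *)
have Dd : walk_direction d.
  split; first by move=> d0; move: d1; rewrite d0 nrm0 => /eqP; rewrite eq_sym oner_eq0.
  move=> h; have := Deta.2 h; have := ea h.
  rewrite /d; set N := (nrm w)^-1; rewrite /w /cross /cmul /sc/= => -> E0.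
  transitivity (N * e.1 * (eta.1 * v.2 - eta.2 * v.1)); first by ring.
  by rewrite E0 mulr0.
pose K x y := M%:R^-1 * \sum_(i < M) cos (dot (iter i (cmul ((1, 0) + e)) eta) (x - y)).
have bK y : bmf (fun x => K x y).
  by apply: bmfM; [exact: bmf_cst|apply: bmf_sum => i; exact: bmf_cosB].
have K1 x y : `|K x y| <= 1.
  rewrite normrM normfV (ger0_norm (ltW Mp)) ler_pdivrMl// mulr1.
  apply: (le_trans (ler_norm_sum _ _ _)).
  apply: (@le_trans _ _ (\sum_(i < M) 1)); first by apply: ler_sum => i _; exact: cos_max.
  by rewrite sumr_const card_ord.
have Koff x y : box x -> box y -> ~ strip d (dot d y) rho x -> `|K x y| <= eps / 2.
  move=> bx yb off.
  have xy : nrm (x - y) <= 4.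
    by apply: (le_trans (nrmD _ _)); rewrite nrmN; have := nrm_box bx; have := nrm_box yb; lra.
  pose al := dot eta (x - y); pose be := dot w (x - y).
  have be1 : rho * nrm w < `|be|.
    move/negP: off; rewrite /strip/= -ltNge -dotBr /d dotZl normrM.
    by rewrite ger0_norm ?invr_ge0 ?ltW// mulrC ltr_pdivlMr.
  have be2 : `|be| <= 2.
    apply: (le_trans (ler_dot_nrm _ _)); rewrite nw.
    have : nrm e * nrm eta <= C^-1 / 2 * C by rewrite ler_pM// ltW.
    rewrite mulrAC mulVf ?gt_eqF// => h.
    by have := ler_pM (mulr_ge0 (ltW ne0) (ltW eta0)) (nrm_ge0 _) h xy; lra.
  have be0 : 0 < `|be| by apply: le_lt_trans be1; rewrite mulr_ge0// ltW.
  have lin i : (i < M)%N ->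
      `|cos (dot (iter i (cmul ((1, 0) + e)) eta) (x - y)) - cos (al + i%:R * be)| <= eps / 4.
    move=> iM; apply: (le_trans (cos_lipschitz _ _)).
    have ie : i%:R * nrm e <= T.
      by apply: le_trans MeT; rewrite ler_wpM2r ?nrm_ge0// ler_nat ltnW.
    have [_ h] := @iter_linear_bound e eta i (le_trans ie T1).
    have -> : dot (iter i (cmul ((1, 0) + e)) eta) (x - y) - (al + i%:R * be) =
       dot (iter i (cmul ((1, 0) + e)) eta - eta - cmul (sc i%:R e) eta) (x - y).
      by rewrite !dotBl cmulZl dotZl -/al -/w -/be; ring.
    apply: (le_trans (ler_dot_nrm _ _)).
    apply: (@le_trans _ _ (T ^+ 2 * C * 4)); last by lra.
    apply: ler_pM; rewrite ?nrm_ge0//; apply: (le_trans h).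
    have ie0 : 0 <= i%:R * nrm e by rewrite mulr_ge0// nrm_ge0.
    by apply: ler_pM => //; [exact: sqr_ge0|exact: nrm_ge0|rewrite ler_sqr// nnegrE; lra].
  have S2 : `|\sum_(i < M) cos (al + i%:R * be)| <= 4 / `|be|.
    by apply: norm_sum_cos_arith; rewrite be0.
  have S1 : `|\sum_(i < M) cos (dot (iter i (cmul ((1, 0) + e)) eta) (x - y)) -
       \sum_(i < M) cos (al + i%:R * be)| <= M%:R * (eps / 4).
    rewrite -sumrB; apply: (le_trans (ler_norm_sum _ _ _)).
    apply: (@le_trans _ _ (\sum_(i < M) (eps / 4))); first by apply: ler_sum => i _; exact: lin.
    by rewrite sumr_const card_ord mulr_natl.
  have S3 : 4 / `|be| <= M%:R * (eps / 4).
    rewrite ler_pdivrMr//.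
    have h : M%:R * (eps / 4) * (rho * nrm w) <= M%:R * (eps / 4) * `|be|.
      by rewrite ler_wpM2l ?ltW// mulr_gt0.
    apply: le_trans h; rewrite nw.
    have -> : M%:R * (eps / 4) * (rho * (nrm e * nrm eta)) =
      (eps / 4 * rho) * ((M%:R * nrm e) * nrm eta) by ring.
    have h : T / 2 * (r * C) <= M%:R * nrm e * nrm eta.
      by apply: ler_pM => //; [rewrite divr_ge0// ltW|rewrite mulr_ge0// ltW].
    have : eps / 4 * rho * (T / 2 * (r * C)) <= eps / 4 * rho * (M%:R * nrm e * nrm eta).
      by rewrite ler_wpM2l// mulr_ge0// ltW.
    apply: le_trans.
    have gen (x1 x2 x3 x4 x5 : R) : x1 / 4 * x2 * (x3 / 2 * (x4 * x5)) = (x3 * x5) * (x1 * x2 * x4 / 8) by field.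
    rewrite gen TC /D le_eqVlt; apply/orP; left; apply/eqP; field.
    by rewrite !gt_eqF.
  rewrite /K normrM normfV (ger0_norm (ltW Mp)) ler_pdivrMl//.
  set S := \sum_(i < M) _ in S1 *; set S' := \sum_(i < M) _ in S1 S2.
  have -> : S = (S - S') + S' by rewrite subrK.
  by apply: (le_trans (ler_normD _ _)); lra.
(* On the strip, of mass at most [eps / 4], the kernel is at most [1]; off it, at most [eps / 2]. *)
have inner y : box y -> E (fun x => K x y) <= eps.
  move=> yb; set A := strip d (dot d y) rho.
  have mA : measurable A by exact: measurable_strip.
  apply: (@le_trans _ _ (E (fun x => \1_A x + eps / 2))).
    apply: (le_Ex_ae _ _ mbox mu_box) => //.
      by apply: bmfD; [exact: bmf_indic|exact: bmf_cst].
    move=> x bx; rewrite indicE; have [xA|xA] := pselect (A x).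
      rewrite mem_set//=; apply: (le_trans (ler_norm _)); apply: (le_trans (K1 x y)).
      by rewrite lerDl divr_ge0// ltW.
    rewrite memNset//= add0r; apply: (le_trans (ler_norm _)); exact: Koff.
  rewrite ExD; [|exact: bmf_indic|exact: bmf_cst].
  rewrite Ex_cst -prb_Ex//.
  by have := Hrho d (dot d y) d1 Dd; rewrite -/A; lra.
have -> : M%:R^-1 * \sum_(i < M) F mu (iter i (cmul ((1, 0) + e)) eta) = E (fun y => E (fun x => K x y)).
  have -> : (fun y => E (fun x => K x y)) = (fun y => M%:R^-1 * \sum_(i < M)
      E (fun x => cos (dot (iter i (cmul ((1, 0) + e)) eta) (x - y)))).
    apply/funext => y; rewrite /K ExZ; last by apply: bmf_sum => i; exact: bmf_cosB.
    by rewrite Ex_sum// => i; exact: bmf_cosB.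
  rewrite ExZ; last by apply: bmf_sum => i; exact: bmf_Ex_cosB.
  rewrite Ex_sum; last by move=> i; exact: bmf_Ex_cosB.
  by congr (_ * _); apply: eq_bigr => i _; rewrite F_double.
rewrite -[leRHS](Ex_cst mu eps); apply: (le_Ex_ae _ _ mbox mu_box).
- have -> : (fun y => E (fun x => K x y)) = (fun y => M%:R^-1 * \sum_(i < M)
      E (fun x => cos (dot (iter i (cmul ((1, 0) + e)) eta) (x - y)))).
    apply/funext => y; rewrite /K ExZ; last by apply: bmf_sum => i; exact: bmf_cosB.
    by rewrite Ex_sum// => i; exact: bmf_cosB.
  by apply: bmfM; [exact: bmf_cst|apply: bmf_sum => i; exact: bmf_Ex_cosB].
- exact: bmf_cst.
- exact: inner.
Qed.

End Kernel.

(** * Rescaled frequencies *)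

Section ComplexPowers.
Variable R : realType.
Implicit Types (z w : R * R) (n m : nat).

Definition cpow z n := iter n (cmul z) (1, 0).

Lemma cpowS z n : cpow z n.+1 = cmul z (cpow z n). Proof. by []. Qed.

Lemma cpowD z n m : cpow z (n + m) = cmul (cpow z n) (cpow z m).
Proof. by elim: n => [|n IH]; rewrite ?cmul1// addSn !cpowS IH cmulA. Qed.

Lemma nrm_cpow z n : nrm (cpow z n) = nrm z ^+ n.
Proof.
elim: n => [|n IH]; last by rewrite cpowS nrmM IH exprS.
by rewrite /nrm/= expr1n expr0n/= addr0 sqrtr1.
Qed.

Lemma conj_cpow z n : conj (cpow z n) = cpow (conj z) n.
Proof. by elim: n => [|n IH]; rewrite ?cpowS ?conjM ?IH// /conj/= oppr0. Qed.

Lemma cpow_real z n : z.2 = 0 -> (cpow z n).2 = 0.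
Proof. by move=> z2; elim: n => // n IH; rewrite cpowS /cmul/= z2 IH mulr0 mul0r addr0. Qed.

Lemma iter_cmul z w n : iter n (cmul z) w = cmul (cpow z n) w.
Proof. by elim: n => [|n IH]; rewrite ?cmul1// iterS IH cmulA. Qed.

Lemma cpow_sc (c : R) z n : cpow (sc c z) n = sc (c ^+ n) (cpow z n).
Proof.
elim: n => [|n IH]; first by rewrite /sc/= !mulr0 mulr1.
by rewrite !cpowS IH cmulZl /sc /cmul/= exprS; congr pair; ring.
Qed.

Lemma cpowM z n m : cpow (cpow z n) m = cpow z (n * m).
Proof.
elim: m => [|m IH]; first by rewrite muln0.
by rewrite cpowS IH mulnS cpowD.
Qed.

Lemma cmulZr (c : R) z w : cmul z (sc c w) = sc c (cmul z w).
Proof. by rewrite cmulC cmulZl cmulC. Qed.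

Lemma scM (c d : R) z : sc c (sc d z) = sc (c * d) z.
Proof. by rewrite /sc/= !mulrA. Qed.

End ComplexPowers.

(** The first [B0] blocks and the incomplete last one contribute a bounded amount, which the
    doubling of [eta] absorbs for large [N]. *)
Lemma block_average (R : realType) (H : nat -> R) (W B0 : nat) (eta : R) :
  (0 < W)%N -> 0 < eta -> (forall i, 0 <= H i <= 1) ->
  (forall B, (B0 <= B)%N -> \sum_(i < W) H (B * W + i)%N <= W%:R * eta) ->
  exists N0, forall N, (N0 <= N)%N -> N%:R^-1 * \sum_(i < N) H i <= 2 * eta.
Proof.
move=> W0 eta0 H01 HB.
have sumB K : \sum_(i < (B0 + K) * W) H i <= B0%:R * W%:R + K%:R * (W%:R * eta).
  elim: K => [|K IH].
    rewrite addn0 mul0r addr0 -natrM.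
    apply: (@le_trans _ _ (\sum_(i < B0 * W) 1)).
      by apply: ler_sum => i _; have /andP[] := H01 i.
    by rewrite sumr_const card_ord.
  have -> : ((B0 + K.+1) * W = (B0 + K) * W + W)%N by rewrite addnS mulSn addnC.
  rewrite big_split_ord/= -[K.+1%:R]natr1 mulrDl mul1r addrA lerD//.
  by apply: HB; exact: leq_addr.
pose N0 := (Num.bound ((B0%:R * W%:R + W%:R * eta) / eta) + B0 * W + 1)%N.
exists N0 => N leN.
have N1 : (0 < N)%N by rewrite /N0 in leN; lia.
have Np : 0 < N%:R :> R by rewrite ltr0n.
pose K := (N %/ W - B0)%N.
have WB : (B0 <= N %/ W)%N by rewrite leq_divRL//; rewrite /N0 in leN; lia.
have KB : (B0 + K = N %/ W)%N by rewrite /K subnKC.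
have KN : (N <= (B0 + K.+1) * W)%N.
  by rewrite addnS KB; apply: ltnW; exact: ltn_ceil.
have KW : (K * W <= N)%N.
  by apply: leq_trans (leq_trunc_div N W); rewrite leq_mul2r -KB leq_addl orbT.
rewrite ler_pdivrMl//.
apply: (@le_trans _ _ (\sum_(i < (B0 + K.+1) * W) H i)).
  rewrite -(subnKC KN) big_split_ord/= lerDl.
  by apply: sumr_ge0 => i _; have /andP[] := H01 (N + i)%N.
apply: (le_trans (sumB _)).
have h1 : K%:R * W%:R * eta <= N%:R * eta.
  by apply: ler_wpM2r; [exact: ltW|rewrite -natrM ler_nat].
have h2 : B0%:R * W%:R + W%:R * eta <= N%:R * eta.
  rewrite -ler_pdivrMr//; apply: ltW; apply: lt_le_trans (_ : (Num.bound ((B0%:R * W%:R + W%:R * eta) / eta))%:R <= _).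
    apply: archi_boundP; apply: divr_ge0 (ltW eta0).
    by rewrite addr_ge0// mulr_ge0// ltW.
  by rewrite ler_nat; rewrite /N0 in leN; lia.
by rewrite -natr1; lra.
Qed.

Section Levels.
Context (R : realType) (r b : R).
Hypothesis r0 : 0 < r.
Hypothesis r1 : r < 1.
Hypothesis b1 : 1 < b.

Lemma level_exists (y : R) : 1 <= y -> exists n, r < r ^+ n * y <= 1.
Proof.
move=> y1; have y0 : 0 < y by apply: lt_le_trans y1.
have ex : exists n, r ^+ n * y <= 1.
  have : r ^+ n @[n --> \oo] --> 0 by apply: cvg_expr; rewrite ger0_norm// ltW.
  move/cvgrPdist_lt => /(_ (y^-1)); case; first by rewrite invr_gt0.
  move=> n _ /(_ n (leqnn _)); rewrite /= sub0r normrN ger0_norm ?exprn_ge0//; last exact: ltW.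
  by move=> h; exists n; rewrite -ler_pdivlMr// div1r ltW.
case: (ex_minnP ex) => n hn nmin; exists n; rewrite hn andbT.
case: n hn nmin => [|n] hn nmin; first by rewrite expr0 mul1r; exact: lt_le_trans y1.
rewrite exprS -mulrA ltr_pMr// ltNge; apply/negP => /nmin.
by rewrite ltnn.
Qed.

Lemma expb_ge1 i : 1 <= b ^+ i. Proof. by rewrite exprn_ege1// ltW. Qed.

(** The depth at which the pieces of the attractor have size about [b ^- i]. *)
Definition lev i := projT1 (cid (level_exists (expb_ge1 i))).

Lemma levP i : r < r ^+ lev i * b ^+ i <= 1.
Proof. by rewrite /lev; case: cid. Qed.

Lemma lev_mono i j : (i <= j)%N -> (lev i <= lev j)%N.
Proof.
move=> ij; rewrite leqNgt; apply/negP => lt.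
have /andP[h1 _] := levP i; have /andP[_ h2] := levP j.
have bij : b ^+ i <= b ^+ j by rewrite ler_weXn2l// ltW.
have b0 k : 0 < b ^+ k by apply: lt_le_trans (expb_ge1 k).
have h3 : r ^+ lev j * b ^+ i <= 1.
  by apply: le_trans h2; rewrite ler_wpM2l// exprn_ge0// ltW.
have h4 : r ^+ lev i <= r ^+ (lev j).+1 by rewrite ler_wiXn2l// ltW.
have h5 : r ^+ lev i * b ^+ i <= r * (r ^+ lev j * b ^+ i).
  by rewrite mulrA -exprS ler_wpM2r// ltW.
have h6 : r * (r ^+ lev j * b ^+ i) <= r * 1 by rewrite ler_pM2l.
by have := lt_le_trans h1 (le_trans h5 h6); rewrite mulr1 ltxx.
Qed.

(* A Dirichlet pigeonhole, carried out multiplicatively in the annulus [r < |z| <= 1]. *)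
Lemma close_return (c : R * R) (e0 : R) : nrm c = r -> 0 < e0 ->
  (forall q s, (0 < q)%N -> b ^+ q * r ^+ s != 1) ->
  exists q s, let e := sc (b ^+ q) (cpow c s) - (1, 0) in
    [/\ (0 < q)%N, e != 0, nrm e <= e0 & (c.2 = 0 -> e.2 = 0)].
Proof.
move=> nc e00 irr.
pose z q := sc (b ^+ q) (cpow c (lev q)).
have b0 k : 0 < b ^+ k by apply: lt_le_trans (expb_ge1 k).
have nz q : nrm (z q) = r ^+ lev q * b ^+ q.
  by rewrite nrmZ nrm_cpow nc (ger0_norm (ltW (b0 q))) mulrC.
pose Q : set (R * R) := `[(-1 : R), 1]%classic `*` `[(-1 : R), 1]%classic.
have cQ : compact Q by apply: compact_setX; exact: segment_compact.
have zQ q : Q (z q).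
  have /andP[_ h] := levP q.
  have : `|z q| <= 1 by apply: (le_trans (ler_nrm _)); rewrite nz.
  by rewrite prod_normE ge_max !ler_norml => /andP[h1 h2]; split; rewrite /= in_itv.
have FQ : (z @ \oo) Q by exists 0%N => // n _; exact: zQ.
(* Two terms [z q1] and [z q2] close to a cluster point [w] are close to each other, and their
   quotient is the required [1 + e]. *)
have [w [_ cw]] := cQ (z @ \oo) _ FQ.
(* The sup distance of the two terms is at most [2 * dl], their Euclidean distance at most
   [4 * dl = e0 * r]; dividing by the modulus of [z q1], larger than [r], leaves [e0]. *)
pose dl := e0 * r / 4.
have dl0 : 0 < dl by rewrite divr_gt0// mulr_gt0.
have near N : exists2 n, (N <= n)%N & `|w - z n| < dl.
  have [y [[n /= Nn <-] wn]] := cw [set z n | n in [set n | (N <= n)%N]] (ball w dl)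
    ltac:(by exists N => // n /= Nn; exists n) (nbhsx_ballx _ _ dl0).
  by exists n => //; move: wn; rewrite -ball_normE.
have [q1 _ hq1] := near 0%N; have [q2 q12 hq2] := near q1.+1.
pose q := (q2 - q1)%N; pose s := (lev q2 - lev q1)%N.
exists q, s => e.
have q0 : (0 < q)%N by rewrite subn_gt0.
have e_z : cmul e (z q1) = z q2 - z q1.
  rewrite /e cmulBl cmul1; congr (_ - _).
  rewrite /z cmulZl cmulZr scM -exprD -cpowD /q /s (subnK (ltnW q12)).
  by rewrite (subnK (lev_mono (ltnW q12))).
have nz1 : r < nrm (z q1) by rewrite nz; have /andP[] := levP q1.
split => //.
- apply/eqP => e_eq0; have := irr q s q0.
  have /(congr1 (@nrm R)) : sc (b ^+ q) (cpow c s) = (1, 0) by apply/eqP; rewrite -subr_eq0; apply/eqP.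
  rewrite nrmZ nrm_cpow nc (ger0_norm (ltW (b0 q))) => ->.
  by rewrite /nrm/= expr1n expr0n/= addr0 sqrtr1 eqxx.
- have h : nrm e * nrm (z q1) <= e0 * r.
    rewrite -nrmM e_z; apply: (le_trans (nrm_ler _)).
    have : `|z q2 - z q1| <= dl + dl.
      have -> : z q2 - z q1 = (w - z q1) - (w - z q2) by congr pair => /=; ring.
      by apply: (le_trans (ler_normB _ _)); apply: lerD; exact: ltW.
    by rewrite /dl; lra.
  have h2 : nrm e * r <= nrm e * nrm (z q1) by rewrite ler_wpM2l ?nrm_ge0// ltW.
  by rewrite -(ler_pM2r r0); apply: le_trans h.
- by move=> c2; rewrite /e /sc/= cpow_real// mulr0 subrr.
Qed.

End Levels.

Lemma sum_blocks (R : realType) (f : nat -> R) (M q : nat) :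
  \sum_(i < M * q) f i = \sum_(j < M) \sum_(c < q) f (j * q + c)%N.
Proof.
elim: M => [|M IH]; first by rewrite mul0n !big_ord0.
have -> : (M.+1 * q = M * q + q)%N by rewrite mulSn addnC.
by rewrite big_split_ord/= IH big_ord_recr.
Qed.

Section BlockIndices.
Variables (q M : nat).
Hypothesis q0 : (0 < q)%N.
Hypothesis M0 : (0 < M)%N.
Local Notation W := (M * q)%N.

(* Time is cut into blocks of length [M * q]; within a block, [i] is reached from [base i],
   among the first [q] times of the block, by [tme i] steps of length [q]. *)
Definition base i := ((i %/ W) * W + (i %% W) %% q)%N.
Definition tme i := ((i %% W) %/ q)%N.

Let W0 : (0 < W)%N. Proof. by rewrite muln_gt0 M0. Qed.

Lemma base_tme i : i = (base i + tme i * q)%N.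
Proof.
rewrite /base /tme -addnA [X in (_ + X)%N]addnC -divn_eq.
by rewrite -divn_eq.
Qed.

Lemma tme_lt i : (tme i < M)%N.
Proof. by rewrite /tme ltn_divLR// ltn_pmod. Qed.

Lemma block_index B j c : (j < M)%N -> (c < q)%N ->
  base (B * W + (j * q + c)) = (B * W + c)%N /\ tme (B * W + (j * q + c)) = j.
Proof.
move=> jM cq; have lt : (j * q + c < W)%N by nia.
have e1 : ((B * W + (j * q + c)) %/ W = B)%N by rewrite divnMDl// divn_small// addn0.
have e2 : ((B * W + (j * q + c)) %% W = j * q + c)%N by rewrite modnMDl modn_small.
rewrite /base /tme e1 e2; split; first by rewrite modnMDl modn_small.
by rewrite divnMDl// divn_small// addn0.
Qed.

End BlockIndices.

Section BlockLevels.
Context (R : realType) (r b : R) (r0 : 0 < r) (r1 : r < 1) (b1 : 1 < b).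
Local Notation lev := (lev r0 r1 b1).
Variables (q s M : nat).
Hypothesis q0 : (0 < q)%N.
Hypothesis M0 : (0 < M)%N.
Local Notation base := (base q M).
Local Notation tme := (tme q M).

(* Each step of length [q] deepens the level by [s], so that it multiplies the rescaled
   frequency by [b ^+ q * r ^+ s], which [close_return] makes close to [1]. *)
Definition lvl i := (lev (base i) + tme i * s)%N.

Lemma lvlE i : r ^+ lvl i * b ^+ i =
  r ^+ lev (base i) * b ^+ base i * (b ^+ q * r ^+ s) ^+ tme i.
Proof.
rewrite {2}(base_tme q M i) /lvl !exprD exprMn -!exprM (mulnC q) (mulnC s).
by ring.
Qed.

(** As [tme i < M], at most [M] factors [b ^+ q * r ^+ s] are lost with respect to [levP]. *)
Lemma lvl_bounds : exists c1 c2 : R, [/\ 0 < c1, 0 < c2 &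
  forall i, c1 <= r ^+ lvl i * b ^+ i <= c2].
Proof.
pose g := b ^+ q * r ^+ s.
have b0 : 0 < b by exact: lt_trans b1.
have g0 : 0 < g by rewrite mulr_gt0// exprn_gt0.
pose g1 := Num.min 1 g; pose g2 := Num.max 1 g.
have g10 : 0 < g1 by rewrite lt_min ltr01.
have g11 : g1 <= 1 by rewrite ge_min lexx.
have g21 : 1 <= g2 by rewrite le_max lexx.
have g20 : 0 < g2 by apply: lt_le_trans g21.
exists (r * g1 ^+ M), (g2 ^+ M); split; [by rewrite mulr_gt0// exprn_gt0|by rewrite exprn_gt0|].
move=> i; rewrite lvlE -/g; have /andP[l1 l2] := levP r0 r1 b1 (base i).
have h1 : g1 ^+ M <= g ^+ tme i.
  apply: (@le_trans _ _ (g1 ^+ tme i)).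
    by apply: ler_wiXn2l; [exact: ltW|exact: g11|exact: ltnW (tme_lt q0 M0 i)].
  by apply: lerXn2r; rewrite ?nnegrE; [exact: ltW|exact: ltW|rewrite ge_min lexx orbT].
have h2 : g ^+ tme i <= g2 ^+ M.
  apply: (@le_trans _ _ (g2 ^+ tme i)).
    by apply: lerXn2r; rewrite ?nnegrE; [exact: ltW|exact: ltW|rewrite le_max lexx orbT].
  by apply: ler_weXn2l; [exact: g21|exact: ltnW (tme_lt q0 M0 i)].
apply/andP; split.
  by apply: ler_pM => //; [exact: ltW|rewrite exprn_ge0// ltW|exact: ltW].
rewrite -[leRHS]mul1r; apply: ler_pM => //; last by rewrite exprn_ge0// ltW.
by apply: le_trans (ltW l1); exact: ltW.
Qed.

(** Levels that rise by at most [D] force [j - i] to be bounded. This is stated as a lower bound on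
    [b^-1 ^+ (j - i)] to supply the trivial alternative of [condexp_strong_law]. *)
Lemma lvl_gap (c1 c2 : R) i j D : 0 < c1 -> (i <= j)%N ->
  (forall i, c1 <= r ^+ lvl i * b ^+ i <= c2) -> (lvl j <= lvl i + D)%N ->
  1 <= c2 / (c1 * r ^+ D) * b^-1 ^+ (j - i).
Proof.
move=> c10 ij H lt.
have b0 : 0 < b by exact: lt_trans b1.
have /andP[h1 _] := H i; have /andP[_ h2] := H j.
have bp k : 0 < b ^+ k by rewrite exprn_gt0.
have rp k : 0 < r ^+ k by rewrite exprn_gt0.
rewrite exprVn ler_pdivlMr// mul1r ler_pdivlMr ?mulr_gt0//.
apply: le_trans h2.
have -> : b ^+ j = b ^+ (j - i) * b ^+ i by rewrite -exprD subnK.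
have h3 : r ^+ lvl i * r ^+ D <= r ^+ lvl j by rewrite -exprD ler_wiXn2l// ltW.
have h4 : c1 * r ^+ D <= r ^+ lvl j * b ^+ i.
  apply: (@le_trans _ _ (r ^+ lvl i * b ^+ i * r ^+ D)); first by rewrite ler_wpM2r// ltW.
  by rewrite mulrAC ler_wpM2r// ltW.
by rewrite [leRHS]mulrCA; apply: ler_wpM2l; [exact: ltW|exact: h4].
Qed.

Lemma lvl_large (c2 : R) n : (forall i, r ^+ lvl i * b ^+ i <= c2) ->
  exists N, forall i, (N <= i)%N -> (n <= lvl i)%N.
Proof.
move=> H.
have b0 : 0 < b by exact: lt_trans b1.
have rp k : 0 < r ^+ k by rewrite exprn_gt0.
have [N hN] : exists N, c2 / r ^+ n < b ^+ N.
  have c20 : 0 <= c2 by apply: le_trans (H 0%N); rewrite mulr_ge0 ?exprn_ge0// ltW.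
  have D1 : 0 < c2 / r ^+ n + 1 by rewrite ltr_wpDl// divr_ge0// ltW.
  have d0 : 0 < (c2 / r ^+ n + 1)^-1 by rewrite invr_gt0.
  have : b^-1 ^+ k @[k --> \oo] --> 0.
    by apply: cvg_expr; rewrite ger0_norm ?invr_ge0 ?ltW// invf_lt1.
  move/cvgrPdist_lt => /(_ _ d0)[N _ /(_ N (leqnn _))].
  rewrite /= sub0r normrN ger0_norm; last by rewrite exprn_ge0// invr_ge0 ltW.
  rewrite exprVn ltf_pV2 ?posrE ?exprn_gt0// => h.
  by exists N; apply: le_lt_trans h; rewrite lerDl.
exists N => i Ni; rewrite leqNgt; apply/negP => lt.
have h1 : r ^+ n <= r ^+ lvl i by apply: ler_wiXn2l; [exact: ltW|exact: ltW|exact: ltnW].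
have h2 : b ^+ N <= b ^+ i by apply: ler_weXn2l => //; exact: ltW.
have : c2 < r ^+ lvl i * b ^+ i.
  rewrite ltr_pdivrMr// in hN; apply: (lt_le_trans hN); rewrite mulrC.
  by apply: ler_pM => //; rewrite ?exprn_ge0// ltW.
by rewrite ltNge H.
Qed.

End BlockLevels.

(** * Averages of cosines along exponentially growing frequencies *)

Section CosineAverages.
Context (R : realType) (l : nat) (r : R) (p : 'I_l -> R) (a t : 'I_l -> R * R).
Context (mu : probability (R * R)%type R) (ss : self_similar r p a t mu).
Context (X : set (R * R)) (sX : disjoint_attractor a t X).
Variable v : R * R.
Hypothesis offline : forall c, mu (line v c) <> 1%E.
Variable b : R.
Hypothesis b1 : 1 < b.
Hypothesis irrational : forall q s, (0 < q)%N -> b ^+ q * r ^+ s != 1.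
Variable xi : nat -> R * R.
Variable Kv : R.
Hypothesis xi_le : forall i, nrm (xi i) <= Kv * b ^+ i.
(** The error is small only relative to [b ^+ i]: a slower coordinate may be unbounded and still
    vanish after rescaling. *)
Hypothesis xi_cvg : forall e, 0 < e -> exists N, forall i, (N <= i)%N ->
  nrm (xi i - sc (b ^+ i) v) <= e * b ^+ i.
Local Notation E := (Ex mu).
Local Notation F := (F mu).
Local Notation adj := (adj a).
Local Notation PL := (PL p a).
Local Notation wphi := (wphi a t).
Local Notation condexp := (condexp r a t mu X).
Local Notation cyl := (cyl r a t X).
Let r0 := r_gt0 ss.
Let r1 := r_lt1 ss.
Let p_ge0 k : 0 <= p k. Proof. exact: ltW (p_gt0 ss k). Qed.
Local Notation lev := (lev r0 r1 b1).

Lemma nrm_wphiB u y z : nrm (wphi u y - wphi u z) = r ^+ size u * nrm (y - z).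
Proof.
rewrite (wphi_affine a t u y) (wphi_affine a t u z).
by rewrite opprD addrACA subrr addr0 -cmulBr nrmM (nrm_wmul ss).
Qed.

Lemma X_bounded : exists2 D : R, 0 < D & forall x, X x -> nrm x <= D.
Proof.
have [B [_ HB]] := compact_bounded (compactX sX).
exists (2 * (`|B| + 1)); first by have := normr_ge0 B; lra.
move=> x Xx; apply: (le_trans (nrm_ler x)); rewrite ler_pM2l//.
by apply: HB Xx; rewrite (le_lt_trans (ler_norm B))// ltrDl.
Qed.

(** Letters are replaced one at a time, each at the cost [e]; [adjC] brings the letter concerned
    next to [PL]. *)
Lemma PL_jump_word K (e : R) (f : R * R -> R) zeta k0 w :
  (forall xi j k, `|PL K f (adj [:: j] xi) - PL K f (adj [:: k] xi)| <= e) ->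
  `|PL K f (adj w zeta) - PL K f (adj (nseq (size w) k0) zeta)| <= (size w)%:R * e.
Proof.
move=> H; elim: w zeta => [|k w IH] zeta; first by rewrite subrr normr0 mul0r.
have c u x j : adj (j :: u) x = adj u (adj [:: j] x) by rewrite -adj_cat.
rewrite /= (c w) (c (nseq _ _)).
have := IH (adj [:: k] zeta); rewrite (adjC _ (nseq (size w) k0)) => h1.
have := H (adj (nseq (size w) k0) zeta) k k0.
rewrite [in X in _ - X](adjC _ [:: k0]) => h2.
rewrite -natr1 mulrDl mul1r.
set A := PL K f (adj w _) in h1 *; set B := PL K f (adj [:: k] _) in h1 h2.
set C := PL K f (adj (nseq _ _) _) in h2 *.
have -> : A - C = (A - B) + (B - C) by ring.
by apply: (le_trans (ler_normD _ _)); exact: lerD.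
Qed.

Lemma F01 z : 0 <= F z <= 1. Proof. by rewrite F_ge0 F_le1. Qed.

Lemma PL_F01 n z : 0 <= PL n F z <= 1.
Proof.
apply/andP; split.
  by apply: (avg_ge0 p_ge0 (sum_p ss)) => u; exact: F_ge0.
rewrite -(avg_cst (sum_p ss) n 1); apply: le_avg => // u _; exact: F_le1.
Qed.

Lemma PL_F_lipschitz n z w : `|PL n F z - PL n F w| <= 8 * (r ^+ n * nrm (z - w)).
Proof.
rewrite /PL -avgB; apply: (ler_norm_avg p_ge0 (sum_p ss)) => u su.
apply: (le_trans (F_lipschitz ss _ _)).
by rewrite /adj -cmulBr nrmM nrm_conj (nrm_wmul ss) su.
Qed.

(** This is how [PL] arises from a second conditioning: the letters between positions [m] and [n]
    are averaged out. *)
Lemma condexp_cyl m n (H : seq 'I_l -> R) u y : X y -> (m <= n)%N -> (m <= size u)%N ->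
  condexp m (cyl n (fun w _ => H w)) (wphi u y) = avg p (n - m) (fun w => H (take m u ++ w)).
Proof.
move=> Xy mn mu_; rewrite (condexp_word ss sX)//.
have bc : bmf (cyl n (fun w _ => H w)) by apply: (bmf_cyl r sX) => w; exact: bmf_cst.
have bw u' : bmf (fun z => cyl n (fun w _ => H w) (wphi u' z)).
  by apply: bmf_comp bc; exact: measurable_wphi.
rewrite (Ex_word ss sX (n - m))//; apply: eq_avg => w sw.
rewrite -[RHS](Ex_cst mu); apply: (Ex_ae _ _ (measurable_attractor sX) (muX ss sX)) => //.
- have := bw (take m u ++ w).
  by congr bmf; apply/funext => z; rewrite wphi_cat.
- exact: bmf_cst.
move=> z Xz; rewrite -wphi_cat.
have sz : size (take m u ++ w) = n by rewrite size_cat size_takel// sw subnKC.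
by rewrite (cyl_word ss sX)// ?sz// -[in take n _]sz take_size.
Qed.

Lemma adj_nseq n k z : adj (nseq n k) z = cmul (cpow (conj (a k)) n) z.
Proof.
rewrite /adj -conj_cpow; congr (cmul (conj _) z).
by elim: n => //= n ->.
Qed.

Lemma v_neq0 : v <> 0.
Proof.
move=> v0; apply: (@offline 0).
rewrite (_ : line v 0 = setT); first exact: probability_setT.
by apply/seteqP; split => // x _; rewrite /line /dot v0/= !mul0r addr0.
Qed.

Lemma walk_direction_adj u z : walk_direction a v z -> walk_direction a v (adj u z).
Proof.
elim: u z => [|k u IH] z Dz; first by rewrite /adj /conj/= oppr0 cmul1.
have -> : adj (k :: u) z = adj u (adj [:: k] z) by rewrite -adj_cat.
by apply: IH; rewrite adj_single; exact: (walk_direction_step ss).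
Qed.

Lemma walk_direction_sc (c : R) z : 0 < c -> walk_direction a v z -> walk_direction a v (sc c z).
Proof.
move=> c0 [z0 zv]; split.
  by move/eqP; rewrite -nrm_eq0 nrmZ mulf_eq0 normr_eq0 gt_eqF//= nrm_eq0 => /eqP.
move=> /zv h; transitivity (c * cross z v); last by rewrite h mulr0.
by rewrite /cross /sc/=; ring.
Qed.

(** With [e = eps / 3], the first strong law costs [e], and [|h| <= e + h^2 / e] bounds the
    conditional expectations by [e] plus the average of [GG] divided by [e]. That average is at most
    [7 * e1 = e^2]: [e1] from the second strong law, and twice [3 * e1] from the blocks, where the
    three errors are the passage from [xi] to its limit direction, the exchange of letters, and
    [kernel_bound]. *)
Lemma cos_average_eps (ph eps : R) : 0 < eps ->
  {ae mu, forall x, exists N0, forall N, (N0 <= N)%N ->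
    `|N%:R^-1 * \sum_(i < N) cos (dot (xi i) x + ph)| <= eps}.
Proof.
move=> eps0.
pose e := eps / 3; have e0 : 0 < e by rewrite divr_gt0.
pose e1 := e ^+ 2 / 7; have e10 : 0 < e1 by rewrite divr_gt0// exprn_gt0.
have b0 : 0 < b by exact: lt_trans b1.
have bp k : 0 < b ^+ k by rewrite exprn_gt0.
have rp k : 0 < r ^+ k by rewrite exprn_gt0.
have nv0 : 0 < nrm v by rewrite lt0r nrm_ge0 nrm_eq0 andbT; apply/eqP/v_neq0.
have [C0 C00 HC0] := kernel_bound ss offline e10.
(* Stopping [L] levels early leaves rescaled frequencies of modulus about [C = |v| / r ^+ L], large
   enough for [kernel_bound]. *)
have [L HL] : exists L, r ^+ L * (C0 / nrm v) < 1.
  exact: (cvg_expr_lt ss (C0 / nrm v) ltr01).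
pose C := nrm v / r ^+ L.
have C0C : C0 <= C.
  rewrite /C ler_pdivlMr//; move: HL.
  by rewrite mulrA ltr_pdivrMr// mul1r mulrC => /ltW.
have [ee ee0 Hee] := HC0 C C0C.
have [k0] := index_exists ss.
have [q [s []]] := @close_return R r b r0 r1 b1 (conj (a k0)) ee
   (etrans (nrm_conj _) (nrma ss k0)) ee0 irrational.
set g := sc (b ^+ q) (cpow (conj (a k0)) s).
set dg := g - (1, 0) => q0 dg0 dgee dgreal.
have gE : (1, 0) + dg = g by rewrite addrC subrK.
have [M M0 HM] : exists2 M : nat, (0 < M)%N & forall eta, r * C <= nrm eta <= C ->
    walk_direction a v eta -> M%:R^-1 * \sum_(i < M) F (iter i (cmul g) eta) <= e1.
  rewrite -gE; apply: Hee => // h; apply: dgreal.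
  by rewrite /conj/= h oppr0.
pose W := (M * q)%N.
have W0 : (0 < W)%N by rewrite muln_gt0 M0.
have Mp : 0 < M%:R :> R by rewrite ltr0n.
pose lv := lvl r0 r1 b1 q s M.
have [c1 [c2 [c10 c20 Hc]]] := lvl_bounds r0 r1 b1 s q0 M0.
(* At most [M * s] letters are exchanged in a window, each at the cost [ej]; the successor avoids a
   division by zero. *)
pose ej := e1 / (M * s).+1%:R.
have ej0 : 0 < ej by rewrite divr_gt0.
have [L2 HL2] := PL_jump_cvg0 ss ej0.
have {HL2}HJ := HL2 L2 (leqnn _).
(* [A i] is the depth of the first conditioning and [A' i] that of the second, which frees the [L2]
   letters averaged by [PL]. *)
pose A i := (lv i - L)%N; pose A' i := (lv i - (L + L2))%N.
have [DX DX0 HDX] := X_bounded.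
pose gg i x := cos (dot (xi i) x + ph).
have bgg i : bmf (gg i) by exact: bmf_cos.
pose GG i := cyl (A i) (fun u _ => F (adj u (xi i))).
have bGG i : bmf (GG i) by apply: (bmf_cyl r sX) => u; exact: bmf_cst.
have lam1 : 0 <= b^-1 < 1 by rewrite invr_ge0 ltW//= invf_lt1.
have GG_word i u y : X y -> (A i <= size u)%N -> GG i (wphi u y) = F (adj (take (A i) u) (xi i)).
  by move=> Xy su; rewrite /GG (cyl_word ss sX).
have Kv0 : 0 <= Kv.
  by have := xi_le 0%N; rewrite expr0 mulr1; apply: le_trans; exact: nrm_ge0.
have SL1 : {ae mu, forall x, (fun N : nat => N%:R^-1 *
    \sum_(i < N) (gg i x - condexp (A i) (gg i) x)) @ \oo --> 0}.
  pose K := 2 * (c2 / (c1 * r ^+ 0)) + Kv * (2 * DX) * (c2 / r ^+ L).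
  have K1 : 0 <= Kv * (2 * DX) * (c2 / r ^+ L).
    by rewrite !mulr_ge0// ?invr_ge0 ltW.
  have K2 : 0 <= 2 * (c2 / (c1 * r ^+ 0)) by rewrite expr0 mulr1 mulr_ge0// divr_ge0// ltW.
  apply: (condexp_strong_law ss sX (K := K) bgg _ lam1).
    by move=> i x _; exact: cos_max.
  move=> i j ij; have lamp : 0 <= b^-1 ^+ (j - i) by rewrite exprn_ge0// invr_ge0 ltW.
  (* [lv] need not be monotone. If it has not increased, [j - i] is bounded and the trivial
     alternative holds; otherwise [gg i] varies by at most [|xi i| * r ^+ A j * 2 * DX] on a
     cylinder of order [A j]. *)
  case: (leqP (lv j) (lv i + 0)) => h.
    left; have := lvl_gap c10 ij Hc h => h2.
    rewrite /K mulrDl; apply: ler_wpDr; first exact: mulr_ge0.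
    by rewrite -mulrA; lra.
  have [h'|h'] := leqP (A i) (A j); last first.
    by move: h h'; rewrite addn0 /A; move: (lv i) (lv j); clear; lia.
  right; split => // x /(word_exists sX (A j))[u [y [su Xy ->]]].
  rewrite (condexp_word ss sX)// ?su// -[in take _ u]su take_size.
  rewrite -(Ex_cst mu (gg i (wphi u y))) -ExB; [|exact: bmf_cst|
    by apply: bmf_comp (bgg i); exact: measurable_wphi].
  apply: (ler_norm_Ex_ae _ (measurable_attractor sX) (muX ss sX)).
    by apply: bmfB; [exact: bmf_cst|apply: bmf_comp (bgg i); exact: measurable_wphi].
  move=> z Xz; apply: (le_trans (cos_lipschitz _ _)).
  rewrite opprD addrACA subrr addr0 -dotBr; apply: (le_trans (ler_dot_nrm _ _)).
  rewrite nrm_wphiB su.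
  have yz : nrm (y - z) <= 2 * DX.
    by apply: (le_trans (nrmD _ _)); rewrite nrmN; have := HDX _ Xy; have := HDX _ Xz; lra.
  have rA : r ^+ A j <= c2 / r ^+ L * b^-1 ^+ j.
    rewrite exprVn !ler_pdivlMr//.
    have /andP[_ h2] := Hc j; apply: le_trans h2.
    rewrite mulrAC -exprD; apply: ler_wpM2r; first exact: ltW.
    apply: ler_wiXn2l; [exact: ltW|exact: ltW|].
    by rewrite -/(lv j) /A; move: (lv j); clear; lia.
  apply: (@le_trans _ _ (Kv * b ^+ i * (c2 / r ^+ L * b^-1 ^+ j * (2 * DX)))).
    by apply: ler_pM; rewrite ?nrm_ge0// ?mulr_ge0 ?nrm_ge0// ?ler_pM ?nrm_ge0// ltW.
  rewrite /K [leRHS]mulrDl; apply: ler_wpDl; first exact: mulr_ge0.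
  have -> : b^-1 ^+ j = b^-1 ^+ (j - i) * b^-1 ^+ i by rewrite -exprD subnK.
  rewrite le_eqVlt; apply/orP; left; apply/eqP.
  have bb : b ^+ i * b^-1 ^+ i = 1 by rewrite exprVn mulfV// gt_eqF.
  transitivity (Kv * (2 * DX) * (c2 / r ^+ L) * b^-1 ^+ (j - i) * (b ^+ i * b^-1 ^+ i)); first by ring.
  by rewrite bb mulr1.
have SL2 : {ae mu, forall x, (fun N : nat => N%:R^-1 *
    \sum_(i < N) (GG i x - condexp (A' i) (GG i) x)) @ \oo --> 0}.
  apply: (condexp_strong_law ss sX (K := 2 * (c2 / (c1 * r ^+ L2))) bGG _ lam1).
    move=> i x /(word_exists sX (A i))[u [y [su Xy ->]]].
    by rewrite GG_word ?su//; have /andP[h1 h2] := F01 (adj (take (A i) u) (xi i)); rewrite ger0_norm.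
  move=> i j ij.
  case: (leqP (lv j) (lv i + L2)) => h.
    by left; have := lvl_gap c10 ij Hc h; rewrite -mulrA; lra.
  right; split; first by rewrite /A'; move: h; move: (lv i) (lv j); clear; lia.
  (* [GG i] depends on the first [A i] digits only, so conditioning on the first [A' j] leaves it
     unchanged. *)
  have AA : (A i <= A' j)%N by rewrite /A /A'; move: h; move: (lv i) (lv j); clear; lia.
  move=> x /(word_exists sX (A' j))[u [y [su Xy ->]]].
  rewrite GG_word ?su// (condexp_word ss sX)// ?su//.
  rewrite (Ex_ae (g := fun _ => F (adj (take (A i) u) (xi i))) _ _ (measurable_attractor sX) (muX ss sX)).
  - rewrite Ex_cst subrr normr0 mulr_ge0 ?exprn_ge0 ?invr_ge0// ?mulr_ge0 ?invr_ge0 ?mulr_ge0//; exact: ltW.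
  - by apply: bmf_comp (bGG i); exact: measurable_wphi.
  - exact: bmf_cst.
  - by move=> z Xz; rewrite GG_word// -su take_size// su.
pose H i x := condexp (A' i) (GG i) x.
have A'A i : (A' i <= A i)%N by rewrite /A' /A; move: (lv i); clear; lia.
have HE i u y : X y -> (A' i <= size u)%N ->
    H i (wphi u y) = PL (A i - A' i) F (adj (take (A' i) u) (xi i)).
  move=> Xy su; rewrite /H /GG condexp_cyl//; apply: eq_avg => w _.
  by rewrite adj_cat.
have H01 i x : X x -> 0 <= H i x <= 1.
  move=> /(word_exists sX (A' i))[u [y [su Xy ->]]].
  by rewrite HE ?su//; exact: PL_F01.
have blocks x : X x -> exists B0, forall B, (B0 <= B)%N ->
    \sum_(i < W) H (B * W + i)%N x <= W%:R * (3 * e1).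
  move=> Xx.
  (* The constant undoes the Lipschitz factor [8] of [F] and the rescaling, at most
     [c2 / r ^+ L]. *)
  have d0 : 0 < e1 * r ^+ L / (8 * c2) by rewrite divr_gt0 ?mulr_gt0.
  have [N1 HN1] := xi_cvg d0.
  have [N2 HN2] := lvl_large (L + L2) (fun i => proj2 (andP (Hc i))).
  exists (N1 + N2)%N => B leB.
  (* The times of a block are grouped by residue [c] modulo [q]; along each class the frequency is
     multiplied by [g] at every step, once the letters are exchanged. *)
  have -> : \sum_(i < W) H (B * W + i)%N x =
      \sum_(c < q) \sum_(j < M) H (B * W + (j * q + c))%N x.
    by rewrite (sum_blocks (fun i => H (B * W + i)%N x) M q) exchange_big.
  suff Hc0 (c : 'I_q) : \sum_(j < M) H (B * W + (j * q + c))%N x <= M%:R * (3 * e1).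
    apply: le_trans (ler_sum _ (fun c _ => Hc0 c)) _.
    by rewrite sumr_const card_ord -mulr_natr natrM le_eqVlt; apply/orP; left; apply/eqP; ring.
  pose i0 := (B * W + c)%N.
  have ltBW : (N1 + N2 <= B * W)%N by apply: leq_trans leB _; rewrite leq_pmulr.
  have idx (j : 'I_M) : [/\ lv (B * W + (j * q + c))%N = (lev i0 + j * s)%N &
      (B * W + (j * q + c))%N = (i0 + j * q)%N].
    have [hb ht] := block_index q0 M0 B (ltn_ord j) (ltn_ord c).
    rewrite /lv /lvl hb ht /i0; split => //; clear; lia.
  have lev0 : (L + L2 <= lev i0)%N.
    have := HN2 i0; have [] := idx (Ordinal M0).
    rewrite /= !mul0n !addn0 add0n /lv => -> _; apply.
    by rewrite /i0; move: ltBW; clear; lia.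
  (* One word long enough for all [M] times of the class; its prefix [u0] is common to them. *)
  have [u [y [su Xy xE]]] := word_exists sX (lev i0 + M * s) Xx.
  pose n0 := (lev i0 - (L + L2))%N.
  pose u0 := take n0 u.
  pose z0 := adj u0 (sc (b ^+ i0) v).
  have term (j : 'I_M) : H (B * W + (j * q + c))%N x <=
      PL L2 F (iter j (cmul g) z0) + 2 * e1.
    have [lvj ij] := idx j; set i := (B * W + _)%N in lvj ij *.
    have A'i : A' i = (n0 + j * s)%N by rewrite /A' lvj /n0; move: lev0; move: (lev i0); clear; lia.
    have AA' : (A i - A' i = L2)%N by rewrite A'i /A lvj /n0; move: lev0; move: (lev i0); clear; lia.
    have jM := ltn_ord j.
    have sA' : (A' i <= size u)%N.
      rewrite su A'i /n0; apply: leq_add; first exact: leq_subr.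
      by rewrite leq_mul2r ltnW ?orbT.
    rewrite xE HE// AA'.
    have tE : take (A' i) u = u0 ++ take (j * s) (drop n0 u) by rewrite A'i takeD.
    set w := take (j * s) (drop n0 u) in tE.
    have sw : size w = (j * s)%N.
      rewrite /w size_takel// size_drop su.
      have : (j * s <= M * s)%N by rewrite leq_mul2r ltnW ?orbT.
      by rewrite /n0; move: (lev i0) (j * s)%N (M * s)%N; clear; lia.
    have s1 : `|PL L2 F (adj (take (A' i) u) (xi i)) -
        PL L2 F (adj (take (A' i) u) (sc (b ^+ i) v))| <= e1.
      apply: (le_trans (PL_F_lipschitz _ _ _)).
      have -> : adj (take (A' i) u) (xi i) - adj (take (A' i) u) (sc (b ^+ i) v) =
         adj (take (A' i) u) (xi i - sc (b ^+ i) v) by rewrite /adj cmulBr.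
      rewrite (nrm_adj ss) size_takel//.
      have N1i : (N1 <= i)%N by rewrite /i; move: ltBW; clear; lia.
      have h1 : r ^+ L2 * r ^+ A' i * b ^+ i <= c2 / r ^+ L.
        rewrite ler_pdivlMr// -exprD mulrAC -exprD.
        have -> : (L2 + A' i + L = lv i)%N by rewrite A'i lvj /n0; move: lev0; move: (lev i0); clear; lia.
        by have /andP[] := Hc i.
      have h2 := HN1 i N1i.
      apply: (@le_trans _ _ (8 * (r ^+ L2 * (r ^+ A' i * (e1 * r ^+ L / (8 * c2) * b ^+ i))))).
        by rewrite !ler_pM2l.
      have -> : 8 * (r ^+ L2 * (r ^+ A' i * (e1 * r ^+ L / (8 * c2) * b ^+ i))) =
        8 * (e1 * r ^+ L / (8 * c2)) * (r ^+ L2 * r ^+ A' i * b ^+ i) by ring.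
      apply: (le_trans (ler_wpM2l _ h1)); first by rewrite mulr_ge0// ltW.
      rewrite le_eqVlt; apply/orP; left; apply/eqP; field.
      by rewrite !gt_eqF.
    have s2 : `|PL L2 F (adj (take (A' i) u) (sc (b ^+ i) v)) - PL L2 F (iter j (cmul g) z0)| <= e1.
      rewrite tE adj_cat.
      have -> : iter j (cmul g) z0 = adj (nseq (size w) k0) (adj u0 (sc (b ^+ i) v)).
        rewrite adj_nseq sw iter_cmul /g cpow_sc cpowM /z0 cmulZl ij exprD.
        by rewrite mulrC -scM /adj (cmulZr (b ^+ (j * q))) (cmulZr (b ^+ (j * q))) -exprM (mulnC q) (mulnC s).
      have HJF z j1 j2 : `|PL L2 F (adj [:: j1] z) - PL L2 F (adj [:: j2] z)| <= ej.
        by apply: HJ => z'; exact: F01.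
      apply: (le_trans (PL_jump_word (adj u0 (sc (b ^+ i) v)) k0 w HJF)).
      rewrite sw /ej mulrA ler_pdivrMr// mulrC ler_pM2l// ler_nat.
      by apply: leqW; rewrite leq_mul2r ltnW ?orbT.
    move: s1 s2; rewrite !ler_norml => /andP[_ s1] /andP[_ s2]; lra.
  apply: (le_trans (ler_sum _ (fun j _ => term j))).
  rewrite big_split/= sumr_const card_ord.
  (* Commutation moves the average over words outside the sum over time; for each [w] the window
     starts at [adj w z0], whose modulus lies between [r * C] and [C] by [levP]. *)
  have main : \sum_(j < M) PL L2 F (iter j (cmul g) z0) <= M%:R * e1.
    have -> : \sum_(j < M) PL L2 F (iter j (cmul g) z0) =
        avg p L2 (fun w => \sum_(j < M) F (iter j (cmul g) (adj w z0))).
      rewrite (avg_sum (sum_p ss)); apply: eq_bigr => j _; apply: eq_avg => w _.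
      by rewrite !iter_cmul /adj !cmulA (cmulC (conj _) (cpow _ _)).
    rewrite -[leRHS](avg_cst (sum_p ss) L2); apply: (le_avg p_ge0) => w sw.
    rewrite -ler_pdivrMl//; apply: HM; last first.
      apply: walk_direction_adj; apply: walk_direction_adj; apply: walk_direction_sc => //.
      by split; [exact: v_neq0|move=> _; rewrite /cross mulrC subrr].
    have su0 : size u0 = n0 by rewrite size_takel// su /n0; move: (lev i0); clear; lia.
    have e3 : r ^+ (L2 + n0) = r ^+ lev i0 / r ^+ L.
      apply: (canRL (mulfK _)); first by rewrite gt_eqF.
      by rewrite -exprD; congr (_ ^+ _); rewrite /n0; move: lev0; move: (lev i0); clear; lia.
    have nz : nrm (adj w z0) = (r ^+ lev i0 * b ^+ i0) * C.
      rewrite !(nrm_adj ss) sw nrmZ (ger0_norm (ltW (bp _))) su0.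
      transitivity (r ^+ (L2 + n0) * b ^+ i0 * nrm v); first by rewrite exprD; ring.
      by rewrite e3 /C; ring.
    have /andP[l1 l2] := levP r0 r1 b1 i0.
    have C_ge0 : 0 <= C by apply: ltW; apply: lt_le_trans C0C.
    rewrite nz; apply/andP; split; first by apply: ler_wpM2r => //; exact: ltW.
    by rewrite ler_piMl.
  by rewrite -mulr_natr; lra.
have aeX : {ae mu, forall x, X x}.
  exists (~` X); split => //; first by apply: measurableC; exact: (measurable_attractor sX).
  by apply: etrans (probability_setC mu (measurable_attractor sX)) _; rewrite (muX ss sX) subee.
apply: (filterS _ (filterI (filterI SL1 SL2) aeX)) => x [[sl1 sl2] Xx].
have [B0 HB0] := blocks x Xx.
have e13 : 0 < 3 * e1 by rewrite mulr_gt0.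
have [N3 HN3] := block_average W0 e13 (fun i => H01 i x Xx) HB0.
move/cvgrPdist_le: sl1 => /(_ e e0)[N1 _ HN1].
move/cvgrPdist_le: sl2 => /(_ e1 e10)[N2 _ HN2].
exists (N1 + N2 + N3 + 1)%N => N leN.
have Np : 0 < N%:R :> R by rewrite ltr0n; move: leN; clear; lia.
have /= := HN1 N ltac:(rewrite /=; move: leN; clear; lia); rewrite sub0r normrN => h1.
have /= := HN2 N ltac:(rewrite /=; move: leN; clear; lia); rewrite sub0r normrN => h2.
have h3 := HN3 N ltac:(move: leN; clear; lia).
have avgG : N%:R^-1 * \sum_(i < N) GG i x <= 7 * e1.
  have -> : \sum_(i < N) GG i x = \sum_(i < N) (GG i x - condexp (A' i) (GG i) x) + \sum_(i < N) H i x.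
    by rewrite -big_split/=; apply: eq_bigr => i _; rewrite subrK.
  rewrite mulrDr; move: h2 h3; rewrite ler_norml => /andP[_]; lra.
have hle i : `|condexp (A i) (gg i) x| <= e + e^-1 * GG i x.
  have [u [y [su Xy ->]]] := word_exists sX (A i) Xx.
  rewrite GG_word ?su// (condexp_word ss sX)// ?su// -[in take _ u]su take_size.
  have := sqr_Ex_cos_wphi_le a t mu (xi i) u ph.
  set h := Ex _ _ => hF.
  have h2' : `|h| ^+ 2 <= F (adj u (xi i)) by rewrite real_normK ?num_real.
  case: (leP `|h| e) => he.
    by apply: (le_trans he); rewrite lerDl mulr_ge0 ?F_ge0// invr_ge0 ltW.
  apply: ler_wpDl; first exact: ltW.
  rewrite ler_pdivlMl//; apply: le_trans h2'; rewrite expr2 ler_wpM2r// ltW//.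
have -> : \sum_(i < N) cos (dot (xi i) x + ph) =
   \sum_(i < N) (gg i x - condexp (A i) (gg i) x) + \sum_(i < N) condexp (A i) (gg i) x.
  by rewrite -big_split/=; apply: eq_bigr => i _; rewrite subrK.
rewrite mulrDr; apply: (le_trans (ler_normD _ _)).
have h4 : `|N%:R^-1 * \sum_(i < N) condexp (A i) (gg i) x| <= e + e^-1 * (7 * e1).
  rewrite normrM normfV (ger0_norm (ltW Np)) ler_pdivrMl//.
  apply: (le_trans (ler_norm_sum _ _ _)).
  apply: (@le_trans _ _ (\sum_(i < N) (e + e^-1 * GG i x))).
    by apply: ler_sum => i _; exact: hle.
  rewrite big_split/= sumr_const card_ord -mulr_sumr -(mulr_natl e N) [leRHS]mulrDr lerD2l.
  rewrite [leRHS]mulrCA; apply: ler_wpM2l; first by rewrite invr_ge0 ltW.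
  by rewrite -ler_pdivrMl.
have e7 : e^-1 * (7 * e1) = e by rewrite /e1; field; rewrite gt_eqF.
have e3 : eps = 3 * e by rewrite /e; field.
by rewrite e3; rewrite e7 in h4; lra.
Qed.

Theorem cos_average_cvg0 (ph : R) :
  {ae mu, forall x, (fun N : nat => N%:R^-1 * \sum_(i < N) cos (dot (xi i) x + ph)) @ \oo --> 0}.
Proof.
have : {ae mu, forall x, forall k : nat, exists N0, forall N, (N0 <= N)%N ->
    `|N%:R^-1 * \sum_(i < N) cos (dot (xi i) x + ph)| <= k.+1%:R^-1}.
  by apply/ae_foralln => k; apply: cos_average_eps; rewrite invr_gt0.
apply: filterS => x Hx; apply/cvgrPdist_le => e e0.
have := @cvg_harmonic R => /cvgrPdist_lt /(_ e e0)[k _ /(_ k (leqnn _))].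
rewrite /harmonic/= sub0r normrN ger0_norm// => ke.
have [N0 HN0] := Hx k; exists N0 => // N /= /HN0 h.
by rewrite sub0r normrN; apply: le_trans (ltW ke).
Qed.

End CosineAverages.

(** * Trigonometric approximation on the torus *)

Section UnitSquare.
Variable R : realType.
Let leb := @lebesgue_measure R.
Let LL := (leb \x leb)%E.
Let J : set R := `[0, 1]%classic.
Let Q : set (R * R) := J `*` J.

Let mJ : measurable J. Proof. exact: measurable_itv. Qed.

Lemma measurable_square : measurable Q.
Proof. exact: measurableX. Qed.
Let mQ := measurable_square.

Lemma square_measure : LL Q = 1%E.
Proof.
have e : leb J = 1%E by rewrite /leb /J lebesgue_measure_itv/= lte_fin ltr01 -EFinB subr0.
transitivity (leb J * leb J)%E; last by rewrite e mule1.
exact: product_measure1E.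
Qed.

Definition Isq (f : R * R -> R) : R := Rintegral LL Q f.

Lemma bmf_integrable_square f : bmf f -> LL.-integrable Q (EFin \o f).
Proof.
move=> [mf [K fK]]; apply: measurable_bounded_integrable => //.
- apply: (@le_lt_trans _ _ 1%E); last exact: ltry.
  by rewrite le_eqVlt; apply/orP; left; apply/eqP; exact: square_measure.
- exact: measurable_funTS.
- by exists K; split; [exact: num_real|move=> M KM x _; exact/(le_trans (fK x))/ltW].
Qed.

Lemma IsqD f g : bmf f -> bmf g -> Isq (fun z => f z + g z) = Isq f + Isq g.
Proof. by move=> bf bg; apply: RintegralD => //; exact: bmf_integrable_square. Qed.

Lemma IsqZ c f : bmf f -> Isq (fun z => c * f z) = c * Isq f.
Proof. by move=> bf; apply: RintegralZl => //; exact: bmf_integrable_square. Qed.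

Lemma Isq_cst c : Isq (fun=> c) = c.
Proof.
by rewrite /Isq Rintegral_cst// [X in fine X]square_measure/= mulr1.
Qed.

Lemma Isq_close f g e : bmf f -> bmf g -> (forall z, `|f z - g z| <= e) -> `|Isq f - Isq g| <= e.
Proof.
move=> bf bg fg.
have bfg : bmf (fun z => f z - g z) by exact: bmfB.
have -> : Isq f - Isq g = Isq (fun z => f z - g z).
  rewrite IsqD//; last exact: bmfN.
  congr (_ + _); have := IsqZ (-1) bg; rewrite mulN1r => <-.
  by congr Isq; apply/funext => z; rewrite mulN1r.
rewrite ler_norml; apply/andP; split.
  rewrite -(Isq_cst (- e)); apply: le_Rintegral => //;
    do ?[exact: bmf_integrable_square]; first exact/bmf_integrable_square/bmf_cst.
  by move=> z _; have := fg z; rewrite ler_norml => /andP[].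
rewrite -[leRHS](Isq_cst e); apply: le_Rintegral => //;
    do ?[exact: bmf_integrable_square]; first exact/bmf_integrable_square/bmf_cst.
by move=> z _; have := fg z; rewrite ler_norml => /andP[].
Qed.

Lemma integral_cos_period (k : int) (c : R) : k != 0 ->
  (\int[leb]_(y in J) (cos (2 * pi * k%:~R * y + c))%:E = 0)%E.
Proof.
move=> k0; set w := 2 * pi * k%:~R.
have w0 : w != 0 by rewrite !mulf_neq0// ?intr_eq0// gt_eqF// pi_gt0.
pose f (y : R) : R := cos (w * y + c); pose F (y : R) : R := w^-1 * sin (w * y + c).
have dF (y : R) : is_derive y (1 : R) F (f y).
  rewrite /F /f; apply: is_derive_eq.
  by rewrite /GRing.scale/=; field.
have cf : continuous f.
  move=> y; apply: continuous_comp; last exact: continuous_cos.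
  by apply: cvgD; [apply: cvgM; [exact: cvg_cst|exact: cvg_id]|exact: cvg_cst].
have cF : continuous F.
  move=> y; apply: cvgM; first exact: cvg_cst.
  apply: (@continuous_comp _ _ _ (fun y => w * y + c) sin); last exact: continuous_sin.
  by apply: cvgD; [apply: cvgM; [exact: cvg_cst|exact: cvg_id]|exact: cvg_cst].
rewrite (@continuous_FTC2 _ f F 0 1)//.
- rewrite /F mulr1 mulr0 add0r -EFinB; congr EFin.
  rewrite (_ : w + c = c + (pi *+ 2) *~ k); last by rewrite /w -mulrzr -mulr_natr; ring.
  have sinz (i : int) : sin (c + pi *+ 2 *~ i) = sin c.
    have sinn (n : nat) x : sin (x + pi *+ 2 *+ n) = sin x :> R.
      by apply: periodicn; exact: sinD2pi.
    case: i => n; first exact: sinn.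
    by rewrite NegzE mulrNz -[in RHS](subrK (pi *+ 2 *+ n.+1) c) sinn.
  by rewrite sinz subrr.
- by apply: continuous_subspaceT.
- split => [y _||]; [by have [] := dF y| |].
    by apply: cvg_at_right_filter; exact: cF.
  by apply: cvg_at_left_filter; exact: cF.
- by move=> y _; rewrite derive1E derive_val.
Qed.

(** The phase [c] lets real cosines stand for both parts of a character, and makes a product of
    waves a sum of waves. *)
Definition wave (j k : int) (c : R) (z : R * R) : R :=
  cos (2 * pi * (j%:~R * z.1 + k%:~R * z.2) + c).

Lemma bmf_wave j k c : bmf (wave j k c).
Proof.
have := bmf_cos (2 * pi * j%:~R, 2 * pi * k%:~R) c.
by congr bmf; apply/funext => z; rewrite /wave /dot/=; congr cos; ring.
Qed.

(** Fubini, integrating first along a coordinate whose frequency is nonzero. *)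
Lemma Isq_wave (j k : int) (c : R) : (j != 0) || (k != 0) -> Isq (wave j k c) = 0.
Proof.
move=> jk; rewrite /Isq /Rintegral integral_mkcond.
set g := _ \_ _.
have ig : LL.-integrable setT g.
  by rewrite -integrable_mkcond//; apply: bmf_integrable_square; exact: bmf_wave.
have gE x y : g (x, y) = ((fun x => (\1_J x)%:E) x * ((fun y => (wave j k c (x, y))%:E) \_ J) y)%E.
  rewrite /g !patchE indicE in_setX/=.
  by case: (x \in J); case: (y \in J); rewrite /= ?mul1e ?mul0e ?mule0.
have gE' x y : g (x, y) = ((fun y => (\1_J y)%:E) y * ((fun x => (wave j k c (x, y))%:E) \_ J) x)%E.
  rewrite /g !patchE indicE in_setX/=.
  by case: (x \in J); case: (y \in J); rewrite /= ?mul1e ?mul0e ?mule0.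
have [k0|k0] := eqVneq k 0.
  have j0 : j != 0 by move: jk; rewrite k0 eqxx orbF.
  rewrite -(integral21_prod_meas1 ig) (eq_integral (fun=> 0%E)) ?integral0// => y _.
  rewrite /fubini_G; under eq_integral do rewrite gE'.
  have [yJ|yJ] := boolP (y \in J); last first.
    rewrite (eq_integral (fun=> 0%E)) ?integral0// => x _.
    by rewrite indicE (negbTE yJ) mul0e.
  transitivity (\int[leb]_x (((fun x => (wave j k c (x, y))%:E) \_ J) x))%E.
    by apply: eq_integral => x _; rewrite indicE yJ mul1e.
  rewrite -integral_mkcond -[RHS](integral_cos_period (2 * pi * (k%:~R * y) + c) j0).
  by apply: eq_integral => x _; rewrite /wave/=; congr EFin; congr cos; ring.
rewrite -(integral12_prod_meas1 ig) (eq_integral (fun=> 0%E)) ?integral0// => x _.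
rewrite /fubini_F; under eq_integral do rewrite gE.
have [xJ|xJ] := boolP (x \in J); last first.
  rewrite (eq_integral (fun=> 0%E)) ?integral0// => y _.
  by rewrite indicE (negbTE xJ) mul0e.
transitivity (\int[leb]_y (((fun y => (wave j k c (x, y))%:E) \_ J) y))%E.
  by apply: eq_integral => y _; rewrite indicE xJ mul1e.
rewrite -integral_mkcond -[RHS](integral_cos_period (2 * pi * (j%:~R * x) + c) k0).
by apply: eq_integral => y _; rewrite /wave/=; congr EFin; congr cos; ring.
Qed.

Inductive trig : (R * R -> R) -> Prop :=
| trig0 : trig (fun=> 0)
| trig_cons a j k c g : trig g -> trig (fun z => a * wave j k c z + g z).

Lemma trigD f g : trig f -> trig g -> trig (fun z => f z + g z).
Proof.
elim=> [tg|a j k c h _ IH tg]; first by under eq_fun do rewrite add0r.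
under eq_fun do rewrite -addrA; apply: trig_cons; exact: IH.
Qed.

Lemma trigZ b f : trig f -> trig (fun z => b * f z).
Proof.
elim=> [|a j k c h _ IH]; first by under eq_fun do rewrite mulr0; exact: trig0.
by under eq_fun do rewrite mulrDr mulrA; exact: trig_cons.
Qed.

Lemma trig_wave j k c : trig (wave j k c).
Proof.
have := trig_cons 1 j k c trig0.
by congr trig; apply/funext => z; rewrite mul1r addr0.
Qed.

Lemma trig_cst c : trig (fun=> c).
Proof.
have := trigZ c (trig_wave 0 0 0).
by congr trig; apply/funext => z; rewrite /wave !mulr0z !mul0r !addr0 mulr0 cos0 mulr1.
Qed.

Lemma trig_sum I (s : seq I) (f : I -> R * R -> R) :
  (forall i, trig (f i)) -> trig (fun z => \sum_(i <- s) f i z).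
Proof.
move=> tf; elim: s => [|i s IH].
  by under eq_fun do rewrite big_nil; exact: trig0.
by under eq_fun do rewrite big_cons; exact: trigD.
Qed.

Lemma wave_mul j k c j' k' c' z : wave j k c z * wave j' k' c' z =
  2^-1 * wave (j + j') (k + k') (c + c') z + 2^-1 * wave (j - j') (k - k') (c - c') z.
Proof.
rewrite /wave !rmorphD !rmorphN/=.
set A := 2 * pi * (j%:~R * z.1 + k%:~R * z.2) + c.
set B := 2 * pi * (j'%:~R * z.1 + k'%:~R * z.2) + c'.
have -> : 2 * pi * ((j%:~R + j'%:~R) * z.1 + (k%:~R + k'%:~R) * z.2) + (c + c') = A + B.
  by rewrite /A /B; ring.
have -> : 2 * pi * ((j%:~R - j'%:~R) * z.1 + (k%:~R - k'%:~R) * z.2) + (c - c') = A - B.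
  by rewrite /A /B; ring.
by rewrite (cosD A B) (cosB A B); field.
Qed.

Lemma trigM f g : trig f -> trig g -> trig (fun z => f z * g z).
Proof.
move=> tf; elim=> [|a j k c h _ IH]; first by under eq_fun do rewrite mulr0; exact: trig0.
under eq_fun do rewrite mulrDr; apply: trigD => //.
elim: tf => [|b j' k' c' g' _ IH']; first by under eq_fun do rewrite mul0r; exact: trig0.
under eq_fun do rewrite mulrDl; apply: trigD => //.
have -> : (fun z => b * wave j' k' c' z * (a * wave j k c z)) =
  (fun z => (b * a) * (2^-1 * wave (j' + j) (k' + k) (c' + c) z + 2^-1 * wave (j' - j) (k' - k) (c' - c) z)).
  by apply/funext => z; rewrite -wave_mul; ring.
by apply: trigZ; apply: trigD; apply: trigZ; exact: trig_wave.
Qed.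

Lemma bmf_trig f : trig f -> bmf f.
Proof.
elim=> [|a j k c g _ IH]; first exact: bmf_cst.
by apply: bmfD => //; apply: bmfM; [exact: bmf_cst|exact: bmf_wave].
Qed.

(** A smooth substitute, of period [1], for the squared distance to the nearest integer. *)
Definition sin2 (x : R) : R := sin (pi * x) ^+ 2.

Lemma cos2E (x : R) : cos (pi * x) ^+ 2 = 2^-1 + 2^-1 * cos (2 * (pi * x)).
Proof. by rewrite cosM2 cos2sin2; field. Qed.

(** The product of the squares of [cos (2^i pi x)] for [i < n], that is the square of
    [sin (2^n pi x) / (2^n sin (pi x))]: the Fejer kernel of order [2^n], scaled to be [1] at
    integers. In product form it is visibly a nonnegative trigonometric polynomial, and suits
    induction by doubling. *)
Fixpoint fejer n (x : R) : R :=
  if n is n'.+1 then cos (pi * x) ^+ 2 * fejer n' (2 * x) else 1.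

Lemma fejer_ge0 n x : 0 <= fejer n x.
Proof. by elim: n x => //= n IH x; rewrite mulr_ge0// sqr_ge0. Qed.

Lemma sqr_cosDpi (x : R) : cos (x + pi) ^+ 2 = cos x ^+ 2.
Proof. by rewrite cosDpi sqrrN. Qed.

Lemma fejer_periodB1 n x : fejer n (x - 1) = fejer n x.
Proof.
elim: n x => //= n IH x; congr (_ * _).
  by rewrite -(sqr_cosDpi (pi * (x - 1))); congr (cos _ ^+ 2); ring.
have -> : 2 * (x - 1) = 2 * x - 1 - 1 by ring.
by rewrite !IH.
Qed.

(** In the doubling step the nodes [i] and [2^n + i] are half a period apart, so their first factors
    are a squared cosine and a squared sine and add up to [1]. *)
Lemma sum_fejer n x : \sum_(i < 2 ^ n) fejer n (x - i%:R / (2 ^ n)%:R) = 1.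
Proof.
elim: n x => [|n IH] x; first by rewrite expn0 big_ord1.
have -> : (2 ^ n.+1 = 2 ^ n + 2 ^ n)%N by rewrite expnS mul2n addnn.
rewrite big_split_ord/= -big_split/= -[RHS](IH (2 * x)).
have N0 : (2 ^ n)%:R != 0 :> R by rewrite pnatr_eq0 expn_eq0.
apply: eq_bigr => i _; rewrite natrD (natrD _ (2 ^ n)%N i).
set N := (2 ^ n)%:R in N0 *; set q : R := i%:R.
have NN : N + N != 0 by rewrite -mulr2n mulrn_eq0.
have e1 : 2 * (x - q / (N + N)) = 2 * x - q / N by field; rewrite ?NN ?N0.
have e2 : 2 * (x - (N + q) / (N + N)) = 2 * x - q / N - 1 by field; rewrite ?NN ?N0.
rewrite e1 e2 fejer_periodB1 -mulrDl.
have e3 : pi * (x - q / (N + N)) = pi * (x - (N + q) / (N + N)) + pi / 2 by field; rewrite ?NN ?N0.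
by rewrite e3 cosDpihalf sqrrN addrC cos2Dsin2 mul1r.
Qed.

(** By the double angle formula for the sine, the left side is [sin2] at [2^n x]. *)
Lemma sin2_fejer n x : 4 ^+ n * (sin2 x * fejer n x) <= 1.
Proof.
have sin2_le1 y : sin2 y <= 1.
  by rewrite /sin2 -(real_normK (num_real _)) expr_le1// sin_max.
elim: n x => [|n IH] x; first by rewrite expr0 mul1r /= mulr1.
apply: le_trans (IH (2 * x)); rewrite le_eqVlt; apply/orP; left; apply/eqP.
rewrite /= exprS /sin2.
have -> : pi * (2 * x) = (pi * x) *+ 2 by rewrite -mulr_natr; ring.
by rewrite sin_mulr2n -mulr_natr; ring.
Qed.

(** The dilation [N] and the shift [al] are there because the recursion doubles both. *)
Lemma trig_fejer1 n al (N : nat) : trig (fun z => fejer n (N%:R * z.1 - al)).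
Proof.
elim: n N al => [|n IH] N al /=; first exact: trig_cst.
apply: trigM.
  have -> : (fun z : R * R => cos (pi * (N%:R * z.1 - al)) ^+ 2) =
     (fun z => 2^-1 + 2^-1 * wave N 0 (- (2 * (pi * al))) z).
    by apply/funext => z; rewrite cos2E /wave mulr0z mul0r addr0; congr (_ + _ * cos _); rewrite -pmulrn; ring.
  by apply: trigD; [exact: trig_cst|apply: trigZ; exact: trig_wave].
have := IH (2 * N)%N (2 * al); congr trig; apply/funext => z; congr fejer.
by rewrite natrM; ring.
Qed.

Lemma trig_fejer2 n al (N : nat) : trig (fun z => fejer n (N%:R * z.2 - al)).
Proof.
elim: n N al => [|n IH] N al /=; first exact: trig_cst.
apply: trigM.
  have -> : (fun z : R * R => cos (pi * (N%:R * z.2 - al)) ^+ 2) =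
     (fun z => 2^-1 + 2^-1 * wave 0 N (- (2 * (pi * al))) z).
    by apply/funext => z; rewrite cos2E /wave mulr0z mul0r add0r; congr (_ + _ * cos _); rewrite -pmulrn; ring.
  by apply: trigD; [exact: trig_cst|apply: trigZ; exact: trig_wave].
have := IH (2 * N)%N (2 * al); congr trig; apply/funext => z; congr fejer.
by rewrite natrM; ring.
Qed.

End UnitSquare.

(** * Uniform approximation of torus functions and Weyl's criterion *)

Section TorusApproximation.
Variable R : realType.
Implicit Types (f : R * R -> R) (z w : R * R).

Lemma norm_sinDpi_int (x : R) (p : int) : `|sin (x + pi * p%:~R)| = `|sin x|.
Proof.
have H (n : nat) y : `|sin (y + pi * n%:R)| = `|sin y| :> R.
  elim: n y => [|n IH] y; first by rewrite mulr0 addr0.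
  rewrite -natr1 mulrDr mulr1 addrA sinDpi normrN; exact: IH.
case: p => n; first exact: H.
by rewrite NegzE mulrNz mulrN -[in RHS](subrK (pi * n.+1%:R) x) H.
Qed.

(** For the nearest integer [p], put [y = pi (u - p)], so [|y| <= pi/2]. Monotonicity of the sine
    and [sin 1 >= 1/2] give [|y| < 1], whence [|sin y| >= |y|/2 >= |u - p|]. *)
Lemma near_int (u : R) : `|sin (pi * u)| < 2^-1 ->
  exists p : int, `|u - p%:~R| <= `|sin (pi * u)|.
Proof.
move=> h; pose p := Num.floor (u + 2^-1); exists p.
pose y := pi * (u - p%:~R).
have sy : `|sin y| = `|sin (pi * u)|.
  by rewrite -(norm_sinDpi_int y p) /y; congr `|sin _|; ring.
have /andP[p1 p2] := floor_itv (u + 2^-1); rewrite -/p in p1 p2.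
have pi0 := pi_gt0 R; have pi2 := pi_ge2 R.
have s2 : `|u - p%:~R| <= 2^-1.
  by move: p2; rewrite intrD ler_norml => p2; apply/andP; split; lra.
have yE : `|y| = pi * `|u - p%:~R| by rewrite normrM (ger0_norm (ltW pi0)).
have sny : sin `|y| <= `|sin y|.
  by case: (leP 0 y) => y0; [rewrite (ger0_norm y0)|rewrite (ltr0_norm y0) sinN -normrN]; exact: ler_norm.
have sin1 : 2^-1 <= sin 1 :> R.
  have := @norm_sin_ge R 1; rewrite normr1 => /(_ (lexx _)).
  by rewrite ger0_norm ?div1r//; apply: sin_ge0_pi; lra.
have y1 : `|y| < 1.
  rewrite ltNge; apply/negP => y1.
  have : sin 1 <= sin `|y|.
    rewrite leNgt ltr_sin ?in_itv/=; first by rewrite -leNgt.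
      by have := normr_ge0 y; move=> ?; apply/andP; split; [lra|rewrite yE; nra].
    by apply/andP; split; lra.
  by move: sny h sy; lra.
have := norm_sin_ge (ltW y1); rewrite sy yE.
by have := normr_ge0 (u - p%:~R); nra.
Qed.

Lemma torus_int f z (p q : int) : torus_fun f -> f (z.1 + p%:~R, z.2 + q%:~R) = f z.
Proof.
move=> [_ per].
have H1 (n : nat) x y : f (x + n%:R, y) = f (x, y).
  elim: n x => [|n IH] x; first by rewrite addr0.
  by rewrite -natr1 addrA; have [-> _] := per (x + n%:R, y); exact: IH.
have H2 (n : nat) x y : f (x, y + n%:R) = f (x, y).
  elim: n y => [|n IH] y; first by rewrite addr0.
  by rewrite -natr1 addrA; have [_ ->] := per (x, y + n%:R); exact: IH.
have K1 (i : int) x y : f (x + i%:~R, y) = f (x, y).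
  by case: i => n; rewrite ?H1// NegzE mulrNz -[in RHS](subrK (n.+1%:R) x) H1.
have K2 (i : int) x y : f (x, y + i%:~R) = f (x, y).
  by case: i => n; rewrite ?H2// NegzE mulrNz -[in RHS](subrK (n.+1%:R) y) H2.
by rewrite K1 K2; case: z.
Qed.

Lemma compact_square : compact (`[(0 : R), 1]%classic `*` `[(0 : R), 1]%classic).
Proof. by apply: compact_setX; exact: segment_compact. Qed.

Lemma torus_reduce z : exists p q : int,
  (`[(0 : R), 1]%classic `*` `[(0 : R), 1]%classic) (z.1 + p%:~R, z.2 + q%:~R).
Proof.
exists (- Num.floor z.1), (- Num.floor z.2); split; rewrite /= in_itv/= mulrNz.
  by have /andP[] := floor_itv z.1; rewrite intrD; lra.
by have /andP[] := floor_itv z.2; rewrite intrD; lra.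
Qed.

(** A common integer translation brings [z] into the compact square; [w] may leave it, so the
    covering argument quantifies over all [w]. *)
Lemma torus_uniform f e : torus_fun f -> 0 < e -> exists2 d : R, 0 < d &
  forall z w, `|z - w| < d -> `|f z - f w| <= e.
Proof.
move=> tf e0; have [cf _] := tf.
have := compact_square; rewrite compact_near_coveringP => /(_ nat \oo
  (fun n z => forall w, `|z - w| < n.+1%:R^-1 -> `|f z - f w| <= e) _)[].
  move=> x0 _.
  have e2 : 0 < e / 2 by rewrite divr_gt0.
  have /cvgrPdist_lt /(_ _ e2) /nbhs_ballP[dl /= dl0 Hdl] := cf x0.
  have dl2 : 0 < dl / 2 by rewrite divr_gt0.
  have := @cvg_harmonic R => /cvgrPdist_lt /(_ _ dl2)[m _ Hm].
  exists (ball x0 (dl / 2), [set n | (m <= n)%N]).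
    by split; [exact: nbhsx_ballx|exists m].
  move=> [z n] /= [bz mn] w zw.
  have nd : n.+1%:R^-1 < dl / 2.
    by have := Hm n mn; rewrite /harmonic/= sub0r normrN ger0_norm.
  have bw : `|x0 - w| < dl.
    move: bz; rewrite -ball_normE/= => bz.
    have := ler_normD (x0 - z) (z - w); rewrite addrA subrK => h.
    by apply: (le_lt_trans h); rewrite [ltRHS]splitr; apply: ltrD => //; exact: lt_trans nd.
  have bz' : `|x0 - z| < dl.
    by move: bz; rewrite -ball_normE/= => /lt_trans; apply; rewrite ltr_pdivrMr// ltr_pMr// ltr1n.
  have h1 : `|f x0 - f z| < e / 2 by apply: Hdl; rewrite -ball_normE.
  have h2 : `|f x0 - f w| < e / 2 by apply: Hdl; rewrite -ball_normE.
  have -> : f z - f w = (f x0 - f w) - (f x0 - f z) by ring.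
  by apply: (le_trans (ler_normB _ _)); rewrite [leRHS]splitr; apply: lerD; exact: ltW.
move=> N _ HN; exists (N.+1%:R^-1); first by rewrite invr_gt0.
move=> z w zw; have [p [q zQ]] := torus_reduce z.
rewrite -(torus_int z p q tf) -(torus_int w p q tf).
apply: (HN N (leqnn N) _ zQ).
rewrite (_ : (_, _) - (_, _) = z - w)//.
by case: z {zw zQ} => z1 z2; case: w => w1 w2; congr pair => /=; ring.
Qed.

Lemma torus_bounded f : torus_fun f -> exists B, forall z, `|f z| <= B.
Proof.
move=> tf; have [cf _] := tf.
have := continuous_compact (continuous_subspaceT cf) compact_square.
move/compact_bounded => [B [_ HB]]; exists (B + 1) => z.
have [p [q zQ]] := torus_reduce z; rewrite -(torus_int z p q tf).
by apply: (HB (B + 1)); [rewrite ltrDl|exists (z.1 + p%:~R, z.2 + q%:~R)].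
Qed.

Lemma bmf_torus f : torus_fun f -> bmf f.
Proof.
move=> tf; split; last exact: torus_bounded.
apply: (measurability _ (RGenOInfty.measurableE R)) => //.
move=> /= _ [_ [a ->] <-]; rewrite setTI; apply: open_measurable_plane.
by apply: open_comp; [move=> x _; exact: tf.1|exact: interval_open].
Qed.

(** Either some [sin2] is at least [dl ^+ 2] and the trivial bound [2 * B] is absorbed by [K], or
    both coordinates agree up to [d] modulo integers. The modulus is expressed through [sin2]
    because the kernel is estimated against it. *)
Lemma torus_modulus f e : torus_fun f -> 0 < e -> exists2 K : R, 0 <= K & forall z w,
  `|f z - f w| <= e + K * (sin2 (z.1 - w.1) + sin2 (z.2 - w.2)).
Proof.
move=> tf e0; have [d d0 Hd] := torus_uniform tf e0.
have [B HB] := torus_bounded tf.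
have B0 : 0 <= B by apply: le_trans (HB (0, 0)).
pose dl := Num.min (d / 2) (2^-1 / 2).
have dl0 : 0 < dl by rewrite lt_min !divr_gt0.
have dl1 : dl < d by rewrite gt_min ltr_pdivrMr// ltr_pMr// ltr1n.
have dl2 : dl < 2^-1 by rewrite gt_min (_ : 2^-1 / 2 < 2^-1 :> R) ?orbT//; lra.
have dd0 : 0 < dl ^+ 2 by rewrite exprn_gt0.
have s0 (x : R) : 0 <= sin2 x by rewrite sqr_ge0.
exists (2 * B / dl ^+ 2); first by rewrite divr_ge0 ?mulr_ge0// ltW.
move=> z w.
have far (x : R) : dl ^+ 2 <= x -> `|f z - f w| <= e + 2 * B / dl ^+ 2 * x.
  move=> h; apply: ler_wpDl; first exact: ltW.
  apply: (@le_trans _ _ (2 * B)).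
    by apply: (le_trans (ler_normB _ _)); have := HB z; have := HB w; lra.
  by rewrite mulrAC ler_pdivlMr// ler_wpM2l// mulr_ge0.
have close (u : R) : sin2 u < dl ^+ 2 -> exists p : int, `|u - p%:~R| < d.
  rewrite /sin2 -(real_normK (num_real _)) ltr_sqr ?nnegrE ?(ltW dl0)// => h.
  have [p hp] := near_int (lt_trans h dl2).
  by exists p; apply: (le_lt_trans hp); exact: lt_trans dl1.
have [h1|h1] := leP (dl ^+ 2) (sin2 (z.1 - w.1)).
  by apply: far; apply: (le_trans h1); rewrite lerDl.
have [h2|h2] := leP (dl ^+ 2) (sin2 (z.2 - w.2)).
  by apply: far; apply: (le_trans h2); rewrite lerDr.
have [p hp] := close _ h1; have [q hq] := close _ h2.
apply: ler_wpDr.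
  by rewrite mulr_ge0// ?addr_ge0// divr_ge0 ?mulr_ge0// ltW.
rewrite -(torus_int w p q tf); apply: Hd; rewrite prod_normE gt_max/=.
by rewrite !opprD !addrA hp hq.
Qed.

(** Values of [f] at dyadic nodes are summed against products of kernels forming a partition of
    unity, so no convolution integral enters. By [torus_modulus] the error is [e/2] plus [K] times
    two sums of [2^n] terms, each term at most [4^(-n)] by [sin2_fejer]. *)
Lemma torus_trig_approx f e : torus_fun f -> 0 < e ->
  exists2 g, trig g & forall z, `|f z - g z| <= e.
Proof.
move=> tf e0; have e2 : 0 < e / 2 by rewrite divr_gt0.
have [K K0 HK] := torus_modulus tf e2.
have [n hn] : exists n : nat, 2 * K * (2^-1) ^+ n <= e / 2.
  have d0 : 0 < (e / 2) / (2 * K + 1) by rewrite divr_gt0//; lra.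
  have : (2^-1 : R) ^+ n @[n --> \oo] --> 0.
    by apply: cvg_expr; rewrite ger0_norm// invf_lt1// ltr1n.
  move/cvgrPdist_lt => /(_ _ d0)[n _ /(_ n (leqnn _))].
  rewrite /= sub0r normrN ger0_norm ?exprn_ge0// ltr_pdivlMr; last by lra.
  move=> h; exists n; apply: le_trans (ltW h); rewrite mulrC ler_wpM2l ?exprn_ge0//.
  by lra.
pose N := (2 ^ n)%N; pose Phi := @fejer R n.
pose nd (i : 'I_N) : R := i%:R / N%:R.
pose g z := \sum_(i < N) \sum_(j < N) f (nd i, nd j) * (Phi (z.1 - nd i) * Phi (z.2 - nd j)).
exists g.
  apply: trig_sum => i; apply: trig_sum => j; apply: trigZ; apply: trigM.
    have := trig_fejer1 n (nd i) 1; congr trig; apply/funext => z; by rewrite mul1r.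
  have := trig_fejer2 n (nd j) 1; congr trig; apply/funext => z; by rewrite mul1r.
move=> z.
have S1 (x : R) : \sum_(i < N) Phi (x - nd i) = 1 by exact: sum_fejer.
have P0 (x : R) : 0 <= Phi x by exact: fejer_ge0.
have tail (x : R) : \sum_(i < N) sin2 (x - nd i) * Phi (x - nd i) <= (2^-1) ^+ n.
  apply: (@le_trans _ _ (\sum_(i < N) (4^-1) ^+ n)).
    apply: ler_sum => i _; rewrite exprVn -[leRHS]mulr1 ler_pdivlMl ?exprn_gt0//.
    exact: sin2_fejer.
  rewrite sumr_const card_ord -(mulr_natr _ N) /N natrX -exprMn.
  by rewrite (_ : 4^-1 * 2 = 2^-1 :> R)//; field.
have -> : f z - g z = \sum_(i < N) \sum_(j < N) (f z - f (nd i, nd j)) * (Phi (z.1 - nd i) * Phi (z.2 - nd j)).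
  have fz : f z = \sum_(i < N) \sum_(j < N) f z * (Phi (z.1 - nd i) * Phi (z.2 - nd j)).
    rewrite -[LHS]mulr1 -(S1 z.1) mulr_sumr; apply: eq_bigr => i _.
    by rewrite -mulr_sumr -mulr_sumr S1 mulr1.
  rewrite {1}fz /g -sumrB; apply: eq_bigr => i _; rewrite -sumrB.
  by apply: eq_bigr => j _; rewrite mulrBl.
apply: (@le_trans _ _ (\sum_(i < N) \sum_(j < N)
   (e / 2 + K * (sin2 (z.1 - nd i) + sin2 (z.2 - nd j))) * (Phi (z.1 - nd i) * Phi (z.2 - nd j)))).
  apply: (le_trans (ler_norm_sum _ _ _)); apply: ler_sum => i _.
  apply: (le_trans (ler_norm_sum _ _ _)); apply: ler_sum => j _.
  rewrite normrM [X in _ * X]ger0_norm ?mulr_ge0// ler_wpM2r ?mulr_ge0//.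
have -> : \sum_(i < N) \sum_(j < N)
   (e / 2 + K * (sin2 (z.1 - nd i) + sin2 (z.2 - nd j))) * (Phi (z.1 - nd i) * Phi (z.2 - nd j)) =
   e / 2 + K * (\sum_(i < N) sin2 (z.1 - nd i) * Phi (z.1 - nd i) +
               \sum_(j < N) sin2 (z.2 - nd j) * Phi (z.2 - nd j)).
  transitivity (\sum_(i < N) (Phi (z.1 - nd i) * (e / 2 + K * \sum_(j < N) sin2 (z.2 - nd j) * Phi (z.2 - nd j))
      + K * (sin2 (z.1 - nd i) * Phi (z.1 - nd i)))).
    apply: eq_bigr => i _; set P := Phi (z.1 - nd i); set q := sin2 _.
    transitivity (\sum_(j < N) ((e / 2 + K * q) * P * Phi (z.2 - nd j) +
        (K * P) * (sin2 (z.2 - nd j) * Phi (z.2 - nd j)))).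
      by apply: eq_bigr => j _; ring.
    by rewrite big_split/= -!mulr_sumr S1; ring.
  by rewrite big_split/= -mulr_suml S1 mul1r -mulr_sumr; ring.
have h : K * (\sum_(i < N) sin2 (z.1 - nd i) * Phi (z.1 - nd i) +
               \sum_(j < N) sin2 (z.2 - nd j) * Phi (z.2 - nd j)) <= K * ((2^-1) ^+ n + (2^-1) ^+ n).
  by rewrite ler_wpM2l// lerD.
by lra.
Qed.

Lemma iter_Tmn (m n i : nat) z : exists p q : int,
  iter i (Tmn m n) z = ((m ^ i)%:R * z.1 + p%:~R, (n ^ i)%:R * z.2 + q%:~R).
Proof.
elim: i => [|i [p [q IH]]].
  by exists 0, 0; rewrite !mulr0z !addr0 !expn0 !mul1r; case: z.
pose x := m%:R * ((m ^ i)%:R * z.1 + p%:~R); pose y := n%:R * ((n ^ i)%:R * z.2 + q%:~R).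
exists (m%:Z * p - Num.floor x), (n%:Z * q - Num.floor y).
rewrite iterS IH /Tmn /Tq /Defs.frac/= -/x -/y; congr pair.
  rewrite /x rmorphB rmorphM/= expnS natrM -pmulrn; ring.
by rewrite /y rmorphB rmorphM/= expnS natrM -pmulrn; ring.
Qed.

Lemma torus_iter f (m n i : nat) z : torus_fun f ->
  f (iter i (Tmn m n) z) = f ((m ^ i)%:R * z.1, (n ^ i)%:R * z.2).
Proof.
move=> tf; have [p [q ->]] := iter_Tmn m n i z.
exact: (torus_int ((m ^ i)%:R * z.1, (n ^ i)%:R * z.2) p q tf).
Qed.

Lemma weyl_criterion (m n : nat) z :
  (forall (j k : int) (c : R), (j != 0) || (k != 0) ->
    (fun N : nat => N%:R^-1 * \sum_(i < N) wave j k c ((m ^ i)%:R * z.1, (n ^ i)%:R * z.2)) @ \oo --> 0) ->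
  forall f, torus_fun f ->
    (fun N : nat => N%:R^-1 * \sum_(i < N) f (iter i (Tmn m n) z)) @ \oo --> Isq f.
Proof.
move=> H f tf.
pose A (g : R * R -> R) (N : nat) := N%:R^-1 * \sum_(i < N) g ((m ^ i)%:R * z.1, (n ^ i)%:R * z.2).
have tcvg g : trig g -> A g @ \oo --> Isq g.
  elim=> [|a j k c h th IH].
    rewrite Isq_cst (_ : A _ = fun=> 0); first exact: cvg_cst.
    by apply/funext => N; rewrite /A big1 ?mulr0.
  have bw : bmf (fun z => a * wave j k c z) by apply: bmfM; [exact: bmf_cst|exact: bmf_wave].
  rewrite IsqD//; last exact: bmf_trig.
  rewrite IsqZ; last exact: bmf_wave.
  rewrite (_ : A _ = fun N => a * A (wave j k c) N + A h N); last first.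
    by apply/funext => N; rewrite /A big_split/= mulrDr -mulr_sumr mulrCA.
  apply: cvgD => //; apply: cvgM; first exact: cvg_cst.
  have [jk|jk] := boolP ((j != 0) || (k != 0)); first by rewrite Isq_wave//; exact: H.
  move: jk; rewrite negb_or !negbK => /andP[/eqP -> /eqP ->].
  have wE : wave 0 0 c = fun=> cos c.
    by apply/funext => w; rewrite /wave !mulr0z !mul0r !addr0 mulr0 add0r.
  rewrite wE Isq_cst; apply/cvgrPdist_le => e e0; exists 1%N => // N /= N1.
  rewrite /A sumr_const card_ord -[cos c *+ N]mulr_natl mulKf ?subrr ?normr0 ?ltW//.
  by rewrite pnatr_eq0 -lt0n.
have -> : (fun N : nat => N%:R^-1 * \sum_(i < N) f (iter i (Tmn m n) z)) = A f.
  by apply/funext => N; congr (_ * _); apply: eq_bigr => i _; exact: torus_iter.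
apply/cvgrPdist_le => e e0.
have e3 : 0 < e / 3 by rewrite divr_gt0.
have [g tg fg] := torus_trig_approx tf e3.
have bf := bmf_torus tf; have bg := bmf_trig tg.
have /cvgrPdist_le /(_ _ e3)[N0 _ HN0] := tcvg g tg.
exists N0 => // N /= /HN0 h.
have h1 := Isq_close bf bg fg.
have h2 : `|A g N - A f N| <= e / 3.
  rewrite /A -mulrBr -sumrB normrM normfV (ger0_norm (ler0n R N)).
  have [->|N_gt0] := posnP N; first by rewrite big_ord0 normr0 mulr0 ltW.
  rewrite ler_pdivrMl ?ltr0n//; apply: (le_trans (ler_norm_sum _ _ _)).
  apply: (@le_trans _ _ (\sum_(i < N) (e / 3))).
    by apply: ler_sum => i _; rewrite distrC; exact: fg.
  by rewrite sumr_const card_ord mulr_natl.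
have -> : Isq f - A f N = (Isq f - Isq g) + (Isq g - A g N) + (A g N - A f N) by ring.
apply: (le_trans (ler_normD _ _)); have := ler_normD (Isq f - Isq g) (Isq g - A g N).
lra.
Qed.

End TorusApproximation.

(** * Genericity from the arithmetic and support hypotheses *)

(** Equality would give [ln r / ln m = - q / s], with [s] nonzero because [m ^ q > 1]. *)
Lemma irrational_powers (R : realType) (r : R) (m : nat) : 0 < r -> (1 < m)%N ->
  ~ (exists q : rat, ln r / ln m%:R = ratr q) ->
  forall q s, (0 < q)%N -> m%:R ^+ q * r ^+ s != 1.
Proof.
move=> r0 m1 irr q s q0; apply/eqP => H; apply: irr.
have m0 : 0 < m%:R :> R by rewrite ltr0n ltnW.
have lm : 0 < ln m%:R :> R by rewrite ln_gt0// ltr1n.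
have : ln (m%:R ^+ q * r ^+ s) = 0 :> R by rewrite H ln1.
rewrite lnM ?posrE ?exprn_gt0// !lnXn// => E.
have s0 : (0 < s)%N.
  rewrite lt0n; apply/eqP => s0; move: E; rewrite s0 mulr0n addr0 => /eqP.
  by rewrite mulrn_eq0 (gt_eqF lm) orbF => /eqP q00; rewrite q00 in q0.
exists (- (q%:R / s%:R)); rewrite rmorphN fmorph_div/= !ratr_nat.
have sn : s%:R != 0 :> R by rewrite pnatr_eq0 -lt0n.
have lr : ln r * s%:R = - (ln m%:R * q%:R).
  by apply/eqP; rewrite !mulr_natr -addr_eq0 addrC E.
apply: (mulIf sn); rewrite mulrAC lr mulNr; field.
by rewrite sn gt_eqF.
Qed.

Lemma supp_line (R : realType) (mu : probability (R * R)%type R) (v : R * R) (c : R) :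
  mu (line v c) = 1%E -> supp mu `<=` line v c.
Proof.
move=> m1 z sz; apply: contrapT => zc.
have cl : closed (line v c) by exact: closed_line.
have ml : measurable (line v c) by exact: measurable_line.
have := sz (~` line v c) (closed_openC cl) zc.
by rewrite (_ : mu _ = 0%E) ?ltxx//; apply: etrans (probability_setC mu ml) _; rewrite m1 subee.
Qed.

Section Genericity.
Context (R : realType) (l : nat) (r : R) (p : 'I_l -> R) (a t : 'I_l -> R * R).
Context (mu : probability (R * R)%type R) (ss : self_similar r p a t mu).
Context (X : set (R * R)) (sX : disjoint_attractor a t X).
Variables m n : nat.
Hypothesis n1 : (1 < n)%N.
Hypothesis nm : (n < m)%N.
Hypothesis irr_m : ~ (exists q : rat, ln r / ln m%:R = ratr q).
Hypothesis irr_n : ~ (exists q : rat, ln r / ln n%:R = ratr q).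
Hypothesis not_vertical : forall c, mu (line (1, 0) c) <> 1%E.
Hypothesis not_horizontal : forall c, mu (line (0, 1) c) <> 1%E.

(** If [j] is nonzero, the coordinate in [m ^ i] dominates since [n < m]: the base is [m], and the
    lines normal to [v] are vertical. If [j = 0], the frequencies are exact multiples [n ^ i] of a
    vertical [v], and these lines are horizontal. *)
Lemma wave_average_cvg0 (j k : int) (c : R) : (j != 0) || (k != 0) ->
  {ae mu, forall z, (fun N : nat => N%:R^-1 *
     \sum_(i < N) wave j k c ((m ^ i)%:R * z.1, (n ^ i)%:R * z.2)) @ \oo --> 0}.
Proof.
move=> jk; have r0 := r_gt0 ss.
have m1 : (1 < m)%N by exact: ltn_trans nm.
have m1R : 1 < m%:R :> R by rewrite ltr1n.
have n1R : 1 < n%:R :> R by rewrite ltr1n.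
have m0R : 0 < m%:R :> R by exact: lt_trans m1R.
have n0R : 0 < n%:R :> R by exact: lt_trans n1R.
pose J : R := 2 * pi * j%:~R; pose K : R := 2 * pi * k%:~R.
pose xi (i : nat) : R * R := (J * (m ^ i)%:R, K * (n ^ i)%:R).
have pi20 : 2 * pi != 0 :> R by rewrite mulf_neq0// gt_eqF// pi_gt0.
suff : {ae mu, forall z, (fun N : nat => N%:R^-1 * \sum_(i < N) cos (dot (xi i) z + c)) @ \oo --> 0}.
  apply: filterS => z; set u := fun N : nat => _ => Hz.
  rewrite (_ : (fun N : nat => _) = u) //; apply/funext => N.
  congr (_ * _); apply: eq_bigr => i _; rewrite /wave /dot /xi /J /K/=.
  by congr cos; ring.
have nrm_xi i : nrm (xi i) <= `|J| * m%:R ^+ i + `|K| * n%:R ^+ i.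
  have -> : xi i = sc (m%:R ^+ i) (J, 0) + sc (n%:R ^+ i) (0, K).
    by rewrite /xi /sc !natrX; congr pair => /=; ring.
  apply: (le_trans (nrmD _ _)); rewrite !nrmZ !normrX !normr_nat.
  rewrite /nrm/= expr0n/= addr0 add0r !sqrtr_sqr.
  by rewrite (mulrC (m%:R ^+ i)) (mulrC (n%:R ^+ i)).
have mn i : n%:R ^+ i <= m%:R ^+ i :> R.
  by apply: lerXn2r; rewrite ?nnegrE// ler_nat ltnW.
have [j0|j0] := eqVneq j 0.
  have k0 : k != 0 by move: jk; rewrite j0 eqxx.
  have K0 : K != 0 by rewrite mulf_neq0// intr_eq0.
  have J0 : J = 0 by rewrite /J j0 mulr0z mulr0.
  apply: (@cos_average_cvg0 R l r p a t mu ss X sX (0, K) _ n%:R n1R _ xi `|K|).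
  - move=> d; have -> : line (0, K) d = line (0, 1) (d / K); last exact: not_horizontal.
    apply/seteqP; split => z; rewrite /line /dot/= !mul0r !add0r mul1r.
      by move=> <-; rewrite mulrAC mulfV// mul1r.
    by move=> ->; rewrite mulrCA mulfV// mulr1.
  - exact: irrational_powers.
  - by move=> i; have := nrm_xi i; rewrite J0 normr0 mul0r add0r.
  - move=> e e0; exists 0%N => i _.
    have -> : xi i - sc (n%:R ^+ i) (0, K) = 0.
      transitivity ((0, 0) : R * R); last by [].
      by rewrite /xi /sc J0 !natrX; congr pair => /=; ring.
    by rewrite nrm0 mulr_ge0 ?exprn_ge0// ltW.
have J0 : J != 0 by rewrite mulf_neq0// intr_eq0.
apply: (@cos_average_cvg0 R l r p a t mu ss X sX (J, 0) _ m%:R m1R _ xi (`|J| + `|K|)).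
- move=> d; have -> : line (J, 0) d = line (1, 0) (d / J); last exact: not_vertical.
  apply/seteqP; split => z; rewrite /line /dot/= !mul0r !addr0 mul1r.
    by move=> <-; rewrite mulrAC mulfV// mul1r.
  by move=> ->; rewrite mulrCA mulfV// mulr1.
- exact: irrational_powers.
- by move=> i; apply: (le_trans (nrm_xi i)); rewrite mulrDl lerD2l ler_wpM2l.
- move=> e e0.
  have q01 : 0 <= (n%:R / m%:R : R) < 1.
    by apply/andP; split; [exact: divr_ge0|rewrite ltr_pdivrMr// mul1r ltr_nat].
  have d0 : 0 < e / (`|K| + 1) by rewrite divr_gt0// ltr_wpDl.
  have : (n%:R / m%:R : R) ^+ i @[i --> \oo] --> 0.
    by apply: cvg_expr; case/andP: q01 => h1 h2; rewrite ger0_norm.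
  move/cvgrPdist_lt => /(_ _ d0)[N _ HN]; exists N => i /HN.
  rewrite /= sub0r normrN ger0_norm ?exprn_ge0//.
  rewrite ltr_pdivlMr ?ltr_wpDl// expr_div_n => h.
  have -> : xi i - sc (m%:R ^+ i) (J, 0) = sc (n%:R ^+ i) (0, K).
    by rewrite /xi /sc !natrX; congr pair => /=; ring.
  rewrite nrmZ ger0_norm ?exprn_ge0// /nrm/= expr0n/= add0r sqrtr_sqr.
  have mi : 0 < m%:R ^+ i :> R by rewrite exprn_gt0.
  rewrite -ler_pdivrMr// mulrAC; apply: le_trans (ltW h).
  by rewrite ler_wpM2l ?divr_ge0 ?exprn_ge0// lerDl.
Qed.

(** The exceptional null set must not depend on the phase, so only the phases [0] and [- pi/2] are
    used; every other wave is a combination of these two by the addition formula. *)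
Lemma generic_ae : pointwise_generic_leb (Tmn m n) mu.
Proof.
have H : {ae mu, forall z, forall (j k : int), (j != 0) || (k != 0) -> forall b : bool,
   (fun N : nat => N%:R^-1 * \sum_(i < N)
     wave j k (if b then 0 else - (pi / 2)) ((m ^ i)%:R * z.1, (n ^ i)%:R * z.2)) @ \oo --> 0}.
  have : {ae mu, forall z, forall jkb : int * int * bool, (jkb.1.1 != 0) || (jkb.1.2 != 0) ->
   (fun N : nat => N%:R^-1 * \sum_(i < N)
     wave jkb.1.1 jkb.1.2 (if jkb.2 then 0 else - (pi / 2)) ((m ^ i)%:R * z.1, (n ^ i)%:R * z.2)) @ \oo --> 0}.
    (* The triples are enumerated by [pickle], which reduces the intersection of full sets to one
       along the naturals. *)
    have HH (i : nat) : {ae mu, forall z, forall jkb : int * int * bool,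
        pickle jkb = i -> (jkb.1.1 != 0) || (jkb.1.2 != 0) ->
       (fun N : nat => N%:R^-1 * \sum_(i < N)
       wave jkb.1.1 jkb.1.2 (if jkb.2 then 0 else - (pi / 2)) ((m ^ i)%:R * z.1, (n ^ i)%:R * z.2)) @ \oo --> 0}.
      have [[jkb jkbi]|no] := pselect (exists jkb : int * int * bool, pickle jkb = i); last first.
        by apply: aeW => z jkb jkbi; exfalso; apply: no; exists jkb.
      have [nz|nz] := boolP ((jkb.1.1 != 0) || (jkb.1.2 != 0)); last first.
        apply: aeW => z jkb' jkb'i; rewrite -jkbi in jkb'i.
        by rewrite (pcan_inj pickleK jkb'i) (negbTE nz).
      apply: filterS (wave_average_cvg0 (if jkb.2 then 0 else - (pi / 2)) nz) => z Hz jkb' jkb'i _.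
      by rewrite -jkbi in jkb'i; rewrite (pcan_inj pickleK jkb'i).
    move/ae_foralln: HH; apply: filterS => z Hz jkb; exact: Hz.
  by apply: filterS => z Hz j k jk b; exact: (Hz (j, k, b)).
apply: filterS H => z Hz f tf.
apply: weyl_criterion => // j k c jk.
have h0 := Hz j k jk true; have h1 := Hz j k jk false; rewrite /= in h0 h1.
have : (fun N : nat => cos c * (N%:R^-1 * \sum_(i < N) wave j k 0 ((m ^ i)%:R * z.1, (n ^ i)%:R * z.2)) -
   sin c * (N%:R^-1 * \sum_(i < N) wave j k (- (pi / 2)) ((m ^ i)%:R * z.1, (n ^ i)%:R * z.2))) @ \oo -->
   cos c * 0 - sin c * 0.
  by apply: cvgB; apply: cvgM => //; exact: cvg_cst.
rewrite !mulr0 subrr; set u := fun N : nat => _ => Hu.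
rewrite (_ : (fun N : nat => _) = u)//; apply/funext => N; rewrite /u {u Hu}.
rewrite !(mulrCA _ N%:R^-1) -mulrBr; congr (_ * _).
rewrite !mulr_sumr -sumrB; apply: eq_bigr => i _.
by rewrite /wave addr0 cosBpihalf cosD; ring.
Qed.

End Genericity.

Theorem theorem1p2 (R : realType) (m n : nat) (r : R)
  (l : nat) (p : 'I_l -> R) (O : 'I_l -> 'M[R]_2) (t : 'I_l -> R * R)
  (mu : probability (R * R)%type R) :
  (1 < n)%N -> (n < m)%N -> 0 < r < 1 ->
  ~ (exists q : rat, ln r / ln m%:R = ratr q) ->
  ~ (exists q : rat, ln r / ln n%:R = ratr q) ->
  (forall k, 0 < p k) -> \sum_(k < l) p k = 1 ->
  (forall k, exists theta : R, O k = rotmx theta) ->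
  mu (`[0, 1]%classic `*` `[0, 1]%classic) = 1%E ->
  (forall A, measurable A ->
     mu A = (\sum_(k < l) (p k)%:E * mu (simil r (O k) (t k) @^-1` A))%E) ->
  (* (1) *)
  SSC (fun k => simil r (O k) (t k)) ->
  ~ (exists a : R, supp mu `<=` [set z | z.1 = a]) ->
  ~ (exists b : R, supp mu `<=` [set z | z.2 = b]) ->
  (* (2) *)
  finite_set (GPhi O) \/ (1 < dim_measure mu)%E ->
  (* (3) *)
  (forall (k : nat) (g : R), is_kPhi O k -> is_gammaPhi O k g ->
     forall q : int, q != 0 ->
       ~ (exists z : int, q%:~R / ln m%:R = z%:~R * (g / (ln r * k%:R))) /\
       ~ (exists z : int, q%:~R / ln n%:R = z%:~R * (g / (ln r * k%:R)))) ->
  pointwise_generic_leb (Tmn m n) mu.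
Proof.
move=> n1 nm r01 irr_m irr_n p0 p1 rot mu1 self [X [[cX [X0 Xeq]] Xd]] nv nh _ _.
pose th k := projT1 (cid (rot k)).
have thE k : O k = rotmx (th k) by rewrite /th; case: cid.
pose a k := sc r (cis (th k)).
have phiE k : simil r (O k) (t k) = similarity a t k by apply/funext => z; rewrite thE similE.
have ss : self_similar r p a t mu.
  split => //.
    by move=> k; rewrite nrmZ nrm_cis mulr1 ger0_norm//; case/andP: r01 => /ltW.
  by move=> A mA; rewrite self//; apply: eq_bigr => k _; rewrite phiE.
have sX : disjoint_attractor a t X.
  split => //; first by rewrite {1}Xeq; apply: eq_bigcupr => k _; rewrite phiE.
  by move=> i j ij; rewrite -!phiE; exact: Xd.
apply: (generic_ae ss sX) => // c /supp_line sc.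
  by apply: nv; exists c => z /sc; rewrite /line /dot/= mul1r mul0r addr0.
by apply: nh; exists c => z /sc; rewrite /line /dot/= mul1r mul0r add0r.
Qed.
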